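(* Let $\mathcal H$ be a separable real Hilbert space. Let $(M_n,\mathcal F_n)_{n\ge0}$ be a martingale in $\mathcal H$ with $M_0=0$ and increments $X_n=M_n-M_{n-1}$ satisfying $\mathbb E[X_n\mid\mathcal F_{n-1}]=0$ and $\|X_n\|\le1$ a.s. for all $n\ge1$. Write $V_n=\sum_{i=1}^n\mathbb E[X_i\otimes X_i\mid\mathcal F_{i-1}]$. For $y\ge0$, $n\ge1$ and $u>1$, define \[ L_{n,u}=1\vee\bigl\{y+\Delta_\varpi\bigl(1\vee\operatorname{tr}(V_n),u\bigr)\bigr\}. \] Then for every $y\ge0$, with probability at least $1-e^{-y}$, simultaneously for all $n\ge1$, \[ \|M_n\|\le\inf_{u>1}\Bigl\{\sqrt{4u\Bigl(\operatorname{tr}(V_n)\vee\bigl\{(1\vee\|V_n\|_{\mathrm{op}})L_{n,u}\bigr\}\Bigr)+2u\operatorname{tr}(V_n)}+\frac{L_{n,u}}{\sqrt2}\Bigr\}. \]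
   Context: $\varpi$ is the Borel probability measure on $(0,\infty)$ given by \[ \varpi(d\rho)=\frac{(e+1)\,d\rho}{2\rho\,(e+|\log\rho|)\,\{e+\log(e+|\log\rho|)\}^2},\qquad\rho>0, \] where $e$ is Euler's number, and $\Delta_\varpi(a,u)=-\log\varpi([a,ua])$ for $a>0$, $u>1$. $a\vee b=\max\{a,b\}$; $\|\cdot\|_{\mathrm{op}}$ is the operator norm. $x\otimes y$ is the rank-one operator $(x\otimes y)u=\langle x,u\rangle y$, and $\mathbb E[X\otimes X\mid\mathcal G]$ is the conditional Bochner expectation in the trace-class operators, characterized by $\langle u,\mathbb E[X\otimes X\mid\mathcal G]v\rangle=\mathbb E[\langle u,X\rangle\langle X,v\rangle\mid\mathcal G]$. *)

(* Defs.v *)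
From HB Require Import structures.
From mathcomp Require Import all_boot all_order all_algebra.
From mathcomp Require Import all_classical all_reals all_analysis.

Set Implicit Arguments.
Unset Strict Implicit.
Unset Printing Implicit Defensive.

Import Order.TTheory GRing.Theory Num.Theory.
Import numFieldNormedType.Exports.

Local Open Scope classical_set_scope.
Local Open Scope ring_scope.

Definition separable (E : topologicalType) : Prop :=
  exists2 D : set E, countable D & dense D.

(* A real Hilbert space is a complete normed module [H] over [R] together with
   a symmetric positive definite bilinear form inducing its norm. *)
Definition induces_norm (R : realType) (H : completeNormedModType R)
    (dot : {dot H for idfun}) : Prop :=
  forall x : H, `|x| ^+ 2 = dot x x.

Section Operators.
Context (R : realType) (H : completeNormedModType R)
  (dot : {dot H for idfun}).

Definition bounded_linear (A : H -> H) : Prop :=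
  linear A /\ exists k : R, forall x, `|A x| <= k * `|x|.

Definition opnorm (A : H -> H) : R := sup [set `|A x| | x in [set x | `|x| <= 1]].

(* Zero vectors are allowed in the sequence, so that finite-dimensional spaces
   also have orthonormal bases indexed by [nat]; they contribute nothing to the
   Fourier expansions or to the traces below. *)
Definition orthonormal_basis (e : nat -> H) : Prop :=
  [/\ forall i j, i != j -> dot (e i) (e j) = 0,
      forall i, e i = 0 \/ `|e i| = 1
    & forall x, series (fun i => dot (e i) x *: e i) @ \oo --> x].

(* A fixed orthonormal basis; one exists because H is separable. *)
Definition onb : nat -> H := xget (fun=> 0) [set e | orthonormal_basis e].

Definition trace_series (A : H -> H) : nat -> R :=
  series (fun i => dot (onb i) (A (onb i))).

(* For trace-class operators the trace does not depend on the basis. *)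
Definition trace (A : H -> H) : R := limn (trace_series A).

(* B = |A|, that is, B is positive self-adjoint and B^2 = A^* A. *)
Definition is_operator_abs (A B : H -> H) : Prop :=
  [/\ bounded_linear B,
      forall x y, dot x (B y) = dot (B x) y,
      forall x, 0 <= dot x (B x)
    & forall x y, dot (B x) (B y) = dot (A x) (A y)].

Definition trace_class (A : H -> H) : Prop :=
  bounded_linear A /\ exists2 B, is_operator_abs A B & cvgn (trace_series B).

End Operators.

Section ConditionalExpectation.
Context (R : realType) (d : measure_display) (T : measurableType d)
  (P : probability T R).

Definition sub_sigma_algebra_of (G : set (set T)) : Prop :=
  sigma_algebra setT G /\ G `<=` measurable.

Definition filtration (F : nat -> set (set T)) : Prop :=
  (forall n, sub_sigma_algebra_of (F n)) /\ forall n, F n `<=` F n.+1.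

Definition measurable_wrt (G : set (set T)) d' (T' : measurableType d')
    (X : T -> T') : Prop :=
  @measurable_fun _ _ (g_sigma_algebraType G) T' setT X.

(* Y is a version of the conditional expectation of Z given G. *)
Definition is_cond_exp (G : set (set T)) (Z Y : T -> R) : Prop :=
  [/\ P.-integrable setT (EFin \o Z),
      measurable_wrt G Y,
      P.-integrable setT (EFin \o Y)
    & forall A, G A ->
        (\int[P]_(w in A) (Y w)%:E = \int[P]_(w in A) (Z w)%:E)%E].

Context (E : normedModType R).

Definition borel_wrt (G : set (set T)) (X : T -> E) : Prop :=
  @measurable_wrt G _ (g_sigma_algebraType (@open E)) X.

Definition simple_function (s : T -> E) : Prop :=
  finite_set (range s) /\ forall x, measurable (s @^-1` [set x]).

Definition simple_integral (D : set T) (s : T -> E) : E :=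
  \sum_(x \in [set: E]) fine (P (D `&` s @^-1` [set x])) *: x.

Definition is_bochner_integral (D : set T) (X : T -> E) (v : E) : Prop :=
  exists s : nat -> T -> E,
    [/\ forall k, simple_function (s k),
        (\int[P]_(w in D) (`|X w - s k w|)%:E)%E @[k --> \oo] --> 0%E
      & simple_integral D (s k) @[k --> \oo] --> v].

(* Bochner integrability on a separable space, where Borel measurability and
   strong measurability agree. *)
Definition bochner_integrable (X : T -> E) : Prop :=
  borel_wrt measurable X /\ P.-integrable setT (fun w => (`|X w|)%:E).

(* Y is a version of the conditional Bochner expectation of X given G. *)
Definition is_bochner_cond_exp (G : set (set T)) (X Y : T -> E) : Prop :=
  [/\ bochner_integrable X,
      borel_wrt G Y,
      bochner_integrable Y
    & forall A, G A ->
        exists2 v, is_bochner_integral A X v & is_bochner_integral A Y v].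

Definition martingale (F : nat -> set (set T)) (M : nat -> T -> E) : Prop :=
  [/\ filtration F,
      forall n, borel_wrt (F n) (M n),
      forall n, bochner_integrable (M n)
    & forall n, is_bochner_cond_exp (F n) (M n.+1) (M n)].

Definition increment (M : nat -> T -> E) (n : nat) : T -> E :=
  fun w => M n w - M n.-1 w.

End ConditionalExpectation.

Section ConditionalCovariance.
Context (R : realType) (H : completeNormedModType R)
  (dot : {dot H for idfun}) (d : measure_display) (T : measurableType d)
  (P : probability T R).

(* C is a version of the conditional Bochner expectation of X (x) X given G in
   the trace-class operators, through its weak characterization. *)
Definition is_cond_cov (G : set (set T)) (X : T -> H) (C : T -> H -> H) : Prop :=
  (forall w, trace_class dot (C w)) /\
  forall u v : H, is_cond_exp P G (fun w => dot u (X w) * dot (X w) v)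
                                  (fun w => dot u (C w v)).

(* V_n, where [C i] is the conditional covariance of the i-th increment. *)
Definition pqv (C : nat -> T -> H -> H) (n : nat) (w : T) : H -> H :=
  fun h => \sum_(1 <= i < n.+1) C i w h.

End ConditionalCovariance.

Section Bound.
Context (R : realType).

Definition varpi_density (rho : R) : R :=
  let e := expR 1 in
  (e + 1) /
  (2 * rho * (e + `|ln rho|) * (e + ln (e + `|ln rho|)) ^+ 2).

Definition varpi (A : set R) : \bar R :=
  (\int[lebesgue_measure]_(rho in A `&` [set rho | 0 < rho]%R)
    (varpi_density rho)%:E)%E.

Definition Delta_varpi (a u : R) : R := - ln (fine (varpi `[a, u * a])).

Definition Lterm (y trV u : R) : R :=
  Num.max 1 (y + Delta_varpi (Num.max 1 trV) u).

Definition deviation_bound (y trV opV : R) : R :=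
  inf [set Num.sqrt (4 * u * Num.max trV (Num.max 1 opV * Lterm y trV u)
                     + 2 * u * trV)
           + Lterm y trV u / Num.sqrt 2 | u in [set u : R | 1 < u]].

End Bound.

(* Main.v *)
From HB Require Import structures.
Require Import Defs.
From mathcomp Require Import all_boot all_order all_algebra.
From mathcomp Require Import all_classical all_reals all_analysis.
From mathcomp Require Import measurable_realfun.
From mathcomp Require Import ring lra.

Set Implicit Arguments.
Unset Strict Implicit.
Unset Printing Implicit Defensive.

Import Order.TTheory GRing.Theory Num.Theory.
Import numFieldNormedType.Exports.

Local Open Scope classical_set_scope.
Local Open Scope ring_scope.

(* The norm of [M n] is the supremum of the linear functionals [dot v (M n)].
   For a random direction [theta] drawn from a prior, the mixture of the
   processes [exp <theta, M n>], each normalized by the product of its exact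
   conditional Laplace transforms, is a nonnegative martingale, so Ville's
   inequality bounds it by [exp y] uniformly in [n]. The Gibbs variational
   formula then bounds [dot v (M n)] by [y], plus the relative entropy of a
   posterior of mean [v] with respect to the prior, plus the logarithms of the
   Laplace transforms averaged over the posterior, which are controlled by the
   quadratic form and the trace of [V n].

   Ideally the prior is a centered Gaussian of covariance [rho^-1], with [rho]
   drawn from [varpi]; the posterior is its translate, of relative entropy
   [rho * |v|^2 / 2]. To remain within finite sums, level [N] of the argument
   replaces the Gaussian by a normalized sum of independent signs along the first
   [N + 1] basis vectors, translation by a tilt of these signs, and the law of
   [rho] by an atomic measure on a grid of mesh [1 / (N + 1)]; the errors vanish
   as [N] tends to [+oo]. It remains to optimize over [rho] in [[1, 1 \/ tr V]]
   and [lam = |v|] in [(0, 3/2]]. Restricting [varpi] to [[1, +oo[], of mass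
   [1/2], gains [ln 2 >= 69/100], which absorbs the lower-order terms. *)

(** The posterior depends on [v], [rho] and [u], the mixture only on the prior: one Ville event
    serves all directions, all [u] and all times, so [rho] and [lam] may be chosen after seeing
    [V n]. Normalizing by the exact Laplace transforms, rather than by upper bounds of them, leaves
    only their posterior average to be estimated, through [ln D <= D - 1]. For the Gaussian
    posterior this average is the conditional mean of [exp (<v, X> + |X|^2 / (2 rho))], whose
    expansion to second order gives [<v, C v>] and [tr C / rho]. This conditional estimate holds
    almost surely only for each fixed [v], hence the directions run over a countable dense sequence.
    The mixtures of different levels are unrelated and no limit of them is taken: only the lower
    limit of their exceptional sets is used, and its probability is still at most [exp (- y)]. The
    factor [u] is the price of selecting one grid point in the window [[rho, u * rho]]; the prior
    mass of that window, about [2 * varpi [rho, u * rho]], is the origin of [Delta_varpi]. *)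

(** * Countable combinations of almost sure statements *)

Section AlmostEverywhere.
Context (R : realType) (d : measure_display) (T : measurableType d)
  (P : probability T R).

Lemma aeW (A B : T -> Prop) : (forall w, A w -> B w) ->
  {ae P, forall w, A w} -> {ae P, forall w, B w}.
Proof.
by move=> AB; apply: (@filterS _ _ (ae_filter_ringOfSetsType P)) => w; exact: AB.
Qed.

Lemma ae_and (A B : T -> Prop) : {ae P, forall w, A w} ->
  {ae P, forall w, B w} -> {ae P, forall w, A w /\ B w}.
Proof.
by apply: (@filterS2 _ _ (ae_filter_ringOfSetsType P)) => w; split.
Qed.

Lemma ae_forall (A : nat -> T -> Prop) :
  (forall n, {ae P, forall w, A n w}) -> {ae P, forall w, forall n, A n w}.
Proof.
move=> Aae; have := negligible_bigcup Aae; apply: negligibleS => w /=.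
by move=> /existsNP[n An]; exists n.
Qed.

End AlmostEverywhere.

(** * Finite measures with a density *)

Section DensityMeasure.
Context (R : realType) (d : measure_display) (T : measurableType d)
  (P : probability T R) (Z : T -> R).
Hypotheses (mZ : measurable_fun setT Z) (Z0 : forall w, 0 <= Z w)
  (iZ : P.-integrable setT (EFin \o Z)).
Local Open Scope ereal_scope.

(** The hypotheses on [Z] are arguments so that the finite measure structure can be attached to the
    function itself. *)
Definition density_measure_of & measurable_fun setT Z & (forall w, (0 <= Z w)%R)
    & P.-integrable setT (EFin \o Z) : set T -> \bar R :=
  fun A => \int[P]_(w in A) (Z w)%:E.

Local Notation nu := (density_measure_of mZ Z0 iZ).

Let nu0 : nu set0 = 0. Proof. exact: integral_set0. Qed.

Let nu_ge0 A : 0 <= nu A.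
Proof. by apply: integral_ge0 => w _; rewrite lee_fin. Qed.

Let nu_sigma_additive : semi_sigma_additive nu.
Proof.
apply: semi_sigma_additive_nng_induced; first exact/measurable_EFinP.
by move=> w; rewrite lee_fin.
Qed.

HB.instance Definition _ := isMeasure.Build _ _ _ nu
  nu0 nu_ge0 nu_sigma_additive.

Let nu_fin : fin_num_fun nu.
Proof.
by move=> A mA; apply: integrable_fin_num => //; exact: (integrableS measurableT).
Qed.

HB.instance Definition _ := Measure_isFinite.Build _ _ _ nu nu_fin.

(** The Radon-Nikodym derivative has the same integrals as [Z] over all measurable sets, hence
    equals [Z] almost everywhere; the change of variables formula then transfers to [Z]. *)
Lemma ge0_integral_density (f : T -> \bar R) :
  measurable_fun setT f -> (forall w, 0 <= f w) ->
  \int[nu]_w f w = \int[P]_w (f w * (Z w)%:E).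
Proof.
move=> mf f0.
have nuP : nu `<< P.
  apply/null_content_dominatesP => A mA PA.
  rewrite /= /density_measure_of null_set_integral//.
  exact/measurable_funTS/measurable_EFinP.
rewrite -(Radon_Nikodym_SigmaFinite.change_of_variables nuP)//.
set g := Radon_Nikodym_SigmaFinite.f _ _.
have ig : P.-integrable setT g by exact: Radon_Nikodym_SigmaFinite.f_integrable.
have gZ : ae_eq P setT g (EFin \o Z).
  apply: integral_ae_eq => //; first exact/measurable_EFinP.
  by move=> E _ mE; rewrite -(Radon_Nikodym_SigmaFinite.f_integral nuP).
apply: ae_eq_integral => //.
- by apply: emeasurable_funM => //; exact: measurable_int ig.
- by apply: emeasurable_funM => //; exact/measurable_EFinP.
- by apply: filterS gZ => w /= /(_ I) ->.
Qed.

End DensityMeasure.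

(** * Measurability with respect to a sub-sigma-algebra *)

Section SubSigmaAlgebra.
Context (R : realType) (d : measure_display) (T : measurableType d)
  (P : probability T R) (G : set (set T)).
Hypothesis sG : sub_sigma_algebra_of G.

Local Notation TG := (g_sigma_algebraType G).

Lemma sub_sigma_measurable (A : set T) :
  @measurable _ TG A = G A.
Proof. by rewrite measurable_g_measurableTypeE//; case: sG. Qed.

Lemma measurable_id_sub : @measurable_fun _ _ T TG setT id.
Proof.
move=> _ A; rewrite sub_sigma_measurable setTI preimage_id.
by case: sG => _ sGm; exact: sGm.
Qed.

Lemma measurable_wrtW d' (T' : measurableType d') (f : T -> T') :
  measurable_wrt G f -> measurable_fun setT f.
Proof.
move=> mf _ B mB; case: sG => _ sGm; apply: sGm.
by rewrite -sub_sigma_measurable; exact: mf.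
Qed.

Lemma measurable_wrtP d' (T' : measurableType d') (f : T -> T') :
  measurable_wrt G f <-> forall B, measurable B -> G (f @^-1` B).
Proof.
split=> [mf B mB|Gf _ B mB].
  by rewrite -sub_sigma_measurable -[X in measurable X]setTI; exact: mf.
by rewrite setTI sub_sigma_measurable; exact: Gf.
Qed.

End SubSigmaAlgebra.

(** * Densities restricted to a sub-sigma-algebra *)

Section SubDensity.
Context (R : realType) (d : measure_display) (T : measurableType d)
  (P : probability T R) (G : set (set T)) (Z : T -> R).
Hypotheses (sG : sub_sigma_algebra_of G)
  (mZ : measurable_fun setT Z) (Z0 : forall w, 0 <= Z w)
  (iZ : P.-integrable setT (EFin \o Z)).
Local Open Scope ereal_scope.

Local Notation TG := (g_sigma_algebraType G).

(** Pushing forward along the identity restricts the measure to the sets of [G], as a measure on a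
    space whose measurable sets are exactly these. *)
Definition sub_density of sub_sigma_algebra_of G :=
  fun (mZ' : measurable_fun setT Z) (Z0' : forall w, (0 <= Z w)%R)
    (iZ' : P.-integrable setT (EFin \o Z)) =>
  (pushforward (density_measure_of mZ' Z0' iZ') (id : T -> TG)
   : set TG -> \bar R).

Local Notation nu := (sub_density sG mZ Z0 iZ).

Let subG (A : set TG) : measurable A -> measurable (A : set T).
Proof. by rewrite sub_sigma_measurable//; case: sG => _ sGm; exact: sGm. Qed.

Let nu0 : nu set0 = 0. Proof. exact: (measure0 (density_measure_of mZ Z0 iZ)). Qed.

Let nu_ge0 A : 0 <= nu A.
Proof. exact: (measure_ge0 (density_measure_of mZ Z0 iZ)). Qed.

Let nu_sigma_additive : semi_sigma_additive nu.
Proof.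
move=> F mF tF mUF; apply: (@measure_semi_sigma_additive _ _ _ (density_measure_of mZ Z0 iZ)) => //.
- by move=> i; apply: subG; exact: mF.
- by apply: subG; exact: mUF.
Qed.

HB.instance Definition _ := isMeasure.Build _ _ _ nu
  nu0 nu_ge0 nu_sigma_additive.

Let nu_fin : fin_num_fun nu.
Proof.
by move=> A /subG mA; exact: (fin_num_measure (density_measure_of mZ Z0 iZ)).
Qed.

HB.instance Definition _ := Measure_isFinite.Build _ _ _ nu nu_fin.

Lemma ge0_integral_sub_density (f : T -> \bar R) :
  measurable_wrt G f -> (forall w, 0 <= f w) ->
  \int[nu]_w f w = \int[P]_w (f w * (Z w)%:E).
Proof.
move=> mf f0; rewrite -(ge0_integral_density mZ Z0 iZ)//; last first.
  exact: measurable_wrtW mf.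
exact: (ge0_integral_pushforward (measurable_id_sub sG)).
Qed.

End SubDensity.

(** * Existence of bounded conditional expectations *)

Section ConditionalExpectationExistence.
Context (R : realType) (d : measure_display) (T : measurableType d)
  (P : probability T R) (G : set (set T)).
Hypothesis sG : sub_sigma_algebra_of G.

Local Notation TG := (g_sigma_algebraType G).

Lemma bounded_integrable (Z : T -> R) (C : R) :
  measurable_fun setT Z -> (forall w, `|Z w| <= C) ->
  P.-integrable setT (EFin \o Z).
Proof.
move=> mZ ZC.
apply: (@le_integrable _ _ _ P setT measurableT _ (cst C%:E)).
- exact/measurable_EFinP.
- by move=> w _; rewrite /= lee_fin (le_trans (ZC w))// ler_norm.
- exact: finite_measure_integrable_cst.
Qed.

(** The exceptional set [f2 < f1] belongs to [G], so the hypothesis applies to it and forces the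
    positive function [f1 - f2] to have zero integral there. *)
Lemma ae_le_of_integral (f1 f2 : T -> R) :
  measurable_wrt G f1 -> measurable_wrt G f2 ->
  P.-integrable setT (EFin \o f1) -> P.-integrable setT (EFin \o f2) ->
  (forall A, G A ->
    (\int[P]_(w in A) (f1 w)%:E <= \int[P]_(w in A) (f2 w)%:E)%E) ->
  {ae P, forall w, f1 w <= f2 w}.
Proof.
move=> mf1 mf2 if1 if2 f12.
pose A := [set w | f2 w < f1 w].
have GA : G A.
  rewrite -sub_sigma_measurable// -[A]setTI.
  exact: (@measurable_fun_ltr _ TG).
have mA : measurable A by case: sG => _ sGm; exact: sGm.
have if1A : P.-integrable A (EFin \o f1) by exact: (integrableS measurableT).
have if2A : P.-integrable A (EFin \o f2) by exact: (integrableS measurableT).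
have mD : measurable_fun A (fun w => (f1 w - f2 w)%:E).
  apply/measurable_EFinP; apply: measurable_funB.
    by apply: measurable_funTS; exact: measurable_wrtW mf1.
  by apply: measurable_funTS; exact: measurable_wrtW mf2.
have D0 : (\int[P]_(w in A) `|(f1 w - f2 w)%:E| = 0)%E.
  apply/eqP; rewrite eq_le; apply/andP; split; last exact: integral_ge0.
  rewrite (eq_integral (fun w => (f1 w)%:E - (f2 w)%:E)%E); last first.
    move=> w; rewrite inE /A /= => fw.
    by rewrite ger0_norm ?subr_ge0 1?ltW.
  by rewrite integralB// sube_le0 f12.
have /(ae_eq_integral_abs _ mA mD) := D0.
apply: filterS => w /= H.
by rewrite leNgt; apply/negP => /[dup] /H[] /eqP; rewrite subr_eq0 => /eqP ->; rewrite ltxx.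
Qed.

(** The bounds hold at every point because the Laplace transforms obtained from this lemma are later
    inverted and passed to [ln]. Testing against all nonnegative [f], integrable or not, is what the
    martingale property of the exponential processes requires. *)
Lemma cond_exp_exists (Z : T -> R) (a b : R) :
  measurable_fun setT Z -> 0 <= a -> (forall w, a <= Z w <= b) ->
  exists Y : T -> R, [/\ measurable_wrt G Y, forall w, a <= Y w <= b
   & forall f : T -> R, measurable_wrt G f -> (forall w, 0 <= f w) ->
     (\int[P]_w (f w * Y w)%:E = \int[P]_w (f w * Z w)%:E)%E].
Proof.
move=> mZ a0 Zab.
have Z0 w : 0 <= Z w by have /andP[+ _] := Zab w; exact: le_trans.
have b0 : a <= b by have /andP[p q] := Zab point; exact: le_trans p q.
have iZ : P.-integrable setT (EFin \o Z).
  apply: (@bounded_integrable _ b) => // w.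
  by rewrite ger0_norm//; case/andP: (Zab w).
have i1 : P.-integrable setT (EFin \o cst (1 : R)).
  exact: finite_measure_integrable_cst.
have o1 (w : T) : 0 <= cst (1 : R) w by [].
pose nu : {finite_measure set TG -> \bar R} := sub_density sG mZ Z0 iZ.
(* The density [1] encodes the restriction of [P] to [G]. *)
pose mu : {finite_measure set TG -> \bar R} :=
  sub_density sG (@measurable_cst _ _ T R setT 1) o1 i1.
have numu : nu `<< mu.
  apply/null_content_dominatesP => /= A mA muA.
  have mA' : measurable (A : set T).
    by move: mA; rewrite sub_sigma_measurable//; case: sG => _ sGm; exact: sGm.
  have PA : P A = 0.
    transitivity (\int[P]_(w in A) cst 1 w)%E; last exact: muA.
    by rewrite integral_cst// mul1e.
  change (\int[P]_(w in A) (Z w)%:E = 0)%E.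
  rewrite null_set_integral//.
  exact/measurable_funTS/measurable_EFinP.
pose g := Radon_Nikodym_SigmaFinite.f nu mu.
have ig : mu.-integrable setT g by exact: Radon_Nikodym_SigmaFinite.f_integrable.
have g0 w : (0 <= g w)%E by exact: Radon_Nikodym_SigmaFinite.f_ge0.
have gfin w : g w \is a fin_num by exact: Radon_Nikodym_SigmaFinite.f_fin_num.
have mg : measurable_wrt G g by exact: measurable_int ig.
have key (f : T -> \bar R) : measurable_wrt G f -> (forall w, 0 <= f w)%E ->
   (\int[P]_w (f w * g w) = \int[P]_w (f w * (Z w)%:E))%E.
  move=> mf f0; rewrite -(ge0_integral_sub_density sG mZ Z0 iZ mf f0).
  rewrite -(Radon_Nikodym_SigmaFinite.change_of_variables numu)//.
  rewrite ge0_integral_sub_density//; last 2 first.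
    exact: emeasurable_funM.
    by move=> w; rewrite mule_ge0.
  by under [RHS]eq_integral do rewrite mule1.
(* Clamping yields the bounds everywhere; it changes nothing almost surely, since [g] already lies
   in [[a, b]] almost everywhere. *)
pose y w := Num.min b (Num.max a (fine (g w))).
have mfg : measurable_wrt G (fun w => fine (g w)).
  exact: (@measurableT_comp _ _ _ TG _ _ fine _ g).
have my : measurable_wrt G y.
  by apply: measurable_minr => //; apply: measurable_maxr.
exists y; split => //.
  move=> w; rewrite /y le_min b0/= le_max lexx/=.
  by rewrite ge_min lexx.
suff yg : {ae P, forall w, y w = fine (g w)}.
  move=> f mf f0; under [RHS]eq_integral do rewrite EFinM.
  rewrite -key; last 2 first.
    exact/measurable_EFinP.
    by move=> w; rewrite lee_fin.
  apply: ae_eq_integral => //.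
  - apply/measurable_EFinP; apply: measurable_funM.
      exact: measurable_wrtW mf.
    exact: measurable_wrtW my.
  - apply: emeasurable_funM; last exact: measurable_wrtW mg.
    by apply/measurable_EFinP; exact: measurable_wrtW mf.
  - by apply: aeW yg => w -> _; rewrite EFinM fineK.
have intA A : G A ->
    (\int[P]_(w in A) (fine (g w))%:E = \int[P]_(w in A) (Z w)%:E)%E.
  move=> GA; rewrite integral_mkcond [RHS]integral_mkcond !epatch_indic.
  under eq_integral do rewrite /= fineK// muleC.
  under [RHS]eq_integral do rewrite /= muleC.
  apply: key; last by move=> w; rewrite lee_fin.
  apply/measurable_EFinP; apply: (@measurable_indic _ TG).
  by rewrite sub_sigma_measurable.
have ifg : P.-integrable setT (EFin \o (fun w => fine (g w))).
  apply/integrableP; split.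
    by apply/measurable_EFinP; exact: measurable_wrtW mfg.
  under eq_integral do rewrite /= ger0_norm ?fine_ge0//.
  rewrite intA; last by rewrite -sub_sigma_measurable//; exact: measurableT.
  by have /integrable_fin_num := iZ; move=> /(_ measurableT); rewrite fin_numE => /andP[_ H]; rewrite ltey.
have icst (c : R) : P.-integrable setT (EFin \o cst c).
  exact: finite_measure_integrable_cst.
have ag : {ae P, forall w, a <= fine (g w)}.
  apply: (ae_le_of_integral (f1 := cst a)) => // [|A GA].
    exact: measurable_cst.
  have mA : measurable A by case: sG => _ sGm; exact: sGm.
  rewrite intA//; apply: le_integral => //.
  - exact: (integrableS measurableT mA (@subsetT _ _) (icst a)).
  - exact: (integrableS measurableT mA (@subsetT _ _) iZ).
  - by move=> w _; rewrite lee_fin; case/andP: (Zab w).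
have gb : {ae P, forall w, fine (g w) <= b}.
  apply: (ae_le_of_integral (f2 := cst b)) => // [|A GA].
    exact: measurable_cst.
  have mA : measurable A by case: sG => _ sGm; exact: sGm.
  rewrite intA//; apply: le_integral => //.
  - exact: (integrableS measurableT mA (@subsetT _ _) iZ).
  - exact: (integrableS measurableT mA (@subsetT _ _) (icst b)).
  - by move=> w _; rewrite lee_fin; case/andP: (Zab w).
by apply: aeW (ae_and ag gb) => w [ag' gb']; rewrite /y max_r// min_r.
Qed.

End ConditionalExpectationExistence.

(** * The optimization over [lam], reduced to numerical inequalities *)

Section ScalarOptimization.
Context (R : realType).
Implicit Types (r tau b k p h lam : R).

(** Reduces an inequality affine in [b] to the two ends of [[0, bm]]. *)
Lemma mul_le_max b bm (c : R) : 0 <= b -> b <= bm -> b * c <= 0 \/ b * c <= bm * c.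
Proof.
move=> b0 bbm; case: (lerP c 0) => c0; [left|right].
  by rewrite mulr_ge0_le0.
by rewrite ler_wpM2r// ltW.
Qed.

Lemma mul_le1 (t x : R) : t <= 1 -> 0 <= x -> t * x <= x.
Proof. by move=> t1 x0; rewrite ler_piMl. Qed.

(* The cases of [scalar_optimization], with [p = sqrt r] and [h = tau * r]: the
   witness is [lam = sqrt (r * (1 + tau / 2))] for small [r], and otherwise
   [lam = 39 / 50], [1], [3 / 2] for mid, large, huge [r]. The flat cases have
   [k = 1], the root cases [k = sqrt (tau * r)]; [70 / 99] and [2 + 22 / 49 * tau]
   are lower bounds for [1 / sqrt 2] and [sqrt (4 + 2 * tau)]. *)
Lemma small_case q h b : 0 < q -> q * q <= 27 / 40 -> 0 <= h -> 3 * h <= 2 * (q * q) ->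
  0 <= b ->
  let m := (1 - q / 3)^-1 in
  let r := q * q - h / 2 in
  q * q / 2 * (m + 1 + 13 / 20 * b * (m + q^-1))
    + h / 2 * (1 + 3 / 10 * b) * (1 + q / 2) + r - 69 / 100 * b
  <= q * (2 * q) + q * r * (70 / 99).
Proof.
move=> q0 qq h0 hq b0 /=.
have q1 : q <= 37 / 45 by nra.
have mE : (1 - q / 3)^-1 * (1 - q / 3) = 1 by rewrite mulVf//; lra.
have m0 : 0 <= (1 - q / 3)^-1 by rewrite invr_ge0; lra.
move: (1 - q / 3)^-1 mE m0 => m mE m0.
(* After multiplication by [1 - q / 3] this amounts to [q <= 19 / 23], which [q <= 37 / 45]
   ensures. *)
have m1 : m <= 1 + 46 / 100 * q.
  rewrite -(@ler_pM2r _ (1 - q / 3)); last by lra.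
  by rewrite mE; nra.
have qi : q * q^-1 = 1 by rewrite mulfV// gt_eqF.
move: (q^-1) qi => qv qi.
have -> : q * q / 2 * (m + 1 + 13 / 20 * b * (m + qv)) =
   q * q / 2 * (m + 1) + 13 / 40 * b * (m * (q * q) + q * (q * qv)) by field.
rewrite qi mulr1.
have E1 : q * q * m <= q * q * (1 + 46 / 100 * q).
  by apply: ler_wpM2l => //; nra.
(* The whole coefficient of [b]: the gain [69 / 100] coming from [ln 2] outweighs the lower-order
   terms. *)
have B : 13 / 40 * (m * (q * q) + q) + 15 / 100 * h + 3 / 40 * (h * q) - 69 / 100 <= 0.
  have : h * q <= 2 / 3 * (q * q) * q by nra.
  have : q * q * q <= 27 / 40 * (37 / 45) by nra.
  nra.
have Bb : b * (13 / 40 * (m * (q * q) + q) + 15 / 100 * h + 3 / 40 * (h * q) - 69 / 100) <= 0.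
  by rewrite mulr_ge0_le0.
have : q * h <= 2 / 3 * (q * (q * q)) by nra.
have : 0 <= q * (q * q) by nra.
nra.
Qed.

Lemma mid_case_flat p h tau b : 9 / 20 <= p * p -> p * p <= 3 / 2 -> 0 < p ->
  0 <= tau <= 1 -> h = tau * (p * p) -> h <= 1 -> 0 <= b <= 1 -> b <= p * p ->
  39 / 50 * (39 / 50) / 2 * (50 / 37 + 1 + 13 / 20 * b * (50 / 37 + 50 / 39))
   + h / 2 * (1 + 3 / 10 * b) * (139 / 100) + p * p - 69 / 100 * b
  <= 39 / 50 * (p * (2 + 22 / 49 * tau)) + 39 / 50 * (p * p) * (70 / 99).
Proof.
move=> pl pu p0 /andP[t0 t1] hE h1 /andP[b0 b1] bp.
have p1 : 67 / 100 <= p by nra.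
have p2 : p <= 49 / 40 by nra.
have h0 : 0 <= h by rewrite hE; nra.
have hb0 : 0 <= h * b by rewrite mulr_ge0.
have tp0 : 0 <= tau * p by rewrite mulr_ge0// ltW.
suff main : 43 / 60 + 139 / 200 * h + 9 / 20 * (p * p)
    + b * (21 / 100 * h - 1 / 6)
    <= 156 / 100 * p + 7 / 20 * (tau * p) by lra.
(* For [p <= 1] the effective constraints are [tau <= 1] and [b <= p * p]; for [p > 1] they are
   [h <= 1] and [b <= 1]. *)
have [ple1|pgt1] := lerP p 1.
  have th : tau * (139 / 200 * (p * p) - 7 / 20 * p) <=
      139 / 200 * (p * p) - 7 / 20 * p.
    by apply: mul_le1; [exact: t1|clear -p1; nra].
  (* Chord of the square over [[67 / 100, 1]]. *)
  have pp : p * p <= 167 / 100 * p - 67 / 100 by clear -p1 ple1; nra.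
  have [] := mul_le_max (21 / 100 * h - 1 / 6) b0 bp => bm; first by rewrite hE in bm *; lra.
  have hp : p * p * h <= p * p * (p * p).
    by apply: ler_wpM2l; rewrite ?mulr_ge0// ?(ltW p0)// hE ler_piMl// mulr_ge0// ltW.
  have p3 : p * (p * p) <= p * (167 / 100 * p - 67 / 100).
    exact: ler_wpM2l (ltW p0) _ _ pp.
  have p4 : p * (p * (p * p)) <= p * (p * (167 / 100 * p - 67 / 100)).
    by apply: ler_wpM2l (ltW p0) _ _ _; exact: p3.
  rewrite hE in bm hp *; lra.
have gE : p * p^-1 = 1 by rewrite mulfV// gt_eqF.
have g00 : 0 < p^-1 by rewrite invr_gt0.
move: (p^-1) gE g00 => g gE g00.
have g1 : g <= 1 by clear -gE g00 pgt1; nra.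
have g0 : 8 / 10 <= g by clear -gE g00 p2; nra.
have g2 : 2 - p <= g by clear -gE g00 pgt1; nra.
have tp : tau * p = h * g by rewrite hE -!mulrA gE mulr1.
have hg : h * (139 / 200 - 7 / 20 * g) <= 139 / 200 - 7 / 20 * g.
  by apply: mul_le1; [exact: h1|lra].
have pp : p * p <= 89 / 40 * p - 49 / 40 by clear -p2 pgt1; nra.
have [] := mul_le_max (21 / 100 * h - 1 / 6) b0 b1 => bm; rewrite tp; first lra.
have : 21 / 100 * h <= 21 / 100 by lra.
lra.
Qed.

Lemma mid_case_root p k ki b : 1 <= k -> k <= p -> k * ki = 1 -> p * p <= 3 / 2 ->
  0 <= b <= 1 ->
  39 / 50 * (39 / 50) / 2 * (50 / 37 + k + 13 / 20 * (b * ki) * (50 / 37 + 50 / 39))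
   + k / 2 * (1 + 3 / 10 * (b * ki)) * (139 / 100) + p * p - 69 / 100 * b
  <= 39 / 50 * (2 * p + 22 / 49 * (k * (k * p^-1))) + 39 / 50 * (p * p) * (70 / 99).
Proof.
move=> k1 kp kk pu /andP[b0 b1].
have p2 : p <= 49 / 40 by clear -k1 kp pu; nra.
have p0 : 0 < p by lra.
have gE : p * p^-1 = 1 by rewrite mulfV// gt_eqF.
have g00 : 0 < p^-1 by rewrite invr_gt0.
move: (p^-1) gE g00 => g gE g00.
have ki0 : 0 <= ki by clear -kk k1; nra.
have ki1 : ki <= 1 by clear -kk k1 ki0; nra.
have kb : k * (b * ki) = b by rewrite mulrCA kk mulr1.
have g2 : 2 - p <= g.
  have : 0 <= g * ((p - 1) * (p - 1)) by apply: mulr_ge0; [exact: ltW|rewrite -expr2; exact: sqr_ge0].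
  have -> : g * ((p - 1) * (p - 1)) = p * (p * g) - 2 * (p * g) + g by ring.
  by rewrite gE; lra.
have kib : 0 <= b * ki by rewrite mulr_ge0.
have kg : 0 <= k * (k * g) by rewrite !mulr_ge0// ?(ltW g00)//; lra.
suff main : 33 / 80 + 1 * k + 9 / 20 * (p * p)
    + b * (21 / 40 * ki - 12 / 25)
    <= 156 / 100 * p + 7 / 20 * (k * k * g).
  have -> : k / 2 * (1 + 3 / 10 * (b * ki)) = k / 2 + 3 / 20 * (k * (b * ki)).
    by field.
  rewrite kb; lra.
(* Tangent of [k * k / p] at [k = p]. *)
have kg2 : k * k * g >= 2 * k - p.
  have : 0 <= g * ((k - p) * (k - p)) by apply: mulr_ge0; [exact: ltW|rewrite -expr2; exact: sqr_ge0].
  have -> : g * ((k - p) * (k - p)) = k * k * g - 2 * k * (p * g) + p * (p * g).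
    by ring.
  by rewrite gE; lra.
have pp : p * p <= 89 / 40 * p - 49 / 40 by clear -p2 k1 kp; nra.
have H0 : 33 / 80 + k + 9 / 20 * (p * p)
  <= 156 / 100 * p + 7 / 20 * (k * k * g) by lra.
have kk2 : 3 / 10 * k + 21 / 40 * ki <= 33 / 40.
  have : 0 <= ki * ((k - 1) * (21 / 40 - 3 / 10 * k)).
    by apply: mulr_ge0 => //; apply: mulr_ge0; lra.
  have -> : ki * ((k - 1) * (21 / 40 - 3 / 10 * k)) =
    33 / 40 * (k * ki) - 3 / 10 * k * (k * ki) - 21 / 40 * ki by field.
  by rewrite kk; lra.
have H1 : 33 / 80 + k + 9 / 20 * (p * p)
    + (21 / 40 * ki - 12 / 25)
  <= 156 / 100 * p + 7 / 20 * (k * k * g) by lra.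
(* The goal is affine in [b]; [H0] and [H1] are its cases [b = 0] and [b = 1], combined here with
   weights [1 - b] and [b]. *)
have : 0 <= b * (156 / 100 * p + 7 / 20 * (k * k * g) - (33 / 80 + k + 9 / 20 * (p * p)
    + (21 / 40 * ki - 12 / 25))) by rewrite mulr_ge0// subr_ge0.
have : 0 <= (1 - b) * (156 / 100 * p + 7 / 20 * (k * k * g) - (33 / 80 + k + 9 / 20 * (p * p))) by rewrite mulr_ge0// subr_ge0.
lra.
Qed.

Lemma large_case_flat p g h b : 1 <= p -> p * g = 1 -> 3 / 2 <= p * p -> p <= 2 ->
  0 <= h <= 1 -> 0 <= b <= 1 ->
  1 / 2 * (3 / 2 + 1 + 13 / 20 * b * (3 / 2 + 1)) + h / 2 * (1 + 3 / 10 * b) * (3 / 2)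
   + p * p - 69 / 100 * b
  <= 2 * p + 22 / 49 * (h * g) + p * p * (70 / 99).
Proof.
move=> p1 gE pl pu /andP[h0 h1] /andP[b0 b1].
have p2 : 60 / 49 <= p by clear -p1 pl; nra.
have g0 : 0 <= g by clear -gE p1; nra.
have g1 : g <= 1 by clear -gE p1 g0; nra.
have hb : h * b <= 1 * b by apply: ler_wpM2r.
have hg : h * (3 / 4 - 22 / 49 * g) <= 3 / 4 - 22 / 49 * g.
  by apply: mul_le1; [exact: h1|lra].
(* Tangent of [1 / p] at [p = 5 / 4]. *)
have g2 : 16 / 10 - 64 / 100 * p <= g.
  have : 0 <= g * ((8 / 10 * p - 1) * (8 / 10 * p - 1)).
    by apply: mulr_ge0 => //; rewrite -expr2; exact: sqr_ge0.
  have -> : g * ((8 / 10 * p - 1) * (8 / 10 * p - 1)) =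
    64 / 100 * (p * (p * g)) - 16 / 10 * (p * g) + g by field.
  by rewrite gE; lra.
have pp : p * p <= 158 / 49 * p - 120 / 49 by clear -p2 pu; nra.
lra.
Qed.

Lemma large_case_root p g k ki b : 1 <= k -> k <= p -> k * ki = 1 -> p * g = 1 ->
  3 / 2 <= p * p -> p <= 2 -> 0 <= b <= 1 ->
  1 / 2 * (3 / 2 + k + 13 / 20 * (b * ki) * (3 / 2 + 1))
   + k / 2 * (1 + 3 / 10 * (b * ki)) * (3 / 2) + p * p - 69 / 100 * b
  <= 2 * p + 22 / 49 * (k * k * g) + p * p * (70 / 99).
Proof.
move=> k1 kp kk gE pl pu /andP[b0 b1].
have p2 : 60 / 49 <= p by clear -k1 kp pl; nra.
have p0 : 0 < p by lra.
have g0 : 0 <= g by clear -gE p0; nra.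
have ki0 : 0 <= ki by clear -kk k1; nra.
have ki1 : ki <= 1 by clear -kk k1 ki0; nra.
have kb : k * (b * ki) = b by rewrite mulrCA kk mulr1.
have kg2 : k * k * g >= 2 * k - p.
  have : 0 <= g * ((k - p) * (k - p)).
    by apply: mulr_ge0 => //; rewrite -expr2; exact: sqr_ge0.
  have -> : g * ((k - p) * (k - p)) = k * k * g - 2 * k * (p * g) + p * (p * g).
    by ring.
  by rewrite gE; lra.
have bki : b * ki <= 1 * ki by apply: ler_wpM2r.
have pp : p * p <= 158 / 49 * p - 120 / 49 by clear -p2 pu; nra.
have -> : k / 2 * (1 + 3 / 10 * (b * ki)) = k / 2 + 3 / 20 * (k * (b * ki)) by field.
rewrite kb.
have bb : b * (13 / 16 * ki - 93 / 200) <= 0 \/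
   b * (13 / 16 * ki - 93 / 200) <= 1 * (13 / 16 * ki - 93 / 200).
  exact: mul_le_max.
case: bb => bb; first lra.
have : 0 <= ki * ((k - 1) * (13 / 16 - 69 / 196 * k)).
  by apply: mulr_ge0 => //; apply: mulr_ge0; lra.
have -> : ki * ((k - 1) * (13 / 16 - 69 / 196 * k)) =
  (13 / 16 + 69 / 196) * (k * ki) - 69 / 196 * k * (k * ki) - 13 / 16 * ki by field.
rewrite kk; lra.
Qed.

Lemma huge_case_flat p h b : 2 <= p -> 0 <= h <= 1 -> 0 <= b <= 1 ->
  9 / 8 * (2 + 1 + 13 / 20 * b * (2 + 2 / 3)) + h / 2 * (1 + 3 / 10 * b) * (7 / 4)
   + p * p - 69 / 100 * b
  <= 3 * p + 3 / 2 * (p * p) * (70 / 99).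
Proof.
move=> p2 /andP[h0 h1] /andP[b0 b1].
have hb : h * b <= 1 * b by apply: ler_wpM2r.
have pp : 2 * 2 <= p * p by clear -p2; nra.
lra.
Qed.

Lemma huge_case_root p g k ki b : 1 <= k -> k <= p -> k * ki = 1 -> p * g = 1 ->
  2 <= p -> 0 <= b <= 1 ->
  9 / 8 * (2 + k + 13 / 20 * (b * ki) * (2 + 2 / 3))
   + k / 2 * (1 + 3 / 10 * (b * ki)) * (7 / 4) + p * p - 69 / 100 * b
  <= 3 * p + 66 / 98 * (k * k * g) + 3 / 2 * (p * p) * (70 / 99).
Proof.
move=> k1 kp kk gE p2 /andP[b0 b1].
have p0 : 0 < p by lra.
have g0 : 0 <= g by clear -gE p0; nra.
have ki0 : 0 <= ki by clear -kk k1; nra.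
have ki1 : ki <= 1 by clear -kk k1 ki0; nra.
have kb : k * (b * ki) = b by rewrite mulrCA kk mulr1.
have kg2 : k * k * g >= 2 * k - p.
  have : 0 <= g * ((k - p) * (k - p)).
    by apply: mulr_ge0 => //; rewrite -expr2; exact: sqr_ge0.
  have -> : g * ((k - p) * (k - p)) = k * k * g - 2 * k * (p * g) + p * (p * g).
    by ring.
  by rewrite gE; lra.
have pp : 2 * 2 <= p * p by clear -p2; nra.
have -> : k / 2 * (1 + 3 / 10 * (b * ki)) = k / 2 + 3 / 20 * (k * (b * ki)) by field.
rewrite kb.
have bb : b * (39 / 20 * ki - 171 / 400) <= 0 \/
   b * (39 / 20 * ki - 171 / 400) <= 1 * (39 / 20 * ki - 171 / 400).
  exact: mul_le_max.
case: bb => bb; first lra.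
(* The factored inequality is nonnegative only up to about [k = 2.98]; beyond [29 / 10] the term in
   [k^-1] is small enough for a linear argument. *)
have [k3|k3] := lerP k (29 / 10).
  have : 0 <= ki * ((k - 1) * (39 / 20 - 64 / 98 * k)).
    by apply: mulr_ge0 => //; apply: mulr_ge0; lra.
  have -> : ki * ((k - 1) * (39 / 20 - 64 / 98 * k)) =
    (39 / 20 + 64 / 98) * (k * ki) - 64 / 98 * k * (k * ki) - 39 / 20 * ki by field.
  by rewrite kk; lra.
have k29 : ki <= 10 / 29 by clear -kk k3 ki0; nra.
lra.
Qed.

(** Concavity of the square root: a chord over [[0, 1]], with [120 / 49] slightly below [sqrt 6] at
    the end [tau = 1]. *)
Lemma sqrt_chord r tau : 0 <= r -> 0 <= tau <= 1 ->
  Num.sqrt r * (2 + 22 / 49 * tau) <= Num.sqrt (r * (4 + 2 * tau)).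
Proof.
move=> r0 /andP[t0 t1].
have c0 : 0 <= 2 + 22 / 49 * tau by lra.
rewrite -[in leLHS](ger0_norm c0) -sqrtr_sqr -sqrtrM//.
apply: ler_wsqrtr; apply: ler_wpM2l => //.
by rewrite expr2; clear -t0 t1; nra.
Qed.

(** [99 / 70] is a continued fraction convergent of [sqrt 2] from above. *)
Lemma inv_sqrt2_ge : 70 / 99 <= (Num.sqrt 2)^-1 :> R.
Proof.
have -> : 70 / 99 = (99 / 70)^-1 :> R by field.
rewrite lef_pV2 ?posrE ?sqrtr_gt0 ?divr_gt0//.
have a0 : 0 <= (99 / 70 : R) by rewrite divr_ge0.
rewrite -[leRHS](ger0_norm a0) -sqrtr_sqr; apply: ler_wsqrtr.
by rewrite expr2; lra.
Qed.

(** Bernstein's factor: [expR x - 1 - x <= peak lam * x ^+ 2 / 2] whenever [x <= lam < 3]. *)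
Definition peak (lam : R) : R := (1 - lam / 3)^-1.

(** Up to a factor [lam], [k] balances the entropy cost [lam * lam * k / 2] against the trace term
    [tau * r / (2 * k)]; it is kept at least [1] because the prior lives on [[1, +oo[]. *)
Lemma scalar_optimization r tau b : 0 < r -> 0 <= tau <= 1 -> 0 <= b <= 1 ->
  b <= r -> let k := Num.max 1 (Num.sqrt (tau * r)) in
  exists lam, [/\ 0 < lam <= 3 / 2,
    3 / 10 * (1 + lam / 2) * (tau * r / (k * k)) <= lam * lam * peak lam
  & lam * lam / 2 * (peak lam + k + 13 / 20 * (b / k) * (peak lam + lam^-1))
    + tau * r / k / 2 * (1 + 3 / 10 * (b / k)) * (1 + lam / 2) + r - 69 / 100 * b
    <= lam * Num.sqrt (r * (4 + 2 * tau)) + lam * r * (Num.sqrt 2)^-1].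
Proof.
move=> r0 tau01 b01 br k.
have sc := sqrt_chord (ltW r0) tau01.
have s2 := inv_sqrt2_ge.
move: (Num.sqrt 2)^-1 s2 => c2 s2.
have [b0 b1] := andP b01; have [t0 t1] := andP tau01.
have p0 : 0 < Num.sqrt r by rewrite sqrtr_gt0.
have pE : Num.sqrt r * Num.sqrt r = r by rewrite -expr2 sqr_sqrtr// ltW.
have h0 : 0 <= tau * r by rewrite mulr_ge0// ltW.
have hr : tau * r <= r by apply: mul_le1 => //; exact: ltW.
have spV : Num.sqrt r * (Num.sqrt r)^-1 = 1 by rewrite mulfV// gt_eqF.
have sp1 : 1 <= r -> 1 <= Num.sqrt r.
  by move=> r1; rewrite -[leLHS]sqrtr1; exact: ler_wsqrtr.
have sp2 : r <= 4 -> Num.sqrt r <= 2 by clear -pE p0; nra.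
have sp3 : 4 < r -> 2 <= Num.sqrt r by clear -pE p0; nra.
have thg : tau * r * (Num.sqrt r)^-1 = tau * Num.sqrt r.
  have -> : tau * r = tau * Num.sqrt r * Num.sqrt r by rewrite -mulrA pE.
  by rewrite mulfK// gt_eqF.
have tp0 : 0 <= tau * Num.sqrt r by rewrite mulr_ge0// ltW.
have rc : r * (70 / 99) <= r * c2 by rewrite ler_pM2l.
have h01 : tau * r <= 1 -> 0 <= tau * r <= 1 by move=> ->; rewrite h0.
have [h1|h1] := lerP (tau * r) 1.
  have -> : k = 1.
    by rewrite /k max_l// -[leRHS]sqrtr1; exact: ler_wsqrtr.
  rewrite mulr1 !divr1.
  have [r1|r1] := lerP r (9 / 20).
    pose q := Num.sqrt (r * (1 + tau / 2)).
    have q0 : 0 < q by rewrite sqrtr_gt0 mulr_gt0//; lra.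
    have qq : q * q = r * (1 + tau / 2).
      by rewrite -expr2 sqr_sqrtr// mulr_ge0 ?ltW//; lra.
    have qs : Num.sqrt (r * (4 + 2 * tau)) = 2 * q.
      rewrite -[2 in RHS](@ger0_norm _ (2 : R))// -sqrtr_sqr -sqrtrM ?sqr_ge0//.
      by congr Num.sqrt; rewrite expr2; field.
    have q27 : q * q <= 27 / 40 by rewrite qq; clear -t1 t0 r1 r0; nra.
    have q37 : q <= 37 / 45 by clear -q0 q27; nra.
    have pk : 1 <= peak q.
      by rewrite /peak -[leLHS]invr1 lef_pV2 ?posrE//; lra.
    exists q; split.
    - by rewrite q0/=; lra.
    - have : q * q <= q * q * peak q.
        by rewrite ler_peMr// mulr_ge0// ltW.
      have : (1 + q / 2) * (tau * r) <= 2 * (tau * r).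
        by apply: ler_wpM2r => //; lra.
      by rewrite qq; lra.
    - rewrite qs.
      have := @small_case q (tau * r) b q0 q27 h0 _ b0 => /=.
      rewrite (_ : q * q - tau * r / 2 = r); last by rewrite qq; field.
      have -> : 3 * (tau * r) <= 2 * (q * q) by rewrite qq; lra.
      move=> /(_ isT) H; apply: (le_trans H).
      by rewrite lerD2l; apply: ler_wpM2l => //; rewrite mulr_ge0// ltW.
  have [r2|r2] := lerP r (3 / 2).
    exists (39 / 50).
    have pkE : peak (39 / 50) = 50 / 37 by rewrite /peak; field.
    have ivE : (39 / 50)^-1 = 50 / 39 :> R by field.
    rewrite pkE ivE; split; [by lra|by lra|].
    have := @mid_case_flat (Num.sqrt r) (tau * r) tau b.
    rewrite pE => /(_ (ltW r1) r2 p0 tau01 erefl h1 b01 br) H; lra.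
  have sr : 3 / 2 <= r by exact: ltW.
  have [r3|r3] := lerP r 4.
    have r11 : 1 <= r by lra.
    exists 1.
    have pkE : peak 1 = 3 / 2 by rewrite /peak; field.
    rewrite pkE invr1; split; [by lra|by lra|].
    have := @large_case_flat (Num.sqrt r) (Num.sqrt r)^-1 (tau * r) b.
    rewrite pE thg => /(_ (sp1 r11) spV sr (sp2 r3) (h01 h1) b01) H; lra.
  exists (3 / 2).
  have pkE : peak (3 / 2) = 2 by rewrite /peak; field.
  have ivE : (3 / 2)^-1 = 2 / 3 :> R by field.
  rewrite pkE ivE; split; [by lra|by lra|].
  have := @huge_case_flat (Num.sqrt r) (tau * r) b.
  rewrite pE => /(_ (sp3 r3) (h01 h1) b01) H; lra.
have kE : k = Num.sqrt (tau * r).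
  by rewrite /k max_r// -[leLHS]sqrtr1; apply: ler_wsqrtr; exact: ltW.
have kk : k * k = tau * r by rewrite kE -expr2 sqr_sqrtr.
have k1 : 1 <= k by rewrite /k le_max lexx.
have kiE : k * k^-1 = 1 by rewrite mulfV// gt_eqF//; lra.
have kp : k <= Num.sqrt r by rewrite kE; exact: ler_wsqrtr.
have hk : tau * r / k = k by rewrite -kk mulfK// gt_eqF//; lra.
have hkk : tau * r / (k * k) = 1 by rewrite kk divff// gt_eqF//; lra.
have ktp : k * k * (Num.sqrt r)^-1 = tau * Num.sqrt r.
  by rewrite kk.
have r1 : 1 <= r by lra.
rewrite hk hkk.
have [r2|r2] := lerP r (3 / 2).
  exists (39 / 50).
  have pkE : peak (39 / 50) = 50 / 37 by rewrite /peak; field.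
  have ivE : (39 / 50)^-1 = 50 / 39 :> R by field.
  rewrite pkE ivE; split; [by lra|by lra|].
  have := @mid_case_root (Num.sqrt r) k k^-1 b k1 kp kiE.
  rewrite pE (mulrA k) ktp => /(_ r2 b01) H; lra.
have sr : 3 / 2 <= r by exact: ltW.
have [r3|r3] := lerP r 4.
  exists 1.
  have pkE : peak 1 = 3 / 2 by rewrite /peak; field.
  rewrite pkE invr1; split; [by lra|by lra|].
  have := @large_case_root (Num.sqrt r) (Num.sqrt r)^-1 k k^-1 b k1 kp kiE spV.
  rewrite pE ktp => /(_ sr (sp2 r3) b01) H; lra.
exists (3 / 2).
have pkE : peak (3 / 2) = 2 by rewrite /peak; field.
have ivE : (3 / 2)^-1 = 2 / 3 :> R by field.
rewrite pkE ivE; split; [by lra|by lra|].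
have := @huge_case_root (Num.sqrt r) (Num.sqrt r)^-1 k k^-1 b k1 kp kiE spV (sp3 r3) b01.
rewrite pE ktp => H; lra.
Qed.

End ScalarOptimization.

(** * Choice of [rho] and [lam] in the original variables *)

Section DeviationOptimization.
Context (R : realType).

(* After dividing by [u * al], the claim is [scalar_optimization] at
   [r = L / (u * al)] up to the factor [v = u^-1] in front of the operator norm;
   what [v] saves there pays for evaluating the trace coefficient at
   [rho^-1 = a / k] instead of [b / k], with [b = v * a]. *)
Lemma deviation_optimization (op tr L u : R) : 0 <= op -> 0 <= tr ->
  1 <= L -> 1 <= u ->
  exists rho lam : R, [/\ 1 <= rho, rho <= Num.max 1 tr, 0 < lam <= 3 / 2 &
    (lam * lam * peak lam + 13 / 20 * rho^-1 * (lam * lam * peak lam + lam))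
      * (Num.min op tr / 2)
    + (1 + 3 / 10 * rho^-1) * (1 + lam / 2) * (rho^-1 * (tr / 2))
    + u * rho * (lam * lam / 2) + (L - 69 / 100)
    <= lam * (Num.sqrt (4 * u * Num.max tr (Num.max 1 op * L) + 2 * u * tr)
              + L / Num.sqrt 2)].
Proof.
move=> op0 tr0 L1 u1.
(* The minimum gives [al <= Num.max 1 tr], which keeps [rho] in its range when [k = 1]. *)
pose o := Num.min op tr.
have otr : o <= tr by rewrite /o ge_min lexx orbT.
have o0 : 0 <= o by rewrite le_min op0.
pose T := Num.max tr (Num.max 1 o * L).
have L0 : 0 < L by exact: lt_le_trans L1.
have u0 : 0 < u by exact: lt_le_trans u1.
have TL : L <= T by rewrite le_max ler_peMl ?orbT ?le_max ?lexx// ltW.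
have T0 : 0 < T by exact: lt_le_trans TL.
pose al := T / L; pose tau := tr / T.
have alE : al * L = T by rewrite /al divfK// gt_eqF.
have tauE : tau * T = tr by rewrite /tau divfK// gt_eqF.
have al1 : 1 <= al by rewrite /al ler_pdivlMr// mul1r.
have al0 : 0 < al by exact: lt_le_trans al1.
have oal : o <= al.
  rewrite /al ler_pdivlMr// /T le_max; apply/orP; right.
  by rewrite ler_wpM2r ?(ltW L0)// le_max lexx orbT.
have alM : al <= Num.max 1 tr.
  rewrite /al ler_pdivrMr// /T ge_max; apply/andP; split.
    rewrite (@le_trans _ _ (tr * L))// ?ler_peMr// ler_wpM2r ?(ltW L0)//.
    by rewrite le_max lexx orbT.
  by rewrite ler_wpM2r ?(ltW L0)// ge_max !le_max lexx otr orbT.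
have tau01 : 0 <= tau <= 1.
  rewrite /tau divr_ge0 ?(ltW T0)//= ler_pdivrMr// mul1r.
  by rewrite /T le_max lexx.
have ua0 : 0 < u * al by rewrite mulr_gt0.
pose r := L / (u * al).
have rE : r * (u * al) = L by rewrite /r divfK// gt_eqF.
have r0 : 0 < r by rewrite divr_gt0.
pose b := (u * al)^-1.
have bE : b * (u * al) = 1 by rewrite /b mulVf// gt_eqF.
have b0 : 0 < b by rewrite invr_gt0.
have b01 : 0 <= b <= 1.
  rewrite ltW//= /b invf_le1//.
  by rewrite (le_trans u1)// ler_peMr// ltW.
have br : b <= r by rewrite /r -[b]mul1r ler_pM2r.
have := scalar_optimization r0 tau01 b01 br.
set k := Num.max 1 _ => /= -[lam [lam32 C1 C2]].
have lam0 : 0 < lam by case/andP: lam32.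
have k1 : 1 <= k by rewrite /k le_max lexx.
have k0 : 0 < k by exact: lt_le_trans k1.
exists (k * al), lam; split => //.
- by rewrite (le_trans al1)// ler_peMl// ltW.
- have [h1|h1] := lerP (Num.sqrt (tau * r)) 1.
    by rewrite /k max_l// mul1r.
  have kE : k = Num.sqrt (tau * r) by rewrite /k max_r// ltW.
  have kk : k * k = tau * r.
    by rewrite kE -expr2 sqr_sqrtr// mulr_ge0 ?(ltW r0)//; case/andP: tau01.
  rewrite le_max; apply/orP; right.
  rewrite (@le_trans _ _ (k * k * al))//.
    by rewrite ler_pM2r// ler_peMl// ltW.
  rewrite kk -tauE -alE -mulrA ler_wpM2l//; first by case/andP: tau01.
  rewrite mulrC ler_pM2l// -[leLHS]mulr1 -rE ler_pM2l//.
  by rewrite (le_trans al1)// ler_peMl// ltW.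
- have m0 : 0 <= peak lam.
    by rewrite invr_ge0; case/andP: lam32 => _; lra.
  have lm0 : 0 <= lam * lam * peak lam by rewrite !mulr_ge0// ltW.
  have -> : (k * al)^-1 = k^-1 * al^-1 by rewrite invfM.
  have ki0 : 0 < k^-1 by rewrite invr_gt0.
  have ai0 : 0 < al^-1 by rewrite invr_gt0.
  have aiE : al^-1 * al = 1 by rewrite mulVf// gt_eqF.
  have kiE : k^-1 * k = 1 by rewrite mulVf// gt_eqF.
  have liE : lam * lam^-1 = 1 by rewrite mulfV// gt_eqF.
  have bu : b * u = al^-1.
    by rewrite -[LHS]mulr1 -aiE mulrCA -mulrA bE mulr1.
  have S1 : u * al * Num.sqrt (r * (4 + 2 * tau)) <=
      Num.sqrt (4 * u * Num.max tr (Num.max 1 op * L) + 2 * u * tr).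
    rewrite -{1}(ger0_norm (ltW ua0)) -sqrtr_sqr -sqrtrM ?sqr_ge0//.
    apply: ler_wsqrtr.
    have -> : (u * al) ^+ 2 * (r * (4 + 2 * tau)) =
        4 * u * T + 2 * u * tr.
      by rewrite -tauE -alE -rE; ring.
    rewrite lerD2r ler_wpM2l//; first by rewrite mulr_ge0// ltW.
    have oo : Num.max 1 o <= Num.max 1 op.
      rewrite ge_max; apply/andP; split; rewrite le_max; apply/orP; first by left.
      by right; rewrite ge_min lexx.
    rewrite ge_max; apply/andP; split; rewrite le_max; apply/orP; first by left.
    by right; exact: ler_wpM2r (ltW L0) _ _ oo.
  have S2 := ler_wpM2l (ltW lam0) S1.
  have C3 := ler_wpM2l (ltW ua0) C2.
  have o2 : (lam * lam * peak lam + 13 / 20 * (k^-1 * al^-1) *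
      (lam * lam * peak lam + lam)) * (o / 2) <=
      (lam * lam * peak lam + 13 / 20 * (k^-1 * al^-1) *
      (lam * lam * peak lam + lam)) * (al / 2).
    apply: ler_wpM2l; last by rewrite ler_pM2r.
    apply: addr_ge0 => //; apply: mulr_ge0; last exact: addr_ge0 (ltW _).
    by rewrite !mulr_ge0// ltW.
  have L2 : u * al * (lam * r * (Num.sqrt 2)^-1) = lam * (L / Num.sqrt 2).
    by rewrite -rE; ring.
  have pay : 3 / 10 * (1 + lam / 2) * (tau * r / (k * k)) <=
      lam * lam * peak lam * al.
    by apply: (le_trans C1); rewrite ler_peMr.
  have pay2 : 0 <= (u - 1) / 2 * (lam * lam * peak lam * al -
      3 / 10 * (1 + lam / 2) * (tau * r / (k * k))).
    by apply: mulr_ge0; [apply: divr_ge0 => //|]; rewrite subr_ge0.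
  have S3 : u * al * (lam * Num.sqrt (r * (4 + 2 * tau))) <=
      lam * Num.sqrt (4 * u * Num.max tr (Num.max 1 op * L) + 2 * u * tr).
    by rewrite mulrCA.
  rewrite [leRHS]mulrDr L2 in C3.
  rewrite [leRHS]mulrDr.
  apply: (le_trans _ (lerD S3 (lexx (lam * (L / Num.sqrt 2))))).
  apply: (le_trans _ C3).
  apply: (@le_trans _ _ ((lam * lam * peak lam + 13 / 20 * (k^-1 * al^-1) *
      (lam * lam * peak lam + lam)) * (al / 2) +
     (1 + 3 / 10 * (k^-1 * al^-1)) * (1 + lam / 2) * (k^-1 * al^-1 * (tr / 2)) +
     u * (k * al) * (lam * lam / 2) + (L - 69 / 100))).
    by rewrite !lerD2r.
  rewrite -subr_ge0; apply: (le_trans pay2); rewrite le_eqVlt; apply/orP; left.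
  apply/eqP; rewrite -tauE -alE -rE /b; field.
  by rewrite !gt_eqF.
Qed.

End DeviationOptimization.

(** * Differentiation rules *)

Section RealDerivatives.
Context (R : realType).
Implicit Types (f g : R -> R) (x df dg c : R).

Lemma der_eq f x df dg : is_derive x 1 f df -> df = dg -> is_derive x 1 f dg.
Proof. by move=> fd <-. Qed.

Lemma der_cst c x : is_derive x 1 (fun=> c) 0.
Proof. exact: is_derive_cst. Qed.

Lemma der_id x : is_derive x 1 (fun t : R => t) 1.
Proof. exact: is_derive_id. Qed.

Lemma der_add f g x df dg : is_derive x 1 f df -> is_derive x 1 g dg ->
  is_derive x 1 (fun t => f t + g t) (df + dg).
Proof. by move=> fd gd; exact: is_deriveD. Qed.

Lemma der_opp f x df : is_derive x 1 f df -> is_derive x 1 (fun t => - f t) (- df).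
Proof. by move=> fd; exact: is_deriveN. Qed.

Lemma der_mul f g x df dg : is_derive x 1 f df -> is_derive x 1 g dg ->
  is_derive x 1 (fun t => f t * g t) (f x * dg + g x * df).
Proof. by move=> fd gd; exact: is_deriveM. Qed.

Lemma der_sqr f x df : is_derive x 1 f df ->
  is_derive x 1 (fun t => f t ^+ 2) (2 * f x * df).
Proof.
move=> fd; have := der_mul fd fd.
rewrite (_ : (fun t => f t * f t) = (fun t => f t ^+ 2)).
  by move=> h; apply: der_eq h _; ring.
by apply/funext => t; rewrite expr2.
Qed.

Lemma der_exp f x df : is_derive x 1 f df ->
  is_derive x 1 (fun t => expR (f t)) (df * expR (f x)).
Proof.
move=> fd; have := @is_derive1_comp R expR f x _ _ (is_derive_expR (f x)) fd.
by move=> h; apply: der_eq h _; rewrite mulrC.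
Qed.

Lemma der_ln f x df : 0 < f x -> is_derive x 1 f df ->
  is_derive x 1 (fun t => ln (f t)) (df / f x).
Proof.
move=> f0 fd; have := @is_derive1_comp R (@ln R) f x _ _ (is_derive1_ln f0) fd.
by move=> h; apply: der_eq h _; rewrite mulrC.
Qed.

Lemma der_inv f x df : f x != 0 -> is_derive x 1 f df ->
  is_derive x 1 (fun t => (f t)^-1) (- df / f x ^+ 2).
Proof.
move=> f0 fd; have := is_deriveV f0 fd.
by move=> h; apply: der_eq h _; rewrite /GRing.scale/= !mulNr mulrC.
Qed.

End RealDerivatives.

Ltac derive_rules := repeat first
  [ eassumption | eapply der_add | eapply der_sqr | eapply der_opp | eapply der_mul | eapply der_exp
  | eapply der_id | eapply der_cst ].

(** * Inequalities for the exponential and the logarithm *)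

Section RealAnalysis.
Context (R : realType).

Lemma derive_ge0_le (f df : R -> R) (a b : R) : a <= b ->
  (forall x, a <= x <= b -> is_derive x 1 f (df x)) ->
  (forall x, a <= x <= b -> 0 <= df x) -> f a <= f b.
Proof.
move=> ab fdf df0.
have [||c cab fE] := @MVT_segment R f df a b ab.
- by move=> x; rewrite in_itv/= => /andP[ax xb]; apply: fdf; rewrite !ltW.
- apply: derivable_within_continuous => x; rewrite in_itv/= => xab.
  by case: (fdf _ xab).
rewrite -subr_ge0 fE mulr_ge0 ?subr_ge0//; apply: df0.
by move: cab; rewrite in_itv.
Qed.

Lemma convex_critical_min (f df ddf : R -> R) :
  (forall x : R, is_derive x 1 f (df x)) ->
  (forall x : R, is_derive x 1 df (ddf x)) ->
  (forall x, 0 <= ddf x) -> df 0 = 0 -> forall x, f 0 <= f x.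
Proof.
move=> fdf dfddf ddf0 df00 x.
have dfm a b : a <= b -> df a <= df b by move=> ab; exact: derive_ge0_le.
have [x0|x0] := lerP 0 x.
  apply: (derive_ge0_le (df := df)) => // z /andP[z0 _].
  by rewrite -df00; exact: dfm.
rewrite -lerN2; apply: (@derive_ge0_le (- f) (- df) x 0 (ltW x0)) => z.
by move=> /andP[_ z0]; rewrite /= oppr_ge0 -df00; exact: dfm.
Qed.

(** Bernstein's inequality cleared of its denominator [1 - x / 3]. The difference of the two sides
    is convex, and it vanishes at [0] together with its derivative. *)
Lemma expR_bernstein (x : R) : (3 - x) * expR x <= 3 + 2 * x + x ^+ 2 / 2.
Proof.
rewrite -subr_ge0.
pose f (x : R) := 3 + 2 * x + x ^+ 2 / 2 - (3 - x) * expR x.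
pose df (x : R) := 2 + x - (2 - x) * expR x.
pose ddf (x : R) := 1 - (1 - x) * expR x.
rewrite (_ : 0 = f 0); last by rewrite /f expR0; field.
apply: (@convex_critical_min f df ddf) => [z|z|z|].
- eapply der_eq; [rewrite /f; derive_rules|rewrite /df/=; by field].
- eapply der_eq; [rewrite /df; derive_rules|rewrite /ddf/=; by field].
- rewrite subr_ge0 -ler_pdivlMr ?expR_gt0// div1r -expRN.
  exact: expR_ge1Dx.
- by rewrite /df expR0; field.
Qed.

(** The cumulant function [ln c] has second derivative [1 - (s / c) ^+ 2], at most [1], so the
    difference of the exponents is convex with its minimum at [0]. *)
Lemma hoeffding_sign (mu t : R) : -1 < mu < 1 ->
  (1 + mu) / 2 * expR t + (1 - mu) / 2 * expR (- t)
  <= expR (mu * t + t ^+ 2 / 2).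
Proof.
move=> /andP[mu1 mu2].
pose c (t : R) := (1 + mu) / 2 * expR t + (1 - mu) / 2 * expR (- t).
pose s (t : R) := (1 + mu) / 2 * expR t - (1 - mu) / 2 * expR (- t).
have c0 z : 0 < c z.
  by rewrite addr_gt0// mulr_gt0 ?expR_gt0// divr_gt0//; lra.
have dc (z : R) : is_derive z 1 c (s z).
  by eapply der_eq; [rewrite /c; derive_rules|rewrite /s/=; by field].
have ds (z : R) : is_derive z 1 s (c z).
  by eapply der_eq; [rewrite /s; derive_rules|rewrite /c/=; by field].
rewrite -/(c t) -[leLHS]lnK ?posrE// ler_expR -subr_ge0.
pose f (t : R) := mu * t + t ^+ 2 / 2 - ln (c t).
pose df (t : R) := mu + t - s t / c t.
pose ddf (t : R) := (s t / c t) ^+ 2.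
rewrite (_ : 0 = f 0); last first.
  by rewrite /f /c oppr0 expR0 (_ : _ + (1 - mu) / 2 * 1 = 1) ?ln1; field.
apply: (@convex_critical_min f df ddf) => [z|z|z|].
- have dlc := der_ln (c0 z) (dc z).
  eapply der_eq; [rewrite /f; derive_rules|rewrite /df/=; field].
  by rewrite gt_eqF.
- have cn : c z != 0 by rewrite gt_eqF.
  have div := der_mul (ds z) (der_inv cn (dc z)).
  eapply der_eq; [rewrite /df; derive_rules|rewrite /ddf/=; field; exact: cn].
- exact: sqr_ge0.
- by rewrite /df /s /c oppr0 expR0; field; rewrite ?gt_eqF//; lra.
Qed.

(** The derivative of the difference is [x ^+ 3 / (1 + x)], which has the sign of [x]. *)
Lemma ln1D_le (x : R) : -1 < x -> ln (1 + x) <= x - x ^+ 2 / 2 + x ^+ 3 / 3.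
Proof.
move=> x1; rewrite -subr_ge0.
pose f (x : R) := x + - (x ^+ 2 / 2) + x ^+ 2 * x / 3 + - ln (1 + x).
pose df (x : R) := x ^+ 3 / (1 + x).
have fdf (z : R) : -1 < z -> is_derive z 1 f (df z).
  move=> z1; have z0 : 0 < 1 + z by lra.
  have dl := der_ln z0 (der_add (der_cst 1 z) (der_id z)).
  eapply der_eq; [rewrite /f; derive_rules|rewrite /df/=; field].
  by rewrite gt_eqF.
have df0 z : -1 < z -> 0 <= z -> 0 <= df z.
  by move=> z1 z0; rewrite divr_ge0 ?exprn_ge0//; lra.
have df1 z : -1 < z -> z <= 0 -> df z <= 0.
  move=> z1 z0; rewrite /df exprS mulr_le0_ge0// ?invr_ge0; last by lra.
  by rewrite mulr_le0_ge0// sqr_ge0.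
have -> : x - x ^+ 2 / 2 + x ^+ 3 / 3 - ln (1 + x) = f x.
  by rewrite /f; field.
rewrite (_ : 0 = f 0); last by rewrite /f addr0 ln1; field.
have [x0|x0] := lerP 0 x.
  apply: (derive_ge0_le (df := df)) => // z /andP[z0 _]; first apply: fdf.
    by lra.
  by apply: df0 => //; lra.
rewrite -lerN2; apply: (@derive_ge0_le (fun t => - f t) (fun t => - df t) x 0 (ltW x0)) => z.
  by move=> /andP[xz _]; apply: der_opp; apply: fdf; exact: lt_le_trans xz.
by move=> /andP[xz z0]; rewrite oppr_ge0 df1//; exact: lt_le_trans xz.
Qed.

(* Bound on the relative entropy of a biased sign with respect to a fair one. *)
Lemma sign_entropy_le (mu : R) : -1 < mu < 1 ->
  (1 + mu) / 2 * ln (1 + mu) + (1 - mu) / 2 * ln (1 - mu)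
  <= mu ^+ 2 / 2 + mu ^+ 4 / 3.
Proof.
move=> /andP[mu1 mu2].
have A : (1 + mu) / 2 * ln (1 + mu) <=
    (1 + mu) / 2 * (mu - mu ^+ 2 / 2 + mu ^+ 3 / 3).
  by apply: ler_wpM2l; [lra|exact: ln1D_le].
have B : (1 - mu) / 2 * ln (1 - mu) <=
    (1 - mu) / 2 * (- mu - (- mu) ^+ 2 / 2 + (- mu) ^+ 3 / 3).
  by apply: ler_wpM2l; [lra|apply: ln1D_le; lra].
apply: (le_trans (lerD A B)); rewrite le_eqVlt; apply/orP; left.
by apply/eqP; field.
Qed.

(* The cross term [x * h ^+ 2] is split by the arithmetic-geometric mean
   inequality with weight [lam], so that both error coefficients vanish as
   [lam] and [s] tend to [0]. *)
Lemma expR_quadratic_bound (lam s x h : R) : 0 < lam < 3 -> 0 <= s <= 1 ->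
  `|x| <= lam -> 0 <= h <= 1 ->
  expR (x + s * h ^+ 2 / 2) <= 1 + x
    + (peak lam + 13 / 20 * s * (peak lam + lam^-1)) * x ^+ 2 / 2
    + (1 + 3 / 10 * s) * (1 + lam / 2) * (s * h ^+ 2 / 2).
Proof.
move=> /andP[l0 l3] /andP[s0 s1] xl /andP[h0 h1].
have x3 : x < 3 by rewrite (le_lt_trans _ l3)// (le_trans _ xl)// ler_norm.
have lx : x <= lam by rewrite (le_trans _ xl)// ler_norm.
have pk0 : 0 < peak lam by rewrite invr_gt0; lra.
pose e := expR x - 1 - x.
have e0 : 0 <= e by have := expR_ge1Dx x; rewrite /e; lra.
have ex : e <= x ^+ 2 / 2 * peak lam.
  rewrite ler_pdivlMr; last by lra.
  have := expR_bernstein x.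
  have -> : expR x = e + 1 + x by rewrite /e; lra.
  have : 0 <= (lam - x) * e by rewrite mulr_ge0// subr_ge0.
  by rewrite !expr2; lra.
pose w := s * h ^+ 2 / 2.
have h2 : 0 <= h ^+ 2 <= 1 by rewrite sqr_ge0 expr_le1.
have w0 : 0 <= w by rewrite /w divr_ge0// mulr_ge0//; case/andP: h2.
have ws : w <= s / 2.
  by rewrite /w ler_pM2r// ler_piMr//; case/andP: h2.
pose f := expR w - 1 - w.
have f0 : 0 <= f by have := expR_ge1Dx w; rewrite /f; lra.
(* Bernstein at [w <= 1 / 2] gives [f <= 3 / 5 * w ^+ 2], and [w <= s / 2]. *)
have fw : f <= 3 / 10 * s * w.
  have := expR_bernstein w.
  have -> : expR w = f + 1 + w by rewrite /f; lra.
  have : 0 <= (1 / 2 - w) * f by rewrite mulr_ge0// subr_ge0; lra.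
  have : w * w <= s / 2 * w by apply: ler_wpM2r.
  by rewrite !expr2; lra.
have xw : w * `|x| <= s / 4 * (x ^+ 2 / lam + lam * h ^+ 2).
  have amgm : 2 * (h * `|x|) <= x ^+ 2 / lam + lam * h ^+ 2.
    rewrite -subr_ge0.
    have -> : x ^+ 2 / lam + lam * h ^+ 2 - 2 * (h * `|x|) =
        (`|x| - lam * h) ^+ 2 / lam.
      by rewrite -[x ^+ 2]real_normK ?num_real//; field; rewrite gt_eqF.
    by rewrite divr_ge0 ?sqr_ge0// ltW.
  have hh : h ^+ 2 * `|x| <= h * `|x|.
    by apply: ler_wpM2r => //; rewrite expr2 ler_piMl.
  have -> : w * `|x| = s / 2 * (h ^+ 2 * `|x|) by rewrite /w; field.
  have -> : s / 4 = s / 2 / 2 by field.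
  rewrite -[leRHS]mulrA; apply: ler_wpM2l; first by rewrite divr_ge0.
  by apply: (le_trans hh); lra.
rewrite expRD -/w.
have -> : expR x = e + 1 + x by rewrite /e; lra.
have -> : expR w = f + 1 + w by rewrite /f; lra.
have li0 : 0 < lam^-1 by rewrite invr_gt0.
have x20 : 0 <= x ^+ 2 by exact: sqr_ge0.
(* The constant is [13 / 20 = 1 / 2 + 3 / 20], from [w <= s / 2] and [f <= 3 / 20 * s]. *)
have t1 : (f + 1 + w) * e <= (1 + 13 / 20 * s) * (x ^+ 2 / 2 * peak lam).
  apply: ler_pM => //; first by lra.
  have : s * w <= s * (1 / 2) by apply: ler_wpM2l => //; lra.
  by lra.
have t2 : (f + w) * x <= (f + w) * `|x|.
  by apply: ler_wpM2l; [lra|exact: ler_norm].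
have t3 : (f + w) * `|x| <= (1 + 3 / 10 * s) * (w * `|x|).
  by rewrite mulrA ler_wpM2r//; lra.
have t4 : (1 + 3 / 10 * s) * (w * `|x|) <=
    (1 + 3 / 10 * s) * (s / 4 * (x ^+ 2 / lam + lam * h ^+ 2)).
  by apply: ler_wpM2l => //; lra.
have t5 : s * (s * (x ^+ 2 / lam)) <= 1 * (s * (x ^+ 2 / lam)).
  by apply: ler_wpM2r => //; rewrite mulr_ge0// divr_ge0// ltW.
have E4 : (1 + 3 / 10 * s) * (s / 4 * (x ^+ 2 / lam + lam * h ^+ 2)) =
    1 / 4 * (s * (x ^+ 2 / lam)) + 3 / 40 * (s * (s * (x ^+ 2 / lam)))
    + (1 + 3 / 10 * s) * (lam / 2) * w.
  by rewrite /w; field; rewrite gt_eqF.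
rewrite E4 in t4.
have E5 : (peak lam + 13 / 20 * s * (peak lam + lam^-1)) * x ^+ 2 / 2 =
   (1 + 13 / 20 * s) * (x ^+ 2 / 2 * peak lam) + 13 / 40 * (s * (x ^+ 2 / lam)).
  by field; rewrite gt_eqF.
rewrite E5; move: t1 t2 t3 t4 t5 fw.
move: (x ^+ 2 / lam) (x ^+ 2 / 2 * peak lam) => A B.
lra.
Qed.

End RealAnalysis.

(** * The measure [varpi] on [[1, +oo[] *)

Section MixingMeasure.
Context (R : realType).
Local Notation e := (expR 1 : R).

(* [varpi_tail x] is the mass of [x, +oo[ under [varpi], for [x >= 1]. *)
Definition varpi_tail (x : R) : R := (e + 1) / 2 * (e + ln (e + ln x))^-1.

Let e_gt0 : 0 < e. Proof. exact: expR_gt0. Qed.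

Let outer_gt0 (x : R) : 1 <= x -> 1 <= e + ln x.
Proof.
move=> x1; have := ln_ge0 x1; have : 1 + 1 <= e by exact: expR_ge1Dx.
by lra.
Qed.

Let inner_gt0 (x : R) : 1 <= x -> e <= e + ln (e + ln x).
Proof. by move=> x1; rewrite lerDl ln_ge0// outer_gt0. Qed.

Let is_derive_inner (x : R) : 1 <= x ->
  is_derive x 1 (fun x => e + ln (e + ln x)) (x^-1 / (e + ln x)).
Proof.
move=> x1; have x0 : 0 < x by exact: lt_le_trans x1.
have o0 : 0 < e + ln x by rewrite (lt_le_trans _ (outer_gt0 x1)).
have d1 := der_add (der_cst e x) (der_ln x0 (der_id x)).
have d2 := der_add (der_cst e x) (@der_ln R (fun t => e + ln t) x _ o0 d1).
by eapply der_eq; [exact: d2|rewrite add0r add0r mul1r].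
Qed.

Let smooth_density (x : R) : R :=
  (e + 1) * (2 * x * (e + ln x) * (e + ln (e + ln x)) ^+ 2)^-1.

Let varpi_densityE (x : R) : 1 <= x -> varpi_density x = smooth_density x.
Proof. by move=> x1; rewrite /varpi_density ger0_norm ?ln_ge0. Qed.

Let smooth_den_gt0 (x : R) : 1 <= x ->
  0 < 2 * x * (e + ln x) * (e + ln (e + ln x)) ^+ 2.
Proof.
move=> x1; have x0 : 0 < x by exact: lt_le_trans x1.
apply: mulr_gt0; last by apply: exprn_gt0; exact: lt_le_trans (inner_gt0 x1).
by apply: mulr_gt0; [exact: mulr_gt0|exact: lt_le_trans (outer_gt0 x1)].
Qed.

Let is_derive_tail (x : R) : 1 <= x ->
  is_derive x 1 (fun x => - varpi_tail x) (smooth_density x).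
Proof.
move=> x1; have x0 : 0 < x by exact: lt_le_trans x1.
have o0 : 0 < e + ln x by rewrite (lt_le_trans _ (outer_gt0 x1)).
have i0 : 0 < e + ln (e + ln x) by rewrite (lt_le_trans _ (inner_gt0 x1)).
have di := @der_inv R (fun t => e + ln (e + ln t)) x _ (lt0r_neq0 i0)
  (is_derive_inner x1).
have := der_opp (der_mul (der_cst ((e + 1) / 2) x) di).
move=> h; apply: der_eq h _; rewrite /smooth_density.
by field; rewrite !gt_eqF.
Qed.

Let continuous_tail (x : R) : 1 <= x ->
  {for x, continuous (fun x => - varpi_tail x)}.
Proof.
move=> x1; apply: differentiable_continuous; apply/derivable1_diffP.
by case: (is_derive_tail x1).
Qed.

Let derivable_density (x : R) : 1 <= x -> derivable smooth_density x 1.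
Proof.
move=> x1; have x0 : 0 < x by exact: lt_le_trans x1.
have d1 := der_add (der_cst e x) (der_ln x0 (der_id x)).
have d2 := der_mul (der_mul (der_mul (der_cst 2 x) (der_id x)) d1)
  (der_sqr (is_derive_inner x1)).
have := der_mul (der_cst (e + 1) x) (@der_inv R _ x _ (lt0r_neq0 (smooth_den_gt0 x1)) d2).
by case.
Qed.

(** Above [1] the absolute value in the density disappears and [- varpi_tail] is an
    antiderivative. *)
Lemma varpi_itv (a b : R) : 1 <= a -> a < b ->
  varpi `[a, b] = (varpi_tail a - varpi_tail b)%:E.
Proof.
move=> a1 ab; rewrite /varpi.
have -> : `[a, b]%classic `&` [set rho : R | 0 < rho] = `[a, b]%classic.
  apply/setIidl => x /=; rewrite in_itv/= => /andP[ax _].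
  by rewrite (lt_le_trans _ ax)// (lt_le_trans _ a1).
transitivity (\int[lebesgue_measure]_(x in `[a, b]) (smooth_density x)%:E)%E.
  apply: eq_integral => x; rewrite inE/= in_itv/= => /andP[ax _].
  by rewrite varpi_densityE// (le_trans a1).
have ge1 x : a <= x -> 1 <= x by exact: le_trans.
rewrite (@continuous_FTC2 _ _ (fun x => - varpi_tail x))//.
- by rewrite -EFinB opprK addrC.
- apply: derivable_within_continuous => x; rewrite in_itv/= => /andP[ax _].
  exact/derivable_density/ge1.
- split.
  + move=> x; rewrite in_itv/= => /andP[ax _].
    by case: (is_derive_tail (ge1 _ (ltW ax))).
  + exact: cvg_at_right_filter (continuous_tail a1).
  + exact: cvg_at_left_filter (continuous_tail (ge1 _ (ltW ab))).
- move=> x; rewrite in_itv/= => /andP[ax _]; rewrite derive1E.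
  by case: (is_derive_tail (ge1 _ (ltW ax))) => _ ->.
Qed.

Lemma varpi_tail1 : varpi_tail 1 = 1 / 2.
Proof.
rewrite /varpi_tail ln1 addr0 expRK; field.
by rewrite gt_eqF// addr_gt0.
Qed.

Lemma varpi_tail_gt0 (x : R) : 1 <= x -> 0 < varpi_tail x.
Proof.
move=> x1; rewrite mulr_gt0 ?divr_gt0 ?addr_gt0 ?invr_gt0//.
by rewrite (lt_le_trans _ (inner_gt0 x1)).
Qed.

Lemma varpi_tail_lt (a b : R) : 1 <= a -> a < b -> varpi_tail b < varpi_tail a.
Proof.
move=> a1 ab; have b1 : 1 <= b by rewrite (le_trans a1)// ltW.
have o0 x : 1 <= x -> 0 < e + ln x.
  by move=> x1; rewrite (lt_le_trans _ (outer_gt0 x1)).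
have i0 x : 1 <= x -> 0 < e + ln (e + ln x).
  by move=> x1; rewrite (lt_le_trans _ (inner_gt0 x1)).
rewrite ltr_pM2l ?divr_gt0 ?addr_gt0//.
rewrite ltf_pV2 ?posrE ?i0// ltrD2l ltr_ln ?posrE ?o0// ltrD2l ltr_ln// posrE.
  exact: lt_le_trans a1.
exact: lt_le_trans b1.
Qed.

(* The density of [varpi] decreases in the logarithmic scale away from [1]. *)
Lemma varpi_tail_diff_anti (u a b : R) : 1 < u -> 1 <= a -> a <= b ->
  varpi_tail b - varpi_tail (u * b) <= varpi_tail a - varpi_tail (u * a).
Proof.
move=> u1 a1 ab.
have a0 : 0 < a by exact: lt_le_trans a1.
have b1 : 1 <= b by exact: le_trans ab.
have b0 : 0 < b by exact: lt_le_trans b1.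
have u0 : 0 < u by exact: lt_trans u1.
(* The difference of two reciprocals becomes a product of nonnegative factors, each nonincreasing in
   [x]. *)
have gapE x : 1 <= x -> varpi_tail x - varpi_tail (u * x) = (e + 1) / 2 *
    (ln ((e + ln (u * x)) / (e + ln x)) *
     ((e + ln (e + ln x))^-1 * (e + ln (e + ln (u * x)))^-1)).
  move=> x1; have ux1 : 1 <= u * x by rewrite (le_trans x1)// ler_peMl ?ltW// (lt_le_trans _ x1).
  have o1 := lt_le_trans ltr01 (outer_gt0 x1).
  have o2 := lt_le_trans ltr01 (outer_gt0 ux1).
  rewrite ln_div ?posrE// /varpi_tail.
  have i1 := lt_le_trans e_gt0 (inner_gt0 x1).
  have i2 := lt_le_trans e_gt0 (inner_gt0 ux1).
  move: (ln (e + ln x)) (ln (e + ln (u * x))) i1 i2 => A B i1 i2.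
  by field; rewrite !gt_eqF.
have inv_anti x y : 1 <= x -> x <= y ->
    (e + ln (e + ln y))^-1 <= (e + ln (e + ln x))^-1.
  move=> x1 xy; have y1 : 1 <= y by exact: le_trans xy.
  rewrite lef_pV2 ?posrE ?(lt_le_trans e_gt0 (inner_gt0 _))// lerD2l.
  rewrite ler_ln ?posrE ?(lt_le_trans ltr01 (outer_gt0 _))// lerD2l.
  by rewrite ler_ln ?posrE// (lt_le_trans ltr01).
rewrite !gapE//; apply: ler_wpM2l; first by rewrite divr_ge0 ?addr_ge0// ltW.
have lu : 0 <= ln u by rewrite ln_ge0// ltW.
have lnu x : 0 < x -> ln (u * x) = ln u + ln x by move=> x0; rewrite lnM ?posrE.
have lab : ln a <= ln b by rewrite ler_ln ?posrE.
have oa := lt_le_trans ltr01 (outer_gt0 a1).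
have ob := lt_le_trans ltr01 (outer_gt0 b1).
have ua1 : 1 <= u * a by rewrite (le_trans a1)// ler_peMl ?ltW.
have ub1 : 1 <= u * b by rewrite (le_trans b1)// ler_peMl ?ltW.
have oua := lt_le_trans ltr01 (outer_gt0 ua1).
have oub := lt_le_trans ltr01 (outer_gt0 ub1).
apply: ler_pM.
- rewrite ln_ge0// ler_pdivlMr// mul1r lerD2l lnu//; lra.
- by rewrite mulr_ge0// invr_ge0 ltW// (lt_le_trans e_gt0)// inner_gt0.
- rewrite ler_ln ?posrE ?divr_gt0// !lnu//.
  rewrite ler_pdivrMr// mulrAC ler_pdivlMr//.
  have : ln u * ln a <= ln u * ln b by apply: ler_wpM2l.
  lra.
- apply: ler_pM; rewrite ?invr_ge0 ?(ltW (lt_le_trans e_gt0 (inner_gt0 _)))//.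
    exact: inv_anti.
  by apply: inv_anti => //; rewrite ler_pM2l.
Qed.

End MixingMeasure.

(** * Gibbs variational inequality and independent biased signs *)

Section Signs.
Context (R : realType).

(** Termwise [ln t <= t - 1] at [t = p j * W j / (q j * S)]; the right-hand sides, weighted by [q],
    sum to zero. *)
Lemma gibbs_variational (J : finType) (p q W : J -> R) :
  (forall j, 0 < p j) -> (forall j, 0 < q j) -> \sum_j q j = 1 ->
  (forall j, 0 < W j) ->
  \sum_j q j * ln (W j) - \sum_j q j * ln (q j / p j)
  <= ln (\sum_j p j * W j).
Proof.
move=> p0 q0 q1 W0.
have [j0 _|noJ] := pickP (fun _ : J => true); last first.
  by exfalso; move: q1; rewrite big_pred0// => /esym/eqP; rewrite oner_eq0.
pose S := \sum_j p j * W j.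
have S0 : 0 < S.
  rewrite /S (bigD1 j0)//= ltr_pwDl ?mulr_gt0//.
  by apply: sumr_ge0 => j _; rewrite ltW// mulr_gt0.
rewrite -sumrB -/S.
have -> : ln S = \sum_j (q j * ln S + (p j * W j / S - q j)).
  rewrite big_split/= -mulr_suml q1 mul1r sumrB q1 -mulr_suml -/S.
  by rewrite divff ?gt_eqF// subrr addr0.
apply: ler_sum => j _; rewrite -mulrBr -ln_div ?posrE ?divr_gt0//.
have -> : p j * W j / S - q j = q j * (p j * W j / (q j * S) - 1).
  by field; rewrite !gt_eqF.
rewrite -mulrDr ler_pM2l// -lerBlDl -ln_div ?posrE ?divr_gt0//.
have -> : W j / (q j / p j) / S = p j * W j / (q j * S).
  by field; rewrite !gt_eqF.
by rewrite -ler_expR lnK ?posrE ?divr_gt0 ?mulr_gt0// (le_trans _ (expR_ge1Dx _))// addrC subrK.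
Qed.

Definition sgb (b : bool) : R := if b then 1 else -1.

Context (I : finType).
Implicit Types (mu t : I -> R) (xi : {ffun I -> bool}).

(** The law of independent signs with means [mu l]; [mu = 0] gives the uniform prior. *)
Definition sign_weight mu xi : R := \prod_l ((1 + sgb (xi l) * mu l) / 2).

Definition sign_sum xi t : R := \sum_l sgb (xi l) * t l.

Lemma sum_sign_prod (f : I -> bool -> R) :
  \sum_(xi : {ffun I -> bool}) \prod_l f l (xi l) = \prod_l (f l true + f l false).
Proof.
by rewrite -(bigA_distr_bigA (fun l b => f l b)); apply: eq_bigr => l _; rewrite big_bool.
Qed.

Lemma sign_weight_sum mu : \sum_(xi : {ffun I -> bool}) sign_weight mu xi = 1.
Proof.
rewrite (sum_sign_prod (fun l b => (1 + sgb b * mu l) / 2)).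
by apply: big1 => l _; rewrite /sgb; field.
Qed.

Lemma sign_weight_gt0 mu xi : (forall l, -1 < mu l < 1) -> 0 < sign_weight mu xi.
Proof.
move=> mu1; apply: prodr_gt0 => l _; have /andP[a b] := mu1 l.
by rewrite divr_gt0// /sgb; case: (xi l); lra.
Qed.

Lemma sign_weight_marginal mu l0 (g : bool -> R) :
  \sum_(xi : {ffun I -> bool}) sign_weight mu xi * g (xi l0) =
  (1 + mu l0) / 2 * g true + (1 - mu l0) / 2 * g false.
Proof.
pose f l b := (1 + sgb b * mu l) / 2 * (if l == l0 then g b else 1).
transitivity (\sum_(xi : {ffun I -> bool}) \prod_l f l (xi l)).
  apply: eq_bigr => xi _; rewrite /f big_split/=; congr (_ * _).
  by rewrite -big_mkcond/= big_pred1_eq.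
rewrite sum_sign_prod (bigD1 l0)//= big1 ?mulr1.
  by rewrite /f eqxx /sgb mul1r mulN1r.
by move=> l ll0; rewrite /f (negbTE ll0) /sgb; field.
Qed.

Lemma sign_sum_mean mu t :
  \sum_(xi : {ffun I -> bool}) sign_weight mu xi * sign_sum xi t = \sum_l mu l * t l.
Proof.
under eq_bigr do rewrite mulr_sumr.
rewrite exchange_big/=; apply: eq_bigr => l _.
under eq_bigr do rewrite mulrA.
rewrite -mulr_suml (sign_weight_marginal mu l sgb) /sgb.
by field.
Qed.

Lemma sign_sum_mgf mu t : (forall l, -1 < mu l < 1) ->
  \sum_(xi : {ffun I -> bool}) sign_weight mu xi * expR (sign_sum xi t)
  <= expR (\sum_l (mu l * t l + t l ^+ 2 / 2)).
Proof.
move=> mu1.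
pose f l b := (1 + sgb b * mu l) / 2 * expR (sgb b * t l).
have -> : \sum_(xi : {ffun I -> bool}) sign_weight mu xi * expR (sign_sum xi t) =
    \sum_(xi : {ffun I -> bool}) \prod_l f l (xi l).
  by apply: eq_bigr => xi _; rewrite /sign_sum expR_sum -big_split.
rewrite sum_sign_prod expR_sum; apply: ler_prod => l _.
have /andP[a b] := mu1 l.
rewrite /f /sgb !mul1r !mulN1r hoeffding_sign// andbT.
by rewrite addr_ge0// mulr_ge0 ?expR_ge0// divr_ge0//; lra.
Qed.

(** Relative entropy is additive over independent coordinates, so the one-sign bound
    [sign_entropy_le] sums up. *)
Lemma sign_entropy mu : (forall l, -1 < mu l < 1) ->
  \sum_(xi : {ffun I -> bool}) sign_weight mu xi * ln (sign_weight mu xi / 2^-1 ^+ #|I|)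
  <= \sum_l (mu l ^+ 2 / 2 + mu l ^+ 4 / 3).
Proof.
move=> mu1.
have pos l b : 0 < 1 + sgb b * mu l.
  by have /andP[? ?] := mu1 l; rewrite /sgb; case: b; lra.
have lnE xi : ln (sign_weight mu xi / 2^-1 ^+ #|I|) =
    \sum_l ln (1 + sgb (xi l) * mu l).
  rewrite -prodr_const /sign_weight -prodf_div.
  apply: expR_inj; rewrite lnK ?posrE; last first.
    by apply: prodr_gt0 => l _; rewrite !divr_gt0.
  rewrite expR_sum; apply: eq_bigr => l _; rewrite lnK ?posrE//.
  by rewrite invrK divfK.
under eq_bigr do rewrite lnE mulr_sumr.
rewrite exchange_big/=; apply: ler_sum => l _.
under eq_bigr do rewrite mulrC.
rewrite (eq_bigr (fun xi => sign_weight mu xi * ln (1 + sgb (xi l) * mu l))); last first.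
  by move=> xi _; rewrite mulrC.
rewrite (sign_weight_marginal mu l (fun b => ln (1 + sgb b * mu l))) /sgb mul1r mulN1r.
exact: sign_entropy_le.
Qed.

Lemma sign_variational mu (W : {ffun I -> bool} -> R) :
  (forall l, -1 < mu l < 1) -> (forall xi, 0 < W xi) ->
  \sum_(xi : {ffun I -> bool}) sign_weight mu xi * ln (W xi)
    - \sum_l (mu l ^+ 2 / 2 + mu l ^+ 4 / 3)
  <= ln (\sum_(xi : {ffun I -> bool}) 2^-1 ^+ #|I| * W xi).
Proof.
move=> mu1 W0.
apply: (le_trans _ (gibbs_variational (q := sign_weight mu) _ _ _ W0)).
- by rewrite lerD2l lerN2 sign_entropy.
- by move=> xi; rewrite exprn_gt0.
- by move=> xi; exact: sign_weight_gt0.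
- exact: sign_weight_sum.
Qed.

End Signs.

(** * Hilbert space geometry and orthonormal bases *)

Section Hilbert.
Context (R : realType) (H : completeNormedModType R) (dot : {dot H for idfun}).
Hypothesis hdot : induces_norm dot.
Implicit Types (x y z : H) (e : nat -> H).

Lemma dotC x y : dot x y = dot y x.
Proof. by rewrite hermC expr0 mul1r. Qed.

Lemma dotDl x y z : dot (x + y) z = dot x z + dot y z.
Proof. exact: linearDl. Qed.

Lemma dotDr x y z : dot z (x + y) = dot z x + dot z y.
Proof. exact: linearDr. Qed.

Lemma dotZl (a : R) x y : dot (a *: x) y = a * dot x y.
Proof. exact: linearZl_LR. Qed.

Lemma dotZr (a : R) x y : dot x (a *: y) = a * dot x y.
Proof. exact: linearZr_LR. Qed.

Lemma dot0l x : dot 0 x = 0. Proof. exact: linear0l. Qed.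

Lemma dot0r x : dot x 0 = 0. Proof. exact: linear0r. Qed.

Lemma dotBl x y z : dot (x - y) z = dot x z - dot y z.
Proof. exact: linearBl. Qed.

Lemma dotBr x y z : dot z (x - y) = dot z x - dot z y.
Proof. exact: linearBr. Qed.

Lemma dot_suml I (r : seq I) (F : I -> H) y :
  dot (\sum_(i <- r) F i) y = \sum_(i <- r) dot (F i) y.
Proof. by elim/big_rec2: _ => [|i a b _ <-]; rewrite ?dot0l// dotDl. Qed.

Lemma dot_sumr I (r : seq I) (F : I -> H) y :
  dot y (\sum_(i <- r) F i) = \sum_(i <- r) dot y (F i).
Proof. by elim/big_rec2: _ => [|i a b _ <-]; rewrite ?dot0r// dotDr. Qed.

Lemma dot_ge0 x : 0 <= dot x x. Proof. by rewrite -hdot sqr_ge0. Qed.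

Lemma cauchy_schwarz x y : `|dot x y| <= `|x| * `|y|.
Proof.
rewrite -(@ler_pXn2r _ 2)// ?nnegrE ?mulr_ge0// exprMn real_normK ?num_real//.
have [->|y0] := eqVneq y 0; first by rewrite dot0r expr0n/= mulr_ge0.
have ny : 0 < `|y| ^+ 2 by rewrite exprn_gt0// normr_gt0.
have := dot_ge0 (`|y| ^+ 2 *: x - dot x y *: y).
rewrite dotBl !dotBr !dotZl !dotZr (dotC y x) -!hdot.
move: (`|y| ^+ 2) (`|x| ^+ 2) (dot x y) ny => b a c b0.
have -> : b * (b * a) - b * (c * c) - (c * (b * c) - c * (c * b)) =
   b * (a * b - c ^+ 2) by ring.
by rewrite pmulr_rge0// subr_ge0.
Qed.

Definition orthonormal_seq e :=
  (forall i j, i != j -> dot (e i) (e j) = 0) /\ forall i, e i = 0 \/ `|e i| = 1.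

Definition partial_proj e (n : nat) x : H := \sum_(i < n) dot (e i) x *: e i.

Lemma orthonormal_seq_sqr e i : orthonormal_seq e -> dot (e i) (e i) = 1 \/ e i = 0.
Proof.
move=> [_ /(_ i)[->|n1]]; first by right.
by left; rewrite -hdot n1 expr1n.
Qed.

Lemma dot_partial_proj e n i x : orthonormal_seq e -> (i < n)%N ->
  dot (e i) (partial_proj e n x) = dot (e i) x.
Proof.
move=> oe i_n; rewrite /partial_proj dot_sumr (bigD1 (Ordinal i_n))//= big1.
  rewrite addr0 dotZr; case: (orthonormal_seq_sqr i oe) => ->.
    by rewrite mulr1.
  by rewrite dot0l mul0r.
by move=> j ji; rewrite dotZr (oe.1) ?mulr0// eq_sym.
Qed.

Lemma partial_proj_sqr e n x : orthonormal_seq e ->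
  dot (partial_proj e n x) (partial_proj e n x) = \sum_(i < n) dot (e i) x ^+ 2.
Proof.
move=> oe; rewrite {1}/partial_proj dot_suml; apply: eq_bigr => i _.
by rewrite dotZl dot_partial_proj// expr2.
Qed.

Lemma dot_partial_projl e n x y :
  dot (partial_proj e n x) y = \sum_(i < n) dot (e i) x * dot (e i) y.
Proof. by rewrite dot_suml; apply: eq_bigr => i _; rewrite dotZl. Qed.

Lemma partial_proj_sub_sqr e n x : orthonormal_seq e ->
  dot (x - partial_proj e n x) (x - partial_proj e n x) =
  `|x| ^+ 2 - \sum_(i < n) dot (e i) x ^+ 2.
Proof.
move=> oe; rewrite dotBl !dotBr partial_proj_sqr// (dotC x) dot_partial_projl.
by rewrite -hdot subrr subr0; congr (_ - _); apply: eq_bigr => i _; rewrite expr2.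
Qed.

Lemma bessel e n x : orthonormal_seq e ->
  \sum_(i < n) dot (e i) x ^+ 2 <= `|x| ^+ 2.
Proof. by move=> oe; rewrite -subr_ge0 -partial_proj_sub_sqr// dot_ge0. Qed.

Lemma norm_partial_proj_sub e n x : orthonormal_seq e ->
  `|x - partial_proj e n x| <= `|x|.
Proof.
move=> oe; rewrite -(@ler_pXn2r _ 2)// ?nnegrE// hdot partial_proj_sub_sqr//.
by rewrite gerBl sumr_ge0// => i _; rewrite sqr_ge0.
Qed.

Lemma norm_partial_proj_le e n x : orthonormal_seq e -> `|partial_proj e n x| <= `|x|.
Proof.
move=> oe; rewrite -(@ler_pXn2r _ 2)// ?nnegrE// hdot partial_proj_sqr//.
exact: bessel.
Qed.

(** The list of earlier vectors is carried along because every step uses all of them. A vector in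
    the span of its predecessors yields [0], which [orthonormal_basis] admits. *)
Fixpoint gram_schmidt_seq (z : nat -> H) (n : nat) : seq H :=
  if n is m.+1 then
    let s := gram_schmidt_seq z m in
    let u := z m - \sum_(f <- s) dot f (z m) *: f in
    rcons s (`|u|^-1 *: u)
  else [::].

Definition gram_schmidt (z : nat -> H) (n : nat) : H :=
  let u := z n - \sum_(f <- gram_schmidt_seq z n) dot f (z n) *: f in
  `|u|^-1 *: u.

Lemma gram_schmidt_seqE (z : nat -> H) n :
  gram_schmidt_seq z n = [seq gram_schmidt z i | i <- iota 0 n].
Proof.
elim: n => // n IH; rewrite -addn1 iotaD map_cat -IH/= add0n addn1/=.
by rewrite -cats1.
Qed.

Lemma gram_schmidtE (z : nat -> H) n : let u := z n - partial_proj (gram_schmidt z) n (z n) in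
  gram_schmidt z n = `|u|^-1 *: u.
Proof.
have -> : partial_proj (gram_schmidt z) n (z n) =
    \sum_(f <- gram_schmidt_seq z n) dot f (z n) *: f.
  rewrite gram_schmidt_seqE big_map /partial_proj.
  rewrite -(big_mkord xpredT (fun i => dot (gram_schmidt z i) (z n) *: gram_schmidt z i)).
  by rewrite /index_iota subn0.
by [].
Qed.

Lemma gram_schmidt_orthonormal (z : nat -> H) : orthonormal_seq (gram_schmidt z).
Proof.
set e := gram_schmidt z.
have n1 i : e i = 0 \/ `|e i| = 1.
  rewrite /e gram_schmidtE; set u := _ - _.
  have [->|u0] := eqVneq u 0; [left|right]; first by rewrite scaler0.
  by rewrite normrZ normfV normr_id mulVf ?normr_eq0.
have ort n : forall i, (i < n)%N -> forall j, (j < i)%N -> dot (e j) (e i) = 0.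
  elim: n => // n IH i; rewrite ltnS leq_eqVlt => /predU1P[->|]; last exact: IH.
  move=> j jn; rewrite [e n]gram_schmidtE dotZr; apply/eqP; rewrite mulf_eq0.
  apply/orP; right; apply/eqP; rewrite dotBr -/e.
  rewrite /partial_proj dot_sumr (bigD1 (Ordinal jn))//= big1 ?addr0.
    rewrite dotZr; case: (n1 j) => [->|nj]; first by rewrite !dot0l mul0r subrr.
    by rewrite -hdot nj expr1n mulr1 subrr.
  move=> k kj; rewrite dotZr; have [jk|kj'|jk] := ltngtP j k.
  - by rewrite (IH k)// mulr0.
  - by rewrite dotC (IH j)// mulr0.
  - by move: kj; rewrite -val_eqE/= jk eqxx.
split=> // i j; rewrite neq_ltn => /orP[] ij.
  exact: (ort j.+1).
by rewrite dotC; exact: (ort i.+1).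
Qed.

Lemma gram_schmidt_span (z : nat -> H) n :
  partial_proj (gram_schmidt z) n.+1 (z n) = z n.
Proof.
set e := gram_schmidt z.
have oe : orthonormal_seq e by exact: gram_schmidt_orthonormal.
apply/esym/eqP; rewrite -subr_eq0.
have -> : z n - partial_proj e n.+1 (z n) =
    (z n - partial_proj e n (z n)) - dot (e n) (z n) *: e n.
  by rewrite /partial_proj big_ord_recr/= opprD addrA.
set u := z n - _.
have eE : e n = `|u|^-1 *: u by exact: gram_schmidtE.
have [u0|u0] := eqVneq u 0.
  by rewrite u0 eE u0 scaler0 dot0l scale0r subrr.
have nu : `|u| != 0 by rewrite normr_eq0.
have -> : dot (e n) (z n) = `|u|.
  have -> : z n = u + partial_proj e n (z n) by rewrite subrK.
  rewrite dotDr [X in _ + X](_ : _ = 0) ?addr0.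
    by rewrite eE dotZl -hdot expr2 mulKf.
  rewrite /partial_proj dot_sumr big1// => i _; rewrite dotZr oe.1 ?mulr0//.
  by rewrite gtn_eqF.
by rewrite eE scalerA divff// scale1r subrr.
Qed.

Lemma partial_proj_stable e n m x : orthonormal_seq e -> (n <= m)%N ->
  partial_proj e n x = x -> partial_proj e m x = x.
Proof.
move=> oe nm xE; rewrite -{2}xE /partial_proj -(subnKC nm) big_split_ord/=.
rewrite [X in _ + X]big1 ?addr0// => i _.
rewrite -[in dot _ x]xE dot_sumr big1 ?scale0r// => j _.
by rewrite dotZr oe.1 ?mulr0// gtn_eqF// ltn_addr.
Qed.

Lemma series_partial_proj e x :
  series (fun i => dot (e i) x *: e i) = partial_proj e ^~ x.
Proof. by apply/funext => n; rewrite /series/= big_mkord. Qed.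

Lemma dense_sequence : separable H ->
  exists z : nat -> H, forall x (eps : R), 0 < eps -> exists n, `|x - z n| < eps.
Proof.
move=> [D cD dD].
have near_D x (eps : R) : 0 < eps -> exists2 y, D y & `|x - y| < eps.
  move=> eps0; have [] := dD (ball x eps).
  - by exists x; exact: ballxx.
  - exact: ball_open.
  - by move=> y [xy Dy]; exists y => //; move: xy; rewrite -ball_normE.
have [y0 Dy0 _] := near_D 0 1 ltr01.
have /pfcard_geP[D0|/surjfunPex[z Dz]] := cD.
  by move: Dy0; rewrite D0.
exists z => x eps eps0; have [y Dy xy] := near_D x eps eps0.
by move: Dy; rewrite Dz => -[n _ zn]; exists n; rewrite zn.
Qed.

(** Gram-Schmidt on a dense sequence: once the projection fixes [z n], the remainder of [x] is that
    of [x - z n], of norm at most [|x - z n|]. *)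
Lemma orthonormal_basis_exists : separable H -> exists e, orthonormal_basis dot e.
Proof.
move=> /dense_sequence[z dz]; exists (gram_schmidt z).
have oe := gram_schmidt_orthonormal z.
split; [exact: oe.1|exact: oe.2|] => x; rewrite series_partial_proj.
apply/cvgrPdist_lt => eps eps0; have [n xn] := dz x eps eps0.
exists n.+1 => // m /= nm.
have zm : partial_proj (gram_schmidt z) m (z n) = z n.
  exact: partial_proj_stable (gram_schmidt_span z n).
have -> : x - partial_proj (gram_schmidt z) m x =
    (x - z n) - partial_proj (gram_schmidt z) m (x - z n).
  rewrite [partial_proj _ _ (x - z n)](_ : _ = partial_proj (gram_schmidt z) m x - z n).
    by rewrite opprB addrA subrK.
  rewrite -[in RHS]zm /partial_proj -sumrB; apply: eq_bigr => i _.
  by rewrite -scalerBl -dotBr.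
exact: le_lt_trans (norm_partial_proj_sub _ _ oe) xn.
Qed.

Lemma onbP : separable H -> orthonormal_basis dot (onb dot).
Proof. by move=> /orthonormal_basis_exists[e eb]; exact: xgetI eb. Qed.

Lemma onb_orthonormal : separable H -> orthonormal_seq (onb dot).
Proof. by move=> /onbP[]. Qed.

Lemma onb_cvg x : separable H -> partial_proj (onb dot) n x @[n --> \oo] --> x.
Proof. by move=> /onbP[_ _ /(_ x)]; rewrite series_partial_proj. Qed.

Lemma dot_le_opnorm (A : H -> H) v : bounded_linear A ->
  dot v (A v) <= opnorm A * `|v| ^+ 2.
Proof.
move=> [lA [k Ak]].
apply: (le_trans (ler_norm _)); apply: (le_trans (cauchy_schwarz _ _)).
rewrite expr2 mulrCA ler_wpM2l//.
have [->|v0] := eqVneq v 0.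
  by rewrite normr0 mulr0 (le_trans (Ak 0))// normr0 mulr0.
have nv : 0 < `|v| by rewrite normr_gt0.
have -> : A v = `|v| *: A (`|v|^-1 *: v).
  have := lA (`|v|^-1) v 0; rewrite addr0.
  have -> : A 0 = 0.
    by have := lA 1 0 0; rewrite scaler0 !addr0 scale1r => /eqP; rewrite -subr_eq0 opprD addNKr oppr_eq0 => /eqP.
  by rewrite addr0 => ->; rewrite scalerA divff ?gt_eqF// scale1r.
rewrite normrZ normr_id mulrC ler_wpM2r//.
apply: ub_le_sup; last first.
  by exists (`|v|^-1 *: v) => //=; rewrite normrZ normfV normr_id mulVf ?gt_eqF.
exists `|k| => _ [x /= x1 <-]; apply: (le_trans (Ak x)).
rewrite (@le_trans _ _ (`|k| * `|x|))//; first by rewrite ler_wpM2r// ler_norm.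
by rewrite ler_piMr.
Qed.

Lemma opnorm_ge0 (A : H -> H) : 0 <= opnorm A.
Proof.
rewrite /opnorm; set S := (X in sup X).
(* For an unbounded set [sup] takes the default value [0]. *)
have [hS|nS] := pselect (has_sup S); last by rewrite sup_out.
case: hS => [[r Sr] uS]; apply: (le_trans _ (ub_le_sup uS Sr)).
by case: Sr => x _ <-.
Qed.

End Hilbert.

(** * Scalar products of Bochner integrals *)

Section Bochner.
Context (R : realType) (H : completeNormedModType R) (dot : {dot H for idfun}).
Hypothesis hdot : induces_norm dot.
Context (d : measure_display) (T : measurableType d) (P : probability T R).

Lemma continuous_dot (h : H) : continuous (dot h).
Proof.
move=> x; apply/cvgrPdist_le => eps eps0.
near=> y; rewrite -dotBr (le_trans (cauchy_schwarz hdot _ _))//.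
have xy : `|x - y| <= eps / (`|h| + 1).
  near: y; apply: cvgr_dist_le; last by rewrite divr_gt0// ltr_wpDl.
  exact: cvg_id.
rewrite (le_trans (ler_wpM2l _ xy))// mulrCA ler_piMr ?(ltW eps0)//.
by rewrite ler_pdivrMr ?ltr_wpDl// mul1r lerDl.
Unshelve. all: by end_near. Qed.

Lemma borel_wrt_continuous (G : set (set T)) (X : T -> H) (f : H -> R) :
  continuous f -> borel_wrt G X -> measurable_wrt G (f \o X).
Proof.
move=> /continuousP cf mX; apply: (measurability _ (RGenOpens.measurableE R)).
move=> _ [_ [a [b ->] <-]].
rewrite setTI comp_preimage -[X in measurable X]setTI; apply: mX => //.
by apply: sub_sigma_algebra; apply: cf; exact: interval_open.
Qed.

Lemma borel_measurable (X : T -> H) (f : H -> R) :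
  continuous f -> borel_wrt measurable X -> measurable_fun setT (f \o X).
Proof.
move=> cf mX; apply: (measurable_wrtW (G := measurable)).
  by split => //; exact: sigma_algebra_measurable.
exact: borel_wrt_continuous.
Qed.

Lemma measurable_norm_sub (X : T -> H) (x : H) : borel_wrt measurable X ->
  measurable_fun setT (fun w => `|X w - x|).
Proof.
move=> mX; apply: (@borel_measurable X (fun z => `|z - x|)) => // z.
by apply: cvg_norm; apply: cvgB; [exact: cvg_id|exact: cvg_cst].
Qed.

Lemma dot_bochner_integrable (X : T -> H) (h : H) : bochner_integrable P X ->
  P.-integrable setT (fun w => (dot h (X w))%:E).
Proof.
move=> [mX iX].
have mdX : measurable_fun setT (fun w => dot h (X w)).
  exact: (@borel_measurable X (dot h) (@continuous_dot h)).
apply: (@le_integrable _ _ _ P setT measurableT _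
  (fun w => (`|h|%:E * (`|X w|)%:E)%E)).
- exact/measurable_EFinP.
- move=> w _; rewrite -EFinM /= lee_fin [leRHS]ger0_norm ?mulr_ge0//.
  exact: cauchy_schwarz.
- exact: integrableZl.
Qed.

Lemma simple_function_seq (s : T -> H) : simple_function s ->
  exists2 r : seq H, uniq r & forall w, s w \in r.
Proof.
move=> [/finite_seqP[r rE] _]; exists (undup r); first exact: undup_uniq.
move=> w; rewrite mem_undup.
by have : range s (s w) by []; rewrite rE.
Qed.

Lemma sum_simple_function (V : zmodType) (r : seq H) (s : T -> H) (f : H -> V) w :
  uniq r -> s w \in r -> \sum_(x <- r) (if s w == x then f x else 0) = f (s w).
Proof.
move=> ur sr; rewrite (bigD1_seq (s w))//= eqxx big1 ?addr0// => x xs.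
by rewrite eq_sym (negbTE xs).
Qed.

Lemma simple_integral_seq (D : set T) (s : T -> H) (r : seq H) : uniq r ->
  (forall w, s w \in r) ->
  simple_integral P D s = \sum_(x <- r) fine (P (D `&` s @^-1` [set x])) *: x.
Proof.
move=> ur sr; rewrite /simple_integral (@fsbigE _ _ _ _ _ r _ ur)// => [|x _ xr].
  by apply: eq_bigl => x; rewrite in_setT.
rewrite (_ : s @^-1` [set x] = set0) ?setI0 ?measure0 ?scale0r//.
by rewrite -subset0 => w /= sx; move: (sr w); rewrite sx (negbTE xr).
Qed.

Lemma dot_simple_integral (D : set T) (s : T -> H) (h : H) : measurable D ->
  simple_function s ->
  P.-integrable D (fun w => (dot h (s w))%:E) /\
  (\int[P]_(w in D) (dot h (s w))%:E)%E = (dot h (simple_integral P D s))%:E.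
Proof.
move=> mD ss; have [r ur sr] := simple_function_seq ss.
have ms x : measurable (s @^-1` [set x]) by case: ss.
have sE w : (dot h (s w))%:E =
    (\sum_(x <- r) (dot h x)%:E * (\1_(s @^-1` [set x]) w)%:E)%E.
  rewrite -(sum_simple_function (dot h) ur (sr w)) -sumEFin; apply: eq_bigr => x _.
  rewrite -EFinM indicE; case: eqP => [swx|swx].
    by rewrite mem_set ?mulr1.
  by rewrite memNset ?mulr0.
have i1 x : P.-integrable D (fun w => ((\1_(s @^-1` [set x]) w)%:E)).
  apply: (integrableS measurableT mD (@subsetT _ _)).
  by apply/integrable_indic => //; rewrite -ge0_fin_numE// fin_num_measure.
have ix x : P.-integrable D
    (fun w => (dot h x)%:E * (\1_(s @^-1` [set x]) w)%:E)%E.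
  by apply: integrableZl.
split.
  rewrite (_ : (fun w => _) = (fun w => \sum_(x <- r) (dot h x)%:E * (\1_(s @^-1` [set x]) w)%:E)%E).
    by apply: integrable_sum.
  by apply/funext.
under eq_integral do rewrite sE.
rewrite integral_sum//.
rewrite (simple_integral_seq _ ur sr) (dot_sumr dot) -sumEFin.
apply: eq_bigr => x _; rewrite dotZr integralZl// integral_indic// setIC.
by rewrite mulrC EFinM fineK// fin_num_measure//; exact: measurableI.
Qed.

(** Splitting over the finitely many values of [s] replaces a difference of two [H]-valued maps by
    differences with constants. *)
Lemma measurable_norm_sub_simple (X s : T -> H) : borel_wrt measurable X ->
  simple_function s -> measurable_fun setT (fun w => `|X w - s w|).
Proof.
move=> mX ss; have [r ur sr] := simple_function_seq ss.
have ms x : measurable (s @^-1` [set x]) by case: ss.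
rewrite (_ : (fun w => _) =
  (fun w => \sum_(x <- r) `|X w - x| * \1_(s @^-1` [set x]) w)).
  apply: measurable_sum => x; apply: measurable_funM.
    exact: measurable_norm_sub.
  exact: measurable_indic.
apply/funext => w; rewrite -(sum_simple_function (fun x => `|X w - x|) ur (sr w)).
apply: eq_bigr => x _; rewrite indicE; case: eqP => [swx|swx].
  by rewrite mem_set ?mulr1.
by rewrite memNset ?mulr0.
Qed.

(** The identity holds for the simple approximants, and by Cauchy-Schwarz the error on the left is
    at most [|h|] times the integral of [|X - s k|]. *)
Lemma dot_bochner_integral (D : set T) (X : T -> H) (v h : H) : measurable D ->
  bochner_integrable P X -> is_bochner_integral P D X v ->
  (\int[P]_(w in D) (dot h (X w))%:E)%E = (dot h v)%:E.
Proof.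
move=> mD bX [s [ss sX sv]].
have ihX : P.-integrable D (fun w => (dot h (X w))%:E).
  by apply: (integrableS measurableT) => //; exact: dot_bochner_integrable.
have ihs k := (dot_simple_integral h mD (ss k)).1.
have Ehs k := (dot_simple_integral h mD (ss k)).2.
pose a : R := fine (\int[P]_(w in D) (dot h (X w))%:E)%E.
have aE : (\int[P]_(w in D) (dot h (X w))%:E)%E = a%:E.
  by rewrite fineK// integrable_fin_num.
rewrite aE; congr (_%:E).
have c1 : dot h (simple_integral P D (s k)) @[k --> \oo] --> dot h v.
  by apply: continuous_cvg => //; exact: continuous_dot.
apply: (@cvg_unique _ _ (dot h (simple_integral P D (s k)) @[k --> \oo])) => //.
pose b k := (`|h|%:E * \int[P]_(w in D) (`|X w - s k w|)%:E)%E.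
have mXs k : measurable_fun D (fun w => `|X w - s k w|).
  by apply: measurable_funTS; apply: measurable_norm_sub_simple => //; case: bX.
have ab k : (`|a - dot h (simple_integral P D (s k))|%:E <= b k)%E.
  have E : (a - dot h (simple_integral P D (s k)))%:E =
      (\int[P]_(w in D) ((dot h (X w))%:E - (dot h (s k w))%:E))%E.
    by rewrite integralB// EFinB -aE Ehs.
  have -> : (`|a - dot h (simple_integral P D (s k))|%:E =
     `|\int[P]_(w in D) ((dot h (X w))%:E - (dot h (s k w))%:E)|)%E.
    by rewrite -E.
  have iD : P.-integrable D (fun w => (dot h (X w))%:E - (dot h (s k w))%:E)%E.
    exact: integrableB.
  apply: (le_trans (le_abse_integral P mD (measurable_int P iD))).
  rewrite /b -ge0_integralZl//; last exact/measurable_EFinP.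
  apply: ge0_le_integral => //.
  - by apply: measurableT_comp => //; exact: (measurable_int P iD).
  - by apply: emeasurable_funM => //; exact/measurable_EFinP.
  - move=> w _; rewrite -EFinB -EFinM abse_EFin lee_fin -dotBr.
    exact: cauchy_schwarz.
have bc : b k @[k --> \oo] --> 0%E.
  by rewrite -(mule0 `|h|%:E); apply: cvgeZl => //; exact: sX.
have /fine_cvgP[bfin /cvgrPdist_le b0] := bc.
apply/cvgrPdist_le => eps eps0; near=> k.
rewrite -lee_fin (le_trans (ab k))// -[b k]fineK; last by near: k.
rewrite lee_fin; near: k; move: (b0 eps eps0); apply: filterS => k.
by rewrite sub0r normrN; apply: le_trans; exact: ler_norm.
Unshelve. all: by end_near. Qed.

Lemma bochner_cond_exp0_dot (G : set (set T)) (X : T -> H) (h : H) (A : set T) :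
  sub_sigma_algebra_of G -> is_bochner_cond_exp P G X (fun=> 0) -> G A ->
  (\int[P]_(w in A) (dot h (X w))%:E = 0)%E.
Proof.
move=> [_ sG] [bX _ b0 XA] GA; have mA := sG _ GA; have [v Xv zv] := XA _ GA.
rewrite (dot_bochner_integral h mA bX Xv) -(dot_bochner_integral h mA b0 zv).
by under eq_integral do rewrite dot0r; rewrite integral0.
Qed.

End Bochner.

(** * Ville's maximal inequality *)

Section Ville.
Context (R : realType) (d : measure_display) (T : measurableType d)
  (P : probability T R) (F : nat -> set (set T)) (S : nat -> T -> R).
Hypotheses (fF : filtration F) (mS : forall n, measurable_wrt (F n) (S n))
  (S0 : forall n w, 0 <= S n w)
  (S1 : (\int[P]_w (S 0%N w)%:E <= 1)%E)
  (supS : forall n A, F n A ->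
    (\int[P]_(w in A) (S n.+1 w)%:E <= \int[P]_(w in A) (S n w)%:E)%E).

Let below (c : R) (n : nat) : set T := [set w | forall k, (k <= n)%N -> S k w <= c].

Let belowS c n : below c n.+1 = below c n `&` [set w | S n.+1 w <= c].
Proof.
apply/seteqP; split => w /=.
  by move=> h; split => [k kn|]; apply: h => //; exact: leqW.
by move=> [h hn] k; rewrite leq_eqVlt => /predU1P[->//|]; rewrite ltnS; exact: h.
Qed.

Let F_sublevel c n : F n [set w | S n w <= c].
Proof.
rewrite (_ : [set w | _] = S n @^-1` `]-oo, c]).
  by apply: (measurable_wrtP (fF.1 n) _).1 => //; exact: mS.
by apply/seteqP; split => w /=; rewrite in_itv.
Qed.

Let F_below c n : F n (below c n).
Proof.
have sI m A B : F m A -> F m B -> F m (A `&` B).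
  by rewrite -!(sub_sigma_measurable (fF.1 m)); exact: measurableI.
elim: n => [|n IH].
  rewrite (_ : below c 0 = [set w | S 0%N w <= c]); first exact: F_sublevel.
  by apply/seteqP; split => w /= => [|h k]; [exact|rewrite leqn0 => /eqP ->].
by rewrite belowS; apply: sI => //; apply: (fF.2 n).
Qed.

Let m_below c n : measurable (below c n).
Proof. exact: (fF.1 n).2. Qed.

Let mSt n : measurable_fun setT (S n).
Proof. by apply: (measurable_wrtW (fF.1 n)); exact: mS. Qed.

Let split_integral n (c : R) (D : set T) : measurable D -> 0 <= c ->
  (c%:E * P (D `&` [set w | (c < S n w)%R]) +
    \int[P]_(w in D `&` [set w | (S n w <= c)%R]) (S n w)%:E
   <= \int[P]_(w in D) (S n w)%:E)%E.
Proof.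
move=> mD c0.
have mA : measurable (D `&` [set w | S n w <= c]).
  by apply: measurableI => //; exact: (fF.1 n).2.
have mB : measurable (D `&` [set w | c < S n w]).
  rewrite (_ : [set w | _] = ~` [set w | S n w <= c]).
    by apply: measurableI => //; apply: measurableC; exact: (fF.1 n).2.
  by apply/seteqP; split => w /=; rewrite ltNge => /negP.
have DE : D = (D `&` [set w | c < S n w]) `|` (D `&` [set w | S n w <= c]).
  rewrite -setIUr (_ : _ `|` _ = setT) ?setIT//.
  by apply/seteqP; split => w //= _; case: (ltP c (S n w)); [left|right].
have dAB : [disjoint D `&` [set w | c < S n w] & D `&` [set w | S n w <= c]].
  by apply/disj_setPLR => w [_ /= cS] [_ /=]; rewrite leNgt cS.
rewrite [in leRHS]DE ge0_integral_setU//=; last 2 first.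
- by apply/measurable_EFinP; apply: measurable_funTS.
- by move=> w _; rewrite lee_fin.
apply: leeD => //; rewrite -integral_cst//.
apply: ge0_le_integral => //.
- by apply/measurable_EFinP; apply: measurable_funTS.
- by move=> w [_ /= /ltW]; rewrite lee_fin.
Qed.

(** Optional stopping in integrated form: the first term counts the paths that have exceeded [c],
    each at value [c], the second the current value on the others. One supermartingale step followed
    by Markov's inequality preserves the bound. *)
Let below_bound c n : 0 <= c ->
  (c%:E * P (~` below c n) + \int[P]_(w in below c n) (S n w)%:E <= 1)%E.
Proof.
move=> c0; elim: n => [|n IH].
  have := split_integral 0 measurableT c0; rewrite !setTI => h.
  apply: (le_trans _ (le_trans h S1)).
  rewrite (_ : below c 0 = [set w | S 0%N w <= c]).
    rewrite (_ : ~` _ = [set w | c < S 0%N w])//.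
    by apply/seteqP; split => w /=; rewrite ltNge => /negP.
  by apply/seteqP; split => w /= => [|h' k]; [exact|rewrite leqn0 => /eqP ->].
apply: (le_trans _ IH).
have := supS (F_below c n) => h.
apply: (le_trans _ (leeD (lexx (c%:E * P (~` below c n))%E) h)).
apply: (le_trans _ (leeD (lexx (c%:E * P (~` below c n))%E)
  (split_integral n.+1 (m_below c n) c0))).
rewrite -belowS (addeA (c%:E * P (~` below c n))%E) -ge0_muleDr//; apply: leeD => //.
apply: lee_wpmul2l; first by rewrite lee_fin.
have -> : ~` below c n.+1 = ~` below c n `|` (below c n `&` [set w | c < S n.+1 w]).
  rewrite belowS setCI; apply/seteqP; split => w /=.
    move=> [wn|wn]; first by left.
    have [wb|wb] := pselect (below c n w); last by left.
    by right; split => //; rewrite ltNge; exact/negP.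
  by move=> [wn|[_]]; [left|rewrite ltNge => /negP; right].
have mB : measurable (below c n `&` [set w | c < S n.+1 w]).
  rewrite (_ : [set w | _] = ~` [set w | S n.+1 w <= c]).
    by apply: measurableI => //; apply: measurableC; exact: (fF.1 n.+1).2.
  by apply/seteqP; split => w /=; rewrite ltNge => /negP.
rewrite measureU//; first exact: measurableC.
by apply/seteqP; split => w //= [h1 [h2 _]].
Qed.

Lemma ville (c : R) : 0 < c ->
  measurable [set w | exists n, c < S n w] /\
  (P [set w | exists n, (c < S n w)%R] <= (c^-1)%:E)%E.
Proof.
move=> c0.
have UE : [set w | exists n, c < S n w] = \bigcup_n ~` below c n.
  apply/seteqP; split => w /=.
    by move=> [n cn]; exists n => //= /(_ n (leqnn n)); rewrite leNgt cn.
  move=> [n _ /= /existsNP[k /not_implyP[_ /negP h]]].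
  by exists k; rewrite ltNge.
have mB n : measurable (~` below c n) by apply: measurableC.
have mU : measurable (\bigcup_n ~` below c n) by exact: bigcup_measurable.
rewrite UE; split => //.
have nd : nondecreasing_seq (fun n => ~` below c n).
  move=> m n mn; apply/subsetPset; apply: subsetC => w /= h k km.
  by apply: h; exact: leq_trans mn.
have cv := @nondecreasing_cvg_mu _ _ _ P _ mB mU nd.
rewrite -(cvg_lim _ cv)//; apply: lime_le; first by apply/cvg_ex; eexists; exact: cv.
near=> n => /=.
rewrite -[leLHS]mul1e -(mulVf (lt0r_neq0 c0)) EFinM -muleA -[leRHS]mule1.
apply: lee_wpmul2l; first by rewrite lee_fin invr_ge0 ltW.
apply: (le_trans _ (below_bound n (ltW c0))); rewrite leeDl//.
by apply: integral_ge0 => w _; rewrite lee_fin.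
Unshelve. all: by end_near. Qed.

End Ville.

(** * Order and linearity of conditional expectations *)

Section ConditionalExpectationCalculus.
Context (R : realType) (d : measure_display) (T : measurableType d)
  (P : probability T R) (G : set (set T)).
Hypothesis sG : sub_sigma_algebra_of G.
Implicit Types (Z Y : T -> R).

Lemma is_cond_exp_le Z1 Y1 Z2 Y2 : is_cond_exp P G Z1 Y1 ->
  is_cond_exp P G Z2 Y2 -> {ae P, forall w, Z1 w <= Z2 w} ->
  {ae P, forall w, Y1 w <= Y2 w}.
Proof.
move=> [iZ1 mY1 iY1 E1] [iZ2 mY2 iY2 E2] Z12.
apply: (ae_le_of_integral sG) => // A GA.
have mA : measurable A by exact: sG.2.
rewrite E1// E2//.
have i1 : P.-integrable A (EFin \o Z1) by exact: (integrableS measurableT).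
have i2 : P.-integrable A (EFin \o Z2) by exact: (integrableS measurableT).
rewrite -sube_ge0; last by rewrite integrable_fin_num.
rewrite -integralB//.
have mD : measurable_fun A (fun w => (Z2 w)%:E - (Z1 w)%:E)%E.
  by apply: emeasurable_funB; [case/integrableP: i2|case/integrableP: i1].
rewrite (ae_eq_integral (fun w => maxe 0 ((Z2 w)%:E - (Z1 w)%:E))%E)//.
- by apply: integral_ge0 => w _; rewrite le_max lexx.
- exact: measurable_maxe.
- apply: aeW Z12 => w Zw _; rewrite max_r// -EFinB lee_fin subr_ge0//.
Qed.

Lemma is_cond_exp_cst (c : R) : is_cond_exp P G (cst c) (cst c).
Proof.
have ic : P.-integrable setT (EFin \o cst c).
  exact: finite_measure_integrable_cst.
by split => //; exact: measurable_cst.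
Qed.

Lemma is_cond_exp_add Z1 Y1 Z2 Y2 : is_cond_exp P G Z1 Y1 ->
  is_cond_exp P G Z2 Y2 ->
  is_cond_exp P G (fun w => Z1 w + Z2 w) (fun w => Y1 w + Y2 w).
Proof.
move=> [iZ1 mY1 iY1 E1] [iZ2 mY2 iY2 E2]; split.
- by rewrite (_ : _ \o _ = (EFin \o Z1) \+ (EFin \o Z2))%E//; exact: integrableD.
- exact: measurable_funD.
- by rewrite (_ : _ \o _ = (EFin \o Y1) \+ (EFin \o Y2))%E//; exact: integrableD.
- move=> A GA; have mA : measurable A by exact: sG.2.
  under eq_integral do rewrite EFinD.
  under [RHS]eq_integral do rewrite EFinD.
  by rewrite !integralD ?E1 ?E2//; exact: (integrableS measurableT).
Qed.

Lemma is_cond_exp_scale (c : R) Z Y : is_cond_exp P G Z Y ->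
  is_cond_exp P G (fun w => c * Z w) (fun w => c * Y w).
Proof.
move=> [iZ mY iY E]; split.
- by rewrite (_ : _ \o _ = fun w => c%:E * (Z w)%:E)%E//; exact: integrableZl.
- by apply: measurable_funM => //; exact: measurable_cst.
- by rewrite (_ : _ \o _ = fun w => c%:E * (Y w)%:E)%E//; exact: integrableZl.
- move=> A GA; have mA : measurable A by exact: sG.2.
  under eq_integral do rewrite EFinM.
  under [RHS]eq_integral do rewrite EFinM.
  by rewrite !integralZl ?E//; exact: (integrableS measurableT).
Qed.

Lemma is_cond_exp_sum (J : Type) (r : seq J) (Z Y : J -> T -> R) :
  (forall j, is_cond_exp P G (Z j) (Y j)) ->
  is_cond_exp P G (fun w => \sum_(j <- r) Z j w) (fun w => \sum_(j <- r) Y j w).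
Proof.
move=> ZY; elim: r => [|j r IH].
  have := is_cond_exp_cst 0; congr is_cond_exp.
    by apply/funext => w; rewrite big_nil.
  by apply/funext => w; rewrite big_nil.
have := is_cond_exp_add (ZY j) IH; congr is_cond_exp.
  by apply/funext => w; rewrite big_cons.
by apply/funext => w; rewrite big_cons.
Qed.

Lemma is_cond_exp_of_test (Z Y : T -> R) (a b : R) :
  measurable_fun setT Z -> 0 <= a -> (forall w, a <= Z w <= b) ->
  measurable_wrt G Y -> (forall w, a <= Y w <= b) ->
  (forall f : T -> R, measurable_wrt G f -> (forall w, 0 <= f w) ->
     (\int[P]_w (f w * Y w)%:E = \int[P]_w (f w * Z w)%:E)%E) ->
  is_cond_exp P G Z Y.
Proof.
move=> mZ a0 Zab mY Yab test.
have bd (U : T -> R) : (forall w, a <= U w <= b) -> forall w, `|U w| <= b.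
  move=> Uab w; have /andP[aU Ub] := Uab w.
  by rewrite ger0_norm// (le_trans a0).
split => //.
- by apply: bounded_integrable mZ _; exact: bd.
- apply: bounded_integrable (bd _ Yab).
  exact: (measurable_wrtW sG mY).
- move=> A GA; have mA : measurable A by exact: sG.2.
  rewrite integral_mkcond [RHS]integral_mkcond !epatch_indic.
  have t : (\int[P]_w (\1_A w * Y w)%:E = \int[P]_w (\1_A w * Z w)%:E)%E.
    apply: test => //; apply: (@measurable_indic _ (g_sigma_algebraType G)).
    by rewrite (sub_sigma_measurable sG).
  transitivity (\int[P]_w (\1_A w * Y w)%:E)%E.
    by apply: eq_integral => w _; rewrite EFinM muleC.
  by rewrite t; apply: eq_integral => w _; rewrite EFinM muleC.
Qed.

End ConditionalExpectationCalculus.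

(** * Conditional estimates for one increment *)

Section OneStep.
Context (R : realType) (H : completeNormedModType R) (dot : {dot H for idfun}).
Hypothesis hdot : induces_norm dot.
Context (d : measure_display) (T : measurableType d) (P : probability T R)
  (G : set (set T)) (X : T -> H) (C : T -> H -> H) (e : nat -> H).
Hypotheses (sG : sub_sigma_algebra_of G)
  (X0 : is_bochner_cond_exp P G X (fun=> 0))
  (X1 : {ae P, forall w, `|X w| <= 1})
  (XC : is_cond_cov dot P G X C)
  (oe : orthonormal_seq dot e).

(* The truncation is inactive when [`|x| <= 1]. *)
Definition clipped_exp (h x : H) : R :=
  expR (Num.max (- `|h|) (Num.min `|h| (dot h x))).

Lemma clipped_expE h x : `|x| <= 1 -> clipped_exp h x = expR (dot h x).
Proof.
move=> x1; have : `|dot h x| <= `|h|.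
  by rewrite (le_trans (cauchy_schwarz hdot _ _))// ler_piMr.
by rewrite ler_norml => /andP[a b]; rewrite /clipped_exp min_r// max_r.
Qed.

Lemma clipped_exp_bound h x : expR (- `|h|) <= clipped_exp h x <= expR `|h|.
Proof.
rewrite !ler_expR le_max lexx/= ge_max ge_min lexx/= andbT.
by rewrite (@le_trans _ _ 0)// oppr_le0.
Qed.

Lemma measurable_clipped_exp (F : set (set T)) (Y : T -> H) h : borel_wrt F Y ->
  measurable_wrt F (fun w => clipped_exp h (Y w)).
Proof.
move=> mY; have mh : measurable_wrt F (fun w => dot h (Y w)).
  exact: (@borel_wrt_continuous _ _ _ _ _ _ _ (@continuous_dot _ _ _ hdot h) mY).
apply: (@measurableT_comp _ _ _ (g_sigma_algebraType F) _ _ expR).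
  exact: measurable_expR.
by apply: measurable_maxr => //; apply: measurable_minr.
Qed.

Let mX : borel_wrt measurable X. Proof. by case: X0 => -[]. Qed.

Let mclip h : measurable_fun setT (fun w => clipped_exp h (X w)).
Proof.
apply: (measurable_wrtW (G := measurable)).
  by split => //; exact: sigma_algebra_measurable.
exact: measurable_clipped_exp.
Qed.

Lemma cond_mgf_exists h : exists D : T -> R,
  [/\ measurable_wrt G D, forall w, expR (- `|h|) <= D w <= expR `|h|
    & forall f : T -> R, measurable_wrt G f -> (forall w, 0 <= f w) ->
     (\int[P]_w (f w * D w)%:E = \int[P]_w (f w * clipped_exp h (X w))%:E)%E].
Proof.
apply: (cond_exp_exists P sG (mclip h)); first exact: expR_ge0.
by move=> w; exact: clipped_exp_bound.
Qed.

Lemma cond_exp_dot0 h : is_cond_exp P G (fun w => dot h (X w)) (cst 0).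
Proof.
have bX : bochner_integrable P X by case: X0.
have [_ m0 i0 _] := is_cond_exp_cst P G 0.
split => //; first exact: (dot_bochner_integrable hdot h bX).
move=> A GA; rewrite (bochner_cond_exp0_dot hdot h sG X0 GA).
by rewrite integral0.
Qed.

Lemma cond_cov_sum (n : nat) :
  is_cond_exp P G (fun w => \sum_(i < n) dot (e i) (X w) ^+ 2)
    (fun w => \sum_(i < n) dot (e i) (C w (e i))).
Proof.
apply: (@is_cond_exp_sum _ _ _ P G sG _ _
  (fun (i : 'I_n) w => dot (e i) (X w) ^+ 2)
  (fun (i : 'I_n) w => dot (e i) (C w (e i)))) => i.
have := XC.2 (e i) (e i); congr is_cond_exp.
by apply/funext => w; rewrite expr2 (dotC _ (X w)).
Qed.

Lemma cond_cov_sqr h : is_cond_exp P G (fun w => dot h (X w) ^+ 2)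
  (fun w => dot h (C w h)).
Proof.
have := XC.2 h h; congr is_cond_exp.
by apply/funext => w; rewrite expr2 (dotC _ (X w)).
Qed.

Lemma cond_cov_ge0 h : {ae P, forall w, 0 <= dot h (C w h)}.
Proof.
apply: (is_cond_exp_le sG (is_cond_exp_cst P G 0) (cond_cov_sqr h)).
by apply: aeW X1 => w _; exact: sqr_ge0.
Qed.

(** Bessel's inequality bounds the partial traces uniformly, which later makes the trace series of
    [V n] converge. *)
Lemma cond_cov_sum_le1 n :
  {ae P, forall w, \sum_(i < n) dot (e i) (C w (e i)) <= 1}.
Proof.
apply: (is_cond_exp_le sG (cond_cov_sum n) (is_cond_exp_cst P G 1)).
apply: aeW X1 => w x1; apply: (le_trans (bessel hdot _ _ oe)).
by rewrite expr_le1.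
Qed.

(** Cauchy-Schwarz within the span, since [<P v, X> = <P v, P X>]. This supplies the trace in the
    minimum of operator norm and trace used for the quadratic form. *)
Lemma cond_cov_proj_le n v : {ae P, forall w,
  dot (partial_proj dot e n v) (C w (partial_proj dot e n v))
  <= `|v| ^+ 2 * \sum_(i < n) dot (e i) (C w (e i))}.
Proof.
apply: (is_cond_exp_le sG (cond_cov_sqr _)
  (is_cond_exp_scale sG _ (cond_cov_sum n))).
apply: aeW X1 => w _.
have -> : dot (partial_proj dot e n v) (X w) =
    dot (partial_proj dot e n v) (partial_proj dot e n (X w)).
  rewrite !dot_partial_projl; apply: eq_bigr => i _.
  by rewrite (dot_partial_proj hdot).
rewrite -(partial_proj_sqr hdot)// -hdot -exprMn -[leLHS]real_normK ?num_real//.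
rewrite ler_pXn2r ?nnegrE ?mulr_ge0//.
apply: (le_trans (cauchy_schwarz hdot _ _)); rewrite ler_wpM2r//.
exact: norm_partial_proj_le.
Qed.

(** The pointwise inequality on the [q]-average passes to conditional expectations: the linear term
    vanishes because [X] is centered, and the squares become values of the quadratic form of [C]. *)
Lemma cond_mgf_mixture_le (J : finType) (q : J -> R) (h : J -> H)
    (D : J -> T -> R) (v : H) (c1 c2 : R) (n : nat) :
  (forall j, [/\ measurable_wrt G (D j),
     forall w, expR (- `|h j|) <= D j w <= expR `|h j|
    & forall f : T -> R, measurable_wrt G f -> (forall w, 0 <= f w) ->
     (\int[P]_w (f w * D j w)%:E =
      \int[P]_w (f w * clipped_exp (h j) (X w))%:E)%E]) ->
  (forall x, `|x| <= 1 -> \sum_j q j * expR (dot (h j) x) <=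
    1 + dot v x + c1 * dot v x ^+ 2 + c2 * \sum_(i < n) dot (e i) x ^+ 2) ->
  {ae P, forall w, \sum_j q j * D j w <=
    1 + c1 * dot v (C w v) + c2 * \sum_(i < n) dot (e i) (C w (e i))}.
Proof.
move=> hD hq.
have DZ j : is_cond_exp P G (fun w => clipped_exp (h j) (X w)) (D j).
  have [mD bD tD] := hD j.
  apply: (is_cond_exp_of_test sG (mclip (h j)) _ _ mD bD tD).
    exact: expR_ge0.
  by move=> w; exact: clipped_exp_bound.
have lhs : is_cond_exp P G (fun w => \sum_j q j * clipped_exp (h j) (X w))
    (fun w => \sum_j q j * D j w).
  apply: (@is_cond_exp_sum _ _ _ P G sG _ _
    (fun j w => q j * clipped_exp (h j) (X w)) (fun j w => q j * D j w)) => j.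
  exact: is_cond_exp_scale.
have rhs := is_cond_exp_add sG (is_cond_exp_add sG (is_cond_exp_add sG
  (is_cond_exp_cst P G 1) (cond_exp_dot0 v))
  (is_cond_exp_scale sG c1 (cond_cov_sqr v)))
  (is_cond_exp_scale sG c2 (cond_cov_sum n)).
apply: aeW (is_cond_exp_le sG lhs rhs _) => [w|]; first by rewrite /= addr0.
apply: aeW X1 => w x1; rewrite /=.
by under eq_bigr do rewrite clipped_expE//; exact: hq.
Qed.

End OneStep.

(** * The mixture martingale and its maximal inequality *)

Section ExponentialMixture.
Context (R : realType) (H : completeNormedModType R) (dot : {dot H for idfun}).
Hypothesis hdot : induces_norm dot.
Context (d : measure_display) (T : measurableType d) (P : probability T R)
  (F : nat -> set (set T)) (X : nat -> T -> H)
  (J : finType) (p : J -> R) (h : J -> H) (D : nat -> J -> T -> R).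
Hypotheses (fF : filtration F)
  (mX : forall k j, measurable_wrt (F k.+1)
     (fun w => clipped_exp dot (h j) (X k w)))
  (p0 : forall j, 0 <= p j) (p1 : \sum_j p j <= 1)
  (hD : forall k j, [/\ measurable_wrt (F k) (D k j),
     forall w, expR (- `|h j|) <= D k j w <= expR `|h j|
    & forall f : T -> R, measurable_wrt (F k) f -> (forall w, 0 <= f w) ->
     (\int[P]_w (f w * D k j w)%:E =
      \int[P]_w (f w * clipped_exp dot (h j) (X k w))%:E)%E]).

Definition exp_process (j : J) (n : nat) (w : T) : R :=
  \prod_(k < n) (clipped_exp dot (h j) (X k w) / D k j w).

Definition exp_mixture (n : nat) (w : T) : R := \sum_j p j * exp_process j n w.

Let filtration_le m n : (m <= n)%N -> F m `<=` F n.
Proof.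
move=> /subnKC <-; elim: (n - m)%N => [|k IH]; first by rewrite addn0.
by rewrite addnS; apply: subset_trans IH _; exact: fF.2.
Qed.

Let measurable_wrt_le m n (f : T -> R) : (m <= n)%N ->
  measurable_wrt (F m) f -> measurable_wrt (F n) f.
Proof.
move=> mn /(measurable_wrtP (fF.1 m)) mf.
by apply/(measurable_wrtP (fF.1 n)) => B /mf; exact: filtration_le.
Qed.

Let D_gt0 k j w : 0 < D k j w.
Proof.
have [_ /(_ w)/andP[+ _] _] := hD k j.
by apply: lt_le_trans; exact: expR_gt0.
Qed.

Lemma exp_process_gt0 j n w : 0 < exp_process j n w.
Proof. by apply: prodr_gt0 => k _; rewrite divr_gt0 ?expR_gt0. Qed.

Let measurable_inv_D k j : measurable_wrt (F k) (fun w => (D k j w)^-1).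
Proof.
have [mD _ _] := hD k j.
rewrite (_ : (fun w => _) = (fun w => expR (- ln (D k j w)))).
  apply: (@measurableT_comp _ _ _ (g_sigma_algebraType (F k)) _ _ expR).
    exact: measurable_expR.
  apply: (@measurable_funN _ (g_sigma_algebraType (F k)) _ _ (fun w => ln (D k j w))).
  apply: (@measurableT_comp _ _ _ (g_sigma_algebraType (F k)) _ _ (@ln R)) => //.
by apply/funext => w; rewrite expRN lnK ?posrE.
Qed.

Lemma measurable_exp_process j n : measurable_wrt (F n) (exp_process j n).
Proof.
elim: n => [|n IH].
  rewrite (_ : exp_process j 0 = cst 1); first exact: measurable_cst.
  by apply/funext => w; rewrite /exp_process big_ord0.
rewrite (_ : exp_process j n.+1 = fun w => exp_process j n w *
    (clipped_exp dot (h j) (X n w) * (D n j w)^-1)).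
  apply: measurable_funM; first exact: (measurable_wrt_le (leqnSn n) IH).
  apply: measurable_funM; first exact: mX.
  by apply: measurable_wrt_le (leqnSn n) _; exact: measurable_inv_D.
by apply/funext => w; rewrite /exp_process big_ord_recr.
Qed.

Let integral_exp_processS j n A : F n A ->
  (\int[P]_(w in A) (exp_process j n.+1 w)%:E =
   \int[P]_(w in A) (exp_process j n w)%:E)%E.
Proof.
move=> FA; have [_ _ test] := hD n j.
rewrite integral_mkcond [RHS]integral_mkcond !epatch_indic.
(* With this test function the defining property of [D n j] is the martingale identity: [D n j]
   cancels on one side and completes the next factor on the other. *)
have := test (fun w => \1_A w * exp_process j n w * (D n j w)^-1).
move=> t; transitivity (\int[P]_w (\1_A w * exp_process j n w * (D n j w)^-1 *
    clipped_exp dot (h j) (X n w))%:E)%E.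
  apply: eq_integral => w _; rewrite /= muleC -EFinM /exp_process big_ord_recr/=.
  by congr (_%:E); rewrite -!mulrA; congr (_ * (_ * _)); rewrite mulrC.
rewrite -t.
- apply: eq_integral => w _; rewrite /= muleC -EFinM; congr (_%:E).
  by rewrite divfK ?gt_eqF// mulrC.
- apply: measurable_funM; last exact: measurable_inv_D.
  apply: measurable_funM; last exact: measurable_exp_process.
  apply: (@measurable_indic _ (g_sigma_algebraType (F n))).
  by rewrite (sub_sigma_measurable (fF.1 n)).
- move=> w; apply: mulr_ge0; last by rewrite invr_ge0 ltW.
  by apply: mulr_ge0; [rewrite indicE|exact/ltW/exp_process_gt0].
Qed.

Let exp_mixture_ge0 n w : 0 <= exp_mixture n w.
Proof. by apply: sumr_ge0 => j _; rewrite mulr_ge0// ltW// exp_process_gt0. Qed.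

Lemma measurable_exp_mixture n : measurable_wrt (F n) (exp_mixture n).
Proof.
apply: (@measurable_sum _ (g_sigma_algebraType (F n))) => j.
by apply: measurable_funM; [exact: measurable_cst|exact: measurable_exp_process].
Qed.

Let integral_exp_mixture n A : F n A ->
  (\int[P]_(w in A) (exp_mixture n w)%:E =
   \sum_j (p j)%:E * \int[P]_(w in A) (exp_process j n w)%:E)%E.
Proof.
move=> FA; have mA : measurable A by exact: (fF.1 n).2.
have mW j : measurable_fun A (fun w => (exp_process j n w)%:E).
  apply/measurable_EFinP; apply: measurable_funTS.
  apply: (measurable_wrtW (fF.1 n)); exact: measurable_exp_process.
under eq_integral do rewrite /exp_mixture -sumEFin.
rewrite ge0_integral_sum//.
- apply: eq_bigr => j _; under eq_integral do rewrite EFinM.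
  rewrite ge0_integralZl ?lee_fin// => w _.
  by rewrite lee_fin ltW// exp_process_gt0.
- by move=> j; under eq_fun do rewrite EFinM; exact: emeasurable_funM.
- by move=> j w _; rewrite lee_fin mulr_ge0// ltW// exp_process_gt0.
Qed.

Lemma exp_mixture_ville (c : R) : 0 < c ->
  measurable [set w | exists n, c < exp_mixture n w] /\
  (P [set w | exists n, (c < exp_mixture n w)%R] <= (c^-1)%:E)%E.
Proof.
apply: (ville (F := F)) => //.
- exact: measurable_exp_mixture.
- have -> : (\int[P]_w (exp_mixture 0 w)%:E = (\sum_j p j)%:E * P setT)%E.
    rewrite -integral_cst//; apply: eq_integral => w _; congr (_%:E).
    by apply: eq_bigr => j _; rewrite /exp_process big_ord0 mulr1.
  by rewrite [X in (_ * X)%E]probability_setT mule1 lee_fin.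
- move=> n A FA; rewrite !integral_exp_mixture//; last exact: fF.2.
  by apply: lee_sum => j _; rewrite integral_exp_processS.
Qed.

End ExponentialMixture.

(** * Random directions built from signs *)

Section SignDirections.
Context (R : realType) (H : completeNormedModType R) (dot : {dot H for idfun}).
Hypothesis hdot : induces_norm dot.
Context (e : nat -> H) (oe : orthonormal_seq dot e) (K : nat) (rho : R).
Hypothesis rho1 : 1 <= rho.

Local Notation N := K.+1.
Local Notation I := ('I_N * 'I_N)%type.
Implicit Types (xi : {ffun I -> bool}) (v x : H).

(** Each basis vector carries [N] signs, so this scale gives it total variance [rho^-1]. The
    repetition keeps every bias of order [N ^ (-1/2)], which makes the quartic entropy terms vanish
    in the limit. *)
Definition sign_scale : R := (Num.sqrt (rho * N%:R))^-1.

(* A Rademacher approximation of the Gaussian vector of covariance [rho^-1] on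
   the span of [e 0, ..., e K]. *)
Definition sign_dir xi : H := \sum_l (sgb R (xi l) * sign_scale) *: e l.1.

(** Chosen so that the tilted direction has the projection of [v] as its mean:
    [N * rho * sign_scale ^+ 2 = 1]. *)
Definition sign_bias v (l : I) : R := rho * sign_scale * dot (e l.1) v.

Let rho0 : 0 < rho. Proof. exact: lt_le_trans rho1. Qed.

Let sqr_scale : sign_scale ^+ 2 * (rho * N%:R) = 1.
Proof.
rewrite /sign_scale exprVn sqr_sqrtr ?mulVf//; last by rewrite mulr_ge0// ltW.
by rewrite gt_eqF// mulr_gt0.
Qed.

Lemma sum_pair_fst (f : 'I_N -> R) : \sum_(l : I) f l.1 = N%:R * \sum_i f i.
Proof.
rewrite -(pair_bigA _ (fun i _ => f i))/= mulr_sumr; apply: eq_bigr => i _.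
by rewrite sumr_const card_ord mulr_natl.
Qed.

Lemma dot_sign_dir xi x :
  dot (sign_dir xi) x = sign_sum xi (fun l => sign_scale * dot (e l.1) x).
Proof.
by rewrite dot_suml; apply: eq_bigr => l _; rewrite dotZl mulrA.
Qed.

Lemma sign_bias_mean v x :
  \sum_l sign_bias v l * (sign_scale * dot (e l.1) x) =
  dot (partial_proj dot e N v) x.
Proof.
rewrite dot_partial_projl.
rewrite (sum_pair_fst (fun i => rho * sign_scale * dot (e i) v * (sign_scale * dot (e i) x))).
rewrite mulr_sumr; apply: eq_bigr => i _.
transitivity (sign_scale ^+ 2 * (rho * N%:R) * (dot (e i) v * dot (e i) x)).
  by ring.
by rewrite sqr_scale mul1r.
Qed.

Lemma sign_scale_sqr_sum x :
  \sum_(l : I) (sign_scale * dot (e l.1) x) ^+ 2 / 2 =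
  rho^-1 * (\sum_(i < N) dot (e i) x ^+ 2) / 2.
Proof.
rewrite (sum_pair_fst (fun i => (sign_scale * dot (e i) x) ^+ 2 / 2)).
rewrite -mulr_suml mulrA; congr (_ / 2).
rewrite mulr_sumr mulr_sumr; apply: eq_bigr => i _; rewrite exprMn.
have -> : rho^-1 = N%:R * sign_scale ^+ 2.
  transitivity (sign_scale ^+ 2 * (rho * N%:R) * rho^-1).
    by rewrite sqr_scale mul1r.
  by field; rewrite gt_eqF.
by rewrite mulrA.
Qed.

Let bias_sqr v l : sign_bias v l ^+ 2 * N%:R = rho * dot (e l.1) v ^+ 2.
Proof.
transitivity (sign_scale ^+ 2 * (rho * N%:R) * (rho * dot (e l.1) v ^+ 2)).
  by rewrite /sign_bias; ring.
by rewrite sqr_scale mul1r.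
Qed.

Lemma sign_bias_lt1 v l : rho * `|v| ^+ 2 < N%:R -> -1 < sign_bias v l < 1.
Proof.
move=> vN; rewrite -ltr_norml -(@ltr_pXn2r _ 2)// ?nnegrE// expr1n.
rewrite real_normK ?num_real// -(@ltr_pM2r _ N%:R)// mul1r bias_sqr.
rewrite (le_lt_trans _ vN)// ler_pM2l//.
apply: (le_trans _ (bessel hdot N v oe)).
rewrite (bigD1 l.1)//= lerDl sumr_ge0// => i _; exact: sqr_ge0.
Qed.

(** The squares reassemble into the Gaussian cost [rho * |v| ^+ 2 / 2]; in the quartic terms, the
    [N] copies leave one factor [1 / N]. *)
Lemma sign_bias_entropy v :
  \sum_l (sign_bias v l ^+ 2 / 2 + sign_bias v l ^+ 4 / 3) <=
  rho * (`|v| ^+ 2 / 2) + rho ^+ 2 * `|v| ^+ 4 / 3 / N%:R.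
Proof.
have Np : 0 < N%:R :> R by [].
have b2 l : sign_bias v l ^+ 2 = rho / N%:R * dot (e l.1) v ^+ 2.
  by rewrite mulrAC -bias_sqr mulfK// gt_eqF.
rewrite big_split/=; apply: lerD.
  under eq_bigr do rewrite b2.
  rewrite (sum_pair_fst (fun i => rho / N%:R * dot (e i) v ^+ 2 / 2)).
  rewrite -mulr_suml -mulr_sumr.
  have -> : N%:R * (rho / N%:R * (\sum_(i < N) dot (e i) v ^+ 2) / 2) =
     rho * ((\sum_(i < N) dot (e i) v ^+ 2) / 2) by field; rewrite gt_eqF.
  by rewrite ler_pM2l// ler_pM2r// bessel.
under eq_bigr do rewrite (exprM _ 2 2) b2.
rewrite (sum_pair_fst (fun i => (rho / N%:R * dot (e i) v ^+ 2) ^+ 2 / 3)).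
have le4 i : (i < N)%N -> (dot (e i) v ^+ 2) ^+ 2 <= `|v| ^+ 2 * dot (e i) v ^+ 2.
  move=> iN; rewrite [leLHS]expr2 ler_wpM2r ?sqr_ge0//.
  apply: (le_trans _ (bessel hdot N v oe)).
  by rewrite (bigD1 (Ordinal iN))//= lerDl sumr_ge0// => k _; exact: sqr_ge0.
have -> : \sum_(i < N) (rho / N%:R * dot (e i) v ^+ 2) ^+ 2 / 3 =
    (rho / N%:R) ^+ 2 / 3 * \sum_(i < N) (dot (e i) v ^+ 2) ^+ 2.
  by rewrite mulr_sumr; apply: eq_bigr => i _; rewrite exprMn mulrAC.
have s4 : \sum_(i < N) (dot (e i) v ^+ 2) ^+ 2 <= `|v| ^+ 4.
  apply: (@le_trans _ _ (\sum_(i < N) `|v| ^+ 2 * dot (e i) v ^+ 2)).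
    by apply: ler_sum => i _; exact: le4.
  rewrite -mulr_sumr (exprM _ 2 2) [leRHS]expr2 ler_wpM2l ?sqr_ge0//.
  exact: bessel.
have -> : rho ^+ 2 * `|v| ^+ 4 / 3 / N%:R =
    N%:R * ((rho / N%:R) ^+ 2 / 3 * `|v| ^+ 4) by field; rewrite gt_eqF.
by rewrite ler_pM2l// ler_wpM2l// divr_ge0 ?sqr_ge0.
Qed.

(** Hoeffding's lemma bounds the sign average by the Gaussian one; [expR_quadratic_bound] then
    applies with [s = rho^-1] and [h] the norm of the projection of [x]. *)
Lemma sign_dir_mgf v x : 0 < `|v| < 3 -> rho * `|v| ^+ 2 < N%:R -> `|x| <= 1 ->
  \sum_(xi : {ffun I -> bool})
     sign_weight (sign_bias v) xi * expR (dot (sign_dir xi) x) <=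
  1 + dot (partial_proj dot e N v) x
  + (peak `|v| + 13 / 20 * rho^-1 * (peak `|v| + `|v|^-1)) / 2
     * dot (partial_proj dot e N v) x ^+ 2
  + (1 + 3 / 10 * rho^-1) * (1 + `|v| / 2) * (rho^-1 / 2)
     * \sum_(i < N) dot (e i) x ^+ 2.
Proof.
move=> v3 vN x1.
under eq_bigr do rewrite dot_sign_dir.
apply: (le_trans (sign_sum_mgf _ (fun l => sign_bias_lt1 l vN))).
rewrite big_split/= sign_bias_mean sign_scale_sqr_sum.
have S0 : 0 <= \sum_(i < N) dot (e i) x ^+ 2.
  by apply: sumr_ge0 => i _; exact: sqr_ge0.
pose h := Num.sqrt (\sum_(i < N) dot (e i) x ^+ 2).
have hE : h ^+ 2 = \sum_(i < N) dot (e i) x ^+ 2 by rewrite sqr_sqrtr.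
have h01 : 0 <= h <= 1.
  rewrite sqrtr_ge0/= -(@ler_pXn2r _ 2)// ?nnegrE ?sqrtr_ge0// expr1n hE.
  by rewrite (le_trans (bessel hdot _ _ oe))// expr_le1.
have pv : `|dot (partial_proj dot e N v) x| <= `|v|.
  rewrite (le_trans (cauchy_schwarz hdot _ _))// (le_trans (ler_wpM2l _ x1))//.
  by rewrite mulr1 norm_partial_proj_le.
have s01 : 0 <= rho^-1 <= 1 by rewrite invr_ge0 ltW//= invf_le1.
have := expR_quadratic_bound v3 s01 pv h01; rewrite hE => /le_trans; apply.
rewrite le_eqVlt; apply/orP; left; apply/eqP; congr (_ + _ + _ + _); ring.
Qed.

(* One step of the variational argument on a fixed trajectory: [X] are the
   increments and [D k xi] stands for the conditional Laplace transform of the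
   [k]-th increment at [sign_dir xi]. *)
Lemma sign_mixture_ge (n : nat) (X : nat -> H)
    (D : nat -> {ffun I -> bool} -> R) (a : nat -> R) v :
  rho * `|v| ^+ 2 < N%:R -> (forall k, `|X k| <= 1) ->
  (forall k xi, 0 < D k xi) ->
  (forall k, \sum_xi sign_weight (sign_bias v) xi * D k xi <= 1 + a k) ->
  dot (partial_proj dot e N v) (\sum_(k < n) X k) - \sum_(k < n) a k
  - (rho * (`|v| ^+ 2 / 2) + rho ^+ 2 * `|v| ^+ 4 / 3 / N%:R)
  <= ln (\sum_(xi : {ffun I -> bool}) 2^-1 ^+ #|{: I}| *
     \prod_(k < n) (clipped_exp dot (sign_dir xi) (X k) / D k xi)).
Proof.
move=> vN X1 D0 Da.
have mu1 l := sign_bias_lt1 l vN.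
set W := fun xi => \prod_(k < n) (clipped_exp dot (sign_dir xi) (X k) / D k xi).
have W0 xi : 0 < W xi by apply: prodr_gt0 => k _; rewrite divr_gt0// expR_gt0.
apply: (le_trans _ (sign_variational mu1 W0)).
apply: lerB; last exact: sign_bias_entropy.
have lnW xi : ln (W xi) = dot (sign_dir xi) (\sum_(k < n) X k) -
    \sum_(k < n) ln (D k xi).
  apply: expR_inj; rewrite lnK ?posrE// dot_sumr -sumrB expR_sum.
  apply: eq_bigr => k _; rewrite expRB lnK ?posrE//.
  by rewrite (clipped_expE hdot).
rewrite [leRHS](eq_bigr (fun xi =>
  sign_weight (sign_bias v) xi * dot (sign_dir xi) (\sum_(k < n) X k) -
  sign_weight (sign_bias v) xi * \sum_(k < n) ln (D k xi))); last first.
  by move=> xi _; rewrite -mulrBr -lnW.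
rewrite sumrB; apply: lerB.
  rewrite -sign_bias_mean -sign_sum_mean le_eqVlt; apply/orP; left; apply/eqP.
  by apply: eq_bigr => xi _; rewrite dot_sign_dir.
under eq_bigr do rewrite mulr_sumr.
rewrite exchange_big/=; apply: ler_sum => k _.
(* By [ln D <= D - 1], only the posterior average of [D] remains. *)
apply: (@le_trans _ _ (\sum_xi sign_weight (sign_bias v) xi * (D k xi - 1))).
  apply: ler_sum => xi _; apply: ler_wpM2l; first exact/ltW/sign_weight_gt0.
  rewrite -ler_expR lnK ?posrE//; apply: (le_trans _ (expR_ge1Dx _)).
  by rewrite addrC subrK.
under eq_bigr do rewrite mulrBr mulr1.
by rewrite sumrB sign_weight_sum lerBlDl.
Qed.

End SignDirections.

(** * Passage to the limit over the levels *)

Section Limits.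
Context (R : realType).

Lemma frequently_le_limit (f g : nat -> R) (a b : R) :
  f n @[n --> \oo] --> a -> g n @[n --> \oo] --> b ->
  (forall k, exists2 n, (k <= n)%N & f n <= g n) -> a <= b.
Proof.
move=> fa gb fg; rewrite leNgt; apply/negP => ba.
have eps0 : 0 < (a - b) / 2 by rewrite divr_gt0// subr_gt0.
have /cvgrPdist_lt/(_ _ eps0)[k1 _ Hk1] := fa.
have /cvgrPdist_lt/(_ _ eps0)[k2 _ Hk2] := gb.
have [n nk fgn] := fg (maxn k1 k2).
have /= := Hk1 n (leq_trans (leq_maxl _ _) nk); rewrite ltr_norml => /andP[_ h1].
have /= := Hk2 n (leq_trans (leq_maxr _ _) nk); rewrite ltr_norml => /andP[h2 _].
lra.
Qed.

(** Fatou's lemma for sets: the inner intersections increase with [k], and each is contained in some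
    [B n]. *)
Lemma liminf_measure_le (d : measure_display) (T : measurableType d)
    (P : probability T R) (B : nat -> set T) (c : R) :
  (forall n, measurable (B n)) -> (forall n, (P (B n) <= c%:E)%E) ->
  let L := \bigcup_k \bigcap_(n in [set n | (k <= n)%N]) B n in
  measurable L /\ (P L <= c%:E)%E.
Proof.
move=> mB PB L.
pose A k := \bigcap_(n in [set n | (k <= n)%N]) B n.
have mA k : measurable (A k) by apply: bigcap_measurable => //; exists k => /=.
have mL : measurable (\bigcup_k A k) by exact: bigcup_measurable.
split => //.
have nd : nondecreasing_seq A.
  move=> m n mn; apply/subsetPset => w Am k /= nk; apply: Am.
  exact: leq_trans nk.
have cv := @nondecreasing_cvg_mu _ _ _ P _ mA mL nd.
rewrite -(cvg_lim _ cv)//; apply: lime_le; first by apply/cvg_ex; eexists; exact: cv.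
near=> n => /=; apply: (le_trans _ (PB n)).
by apply: le_measure; rewrite ?inE// => w; apply => /=.
Unshelve. all: by end_near. Qed.

End Limits.

(** * Discretization of the mixing measure *)

Section Grid.
Context (R : realType) (N : nat).

Definition grid (j : nat) : R := 1 + j%:R / N.+1%:R.

(* The prior on [grid] discretizes [varpi] conditioned on [1, +oo[, which has
   mass [1 / 2]; each cell is represented by its right end, [grid j.+1]. *)
Definition grid_weight (j : nat) : R :=
  2 * (varpi_tail (grid j) - varpi_tail (grid j.+1)).

Lemma grid_ge1 j : 1 <= grid j.
Proof. by rewrite lerDl divr_ge0. Qed.

Lemma grid_lt j : grid j < grid j.+1.
Proof. by rewrite ltrD2l ltr_pM2r// ltr_nat. Qed.

Lemma grid_weight_gt0 j : 0 < grid_weight j.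
Proof.
by rewrite mulr_gt0// subr_gt0 varpi_tail_lt ?grid_ge1// grid_lt.
Qed.

Lemma sum_grid_weight (m n : nat) : (m <= n)%N ->
  \sum_(m <= j < n) grid_weight j =
  2 * (varpi_tail (grid m) - varpi_tail (grid n)).
Proof.
move=> mn; rewrite -mulr_sumr; congr (2 * _).
have := telescope_sumr (fun j => - varpi_tail (grid j)) mn.
by under eq_bigr do rewrite opprK addrC; rewrite opprK addrC.
Qed.

Lemma sum_grid_weight_le1 n : \sum_(j < n) grid_weight j <= 1.
Proof.
rewrite -(big_mkord xpredT grid_weight) sum_grid_weight//.
rewrite /grid mul0r addr0 varpi_tail1.
have := varpi_tail_gt0 (grid_ge1 n); rewrite /grid; lra.
Qed.

Lemma varpi_tail_anti (a b : R) : 1 <= a -> a <= b -> varpi_tail b <= varpi_tail a.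
Proof.
by move=> a1; rewrite le_eqVlt => /predU1P[->//|ab]; rewrite ltW// varpi_tail_lt.
Qed.

(** If [Psi] exceeded the bound on every cell meeting [[rho, u * rho]], the weighted sum would
    exceed [c], since these cells have at least the mass of the window. Right ends never fall below
    [rho] and overshoot [u * rho] by at most one mesh. *)
Lemma grid_window (c rho u : R) (Psi : nat -> R) : 0 < c -> 1 <= rho -> 1 < u ->
  u * rho <= N.+1%:R -> (forall j, 0 <= Psi j) ->
  \sum_(j < N.+1 * N.+1) grid_weight j * Psi j <= c ->
  exists j, [/\ (j < N.+1 * N.+1)%N, rho <= grid j.+1,
    grid j.+1 <= u * rho + N.+1%:R^-1 &
    Psi j <= c / (2 * (varpi_tail rho - varpi_tail (u * rho)))].
Proof.
move=> c0 r1 u1 urN Psi0 Sc.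
have N0 : 0 < N.+1%:R :> R by [].
have rho0 : 0 < rho by exact: lt_le_trans r1.
have rur : rho < u * rho by rewrite ltr_pMl.
have ur1 : 1 <= u * rho by rewrite (le_trans r1)// ltW.
pose t (x : R) : nat := Num.truncn ((x - 1) * N.+1%:R).
have tE x : 1 <= x -> grid (t x) <= x < grid (t x).+1.
  move=> x1; have := @Num.Theory.truncn_itv R ((x - 1) * N.+1%:R).
  rewrite mulr_ge0 ?subr_ge0// => /(_ isT)/andP[h1 h2].
  rewrite /grid -lerBrDl ler_pdivrMr// h1/= -ltrBlDl ltr_pdivlMr//.
have /andP[g0 g0'] := tE _ r1.
have /andP[g1 g1'] := tE _ ur1.
set tu := t (u * rho) in g1 g1' *.
have gm i j : (i <= j)%N -> grid i <= grid j.
  by move=> ij; rewrite lerD2l ler_pM2r ?invr_gt0// ler_nat.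
have t01 : (t rho <= tu)%N.
  rewrite leqNgt; apply/negP => /gm; rewrite leNgt => /negP; apply.
  by rewrite (le_lt_trans g0)// (lt_trans rur).
have tJ : (tu < N.+1 * N.+1)%N.
  have h : grid (tu) < grid (N.+1 * N.+1).
    rewrite (le_lt_trans g1)// (le_lt_trans urN)// /grid natrM mulfK ?gt_eqF//.
    by rewrite ltrDr.
  by rewrite ltnNge; apply/negP => /gm; rewrite leNgt h.
apply: contrapT => noj.
pose E := c / (2 * (varpi_tail rho - varpi_tail (u * rho))).
have tail0 : 0 < 2 * (varpi_tail rho - varpi_tail (u * rho)).
  by rewrite mulr_gt0// subr_gt0 varpi_tail_lt.
have E0 : 0 < E by rewrite divr_gt0.
have big j : (t rho <= j < (tu).+1)%N -> E < Psi j.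
  move=> /andP[j0 j1]; rewrite ltNge; apply/negP => EP; apply: noj.
  exists j; split => //.
  - exact: leq_ltn_trans tJ.
  - by apply: (le_trans (ltW g0')); apply: gm.
  - apply: (@le_trans _ _ (grid (tu).+1)); first exact: gm.
    rewrite /grid -natr1 mulrDl addrA mul1r lerD2r//.
have lt1 : \sum_(t rho <= j < (tu).+1) grid_weight j * E <
    \sum_(t rho <= j < (tu).+1) grid_weight j * Psi j.
  apply: ltr_sum_nat => // j jt; first by rewrite ltr_pM2l ?grid_weight_gt0// big.
have le2 : \sum_(t rho <= j < (tu).+1) grid_weight j * Psi j <= c.
  apply: (le_trans _ Sc); rewrite -(big_mkord xpredT (fun j => grid_weight j * Psi j)).
  have pos j : 0 <= grid_weight j * Psi j by rewrite mulr_ge0// ltW// grid_weight_gt0.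
  rewrite (@big_cat_nat _ _ _ (t rho) 0)//=; last exact: leq_trans (ltnW tJ).
  rewrite (@big_cat_nat _ _ _ (tu).+1 (t rho) (N.+1 * N.+1))//=; last first.
    exact: leqW.
  by rewrite addrCA lerDl addr_ge0// sumr_ge0.
have := lt_le_trans lt1 le2; rewrite -mulr_suml sum_grid_weight; last exact: leqW.
apply/negP; rewrite -leNgt /E mulrA ler_pdivlMr// mulrC ler_wpM2r ?(ltW c0)//.
rewrite ler_wpM2l// lerB// varpi_tail_anti ?grid_ge1//.
exact: ltW.
Qed.

End Grid.

(** * The linear bound at a fixed level *)

Section LevelBound.
Context (R : realType) (H : completeNormedModType R) (dot : {dot H for idfun}).
Hypothesis hdot : induces_norm dot.
Context (e : nat -> H) (oe : orthonormal_seq dot e).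

Definition mgf_coef1 (lam s : R) : R :=
  (peak lam + 13 / 20 * s * (peak lam + lam^-1)) / 2.

Definition mgf_coef2 (lam s : R) : R :=
  (1 + 3 / 10 * s) * (1 + lam / 2) * (s / 2).

Lemma peak_ge0 (lam : R) : lam <= 3 -> 0 <= peak lam.
Proof. by move=> l3; rewrite invr_ge0 subr_ge0 ler_pdivrMr// mul1r. Qed.

Lemma mgf_coef1_ge0 lam s : 0 < lam <= 3 -> 0 <= s -> 0 <= mgf_coef1 lam s.
Proof.
move=> /andP[l0 l3] s0; have p0 := peak_ge0 l3.
by rewrite divr_ge0// addr_ge0// mulr_ge0// ?mulr_ge0// addr_ge0// invr_ge0 ltW.
Qed.

Lemma mgf_coef2_ge0 lam s : 0 < lam -> 0 <= s -> 0 <= mgf_coef2 lam s.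
Proof. by move=> l0 s0; rewrite !mulr_ge0 ?addr_ge0 ?mulr_ge0 ?divr_ge0// ltW. Qed.

Lemma mgf_coef1_le lam s t : 0 < lam <= 3 -> s <= t ->
  mgf_coef1 lam s <= mgf_coef1 lam t.
Proof.
move=> /andP[l0 l3] st; have p0 := peak_ge0 l3.
by rewrite ler_pM2r// lerD2l ler_wpM2r ?ler_wpM2l// addr_ge0// invr_ge0 ltW.
Qed.

Lemma mgf_coef2_le lam s t : 0 < lam -> 0 <= s -> s <= t ->
  mgf_coef2 lam s <= mgf_coef2 lam t.
Proof.
move=> l0 s0 st; have h0 : 0 <= 1 + lam / 2 by rewrite addr_ge0// divr_ge0// ltW.
have s2 : 0 <= s / 2 by rewrite divr_ge0.
have s1 : 0 <= 1 + 3 / 10 * s by rewrite addr_ge0// mulr_ge0.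
apply: ler_pM; [exact: mulr_ge0|by []| |by rewrite ler_pM2r].
by apply: ler_wpM2r => //; rewrite lerD2l ler_wpM2l.
Qed.

(** At the grid point [g] selected in the window, the Laplace coefficients decrease with [g] and are
    evaluated at [rho], while the entropy increases and is evaluated near [u * rho]. *)
Lemma level_bound (N n : nat) (X : nat -> H) (C : nat -> H -> H)
    (D : nat -> nat -> {ffun 'I_N.+1 * 'I_N.+1 -> bool} -> R)
    (v : H) (rho u y o tr : R) :
  1 <= rho -> 1 < u -> 0 < `|v| < 3 -> 0 <= o -> 0 <= tr ->
  u * rho + 1 <= N.+1%:R -> (u * rho + 1) * `|v| ^+ 2 < N.+1%:R ->
  (forall k, `|X k| <= 1) -> (forall k j xi, 0 < D k j xi) ->
  (forall k j, grid R N j.+1 * `|v| ^+ 2 < N.+1%:R ->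
    \sum_xi sign_weight (sign_bias dot e (grid R N j.+1) v) xi * D k j xi
    <= 1 + mgf_coef1 `|v| (grid R N j.+1)^-1 *
           dot (partial_proj dot e N.+1 v) (C k (partial_proj dot e N.+1 v))
         + mgf_coef2 `|v| (grid R N j.+1)^-1 *
           \sum_(i < N.+1) dot (e i) (C k (e i))) ->
  \sum_(k < n) dot (partial_proj dot e N.+1 v) (C k (partial_proj dot e N.+1 v))
    <= o * `|v| ^+ 2 ->
  \sum_(k < n) \sum_(i < N.+1) dot (e i) (C k (e i)) <= tr ->
  \sum_(j < N.+1 * N.+1) grid_weight R N j *
    (\sum_xi 2^-1 ^+ #|{: 'I_N.+1 * 'I_N.+1}| * \prod_(k < n)
      (clipped_exp dot (sign_dir e (grid R N j.+1) xi) (X k) / D k j xi))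
    <= expR y ->
  dot (partial_proj dot e N.+1 v) (\sum_(k < n) X k) <=
  mgf_coef1 `|v| rho^-1 * (o * `|v| ^+ 2) + mgf_coef2 `|v| rho^-1 * tr
  + u * rho * (`|v| ^+ 2 / 2)
  + (y - ln (2 * (varpi_tail rho - varpi_tail (u * rho))))
  + (`|v| ^+ 2 / 2 + (u * rho + 1) ^+ 2 * `|v| ^+ 4 / 3) / N.+1%:R.
Proof.
move=> r1 u1 v3 o0 tr0 urN urvN X1 D0 hD Qo Ttr mix.
have /andP[v0 v3'] := v3.
have N0 : 0 < N.+1%:R :> R by [].
have rho0 : 0 < rho by exact: lt_le_trans r1.
set Psi := fun j : nat => \sum_xi 2^-1 ^+ #|{: 'I_N.+1 * 'I_N.+1}| * \prod_(k < n)
      (clipped_exp dot (sign_dir e (grid R N j.+1) xi) (X k) / D k j xi).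
have Psi0 j : 0 < Psi j.
  rewrite /Psi (bigD1 [ffun=> true])//= ltr_pwDl//.
    rewrite mulr_gt0 ?exprn_gt0 ?invr_gt0//.
    by apply: prodr_gt0 => k _; rewrite divr_gt0// expR_gt0.
  apply: sumr_ge0 => xi _; rewrite mulr_ge0 ?exprn_ge0 ?invr_ge0//.
  by apply: prodr_ge0 => k _; rewrite divr_ge0 ?expR_ge0// ltW.
have [||j [_ gr gu Pj]] := @grid_window R N (expR y) rho u Psi (expR_gt0 _) r1 u1 _ _ mix.
  by rewrite (le_trans _ urN)// lerDl.
  by move=> j; exact/ltW/Psi0.
set g := grid R N j.+1 in gr gu *.
have g1 : 1 <= g by exact: grid_ge1.
have g0 : 0 < g by exact: lt_le_trans g1.
have Ni1 : N.+1%:R^-1 <= 1 :> R by rewrite invf_le1// ler1n.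
have gu1 : g <= u * rho + 1 by rewrite (le_trans gu)// lerD2l.
have gvN : g * `|v| ^+ 2 < N.+1%:R.
  by rewrite (le_lt_trans _ urvN)// ler_wpM2r// sqr_ge0.
have tail0 : 0 < 2 * (varpi_tail rho - varpi_tail (u * rho)).
  by rewrite mulr_gt0// subr_gt0 varpi_tail_lt// ltr_pMl.
pose a k := mgf_coef1 `|v| g^-1 *
           dot (partial_proj dot e N.+1 v) (C k (partial_proj dot e N.+1 v))
         + mgf_coef2 `|v| g^-1 * \sum_(i < N.+1) dot (e i) (C k (e i)).
have ha k : \sum_xi sign_weight (sign_bias dot e g v) xi * D k j xi <= 1 + a k.
  by rewrite addrA; exact: hD.
have key := sign_mixture_ge hdot oe g1 n gvN X1 (fun k xi => D0 k j xi) ha.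
have v3w : 0 < `|v| <= 3 by rewrite v0 ltW.
have gi0 : 0 <= g^-1 by rewrite invr_ge0 ltW.
have gir : g^-1 <= rho^-1 by rewrite lef_pV2 ?posrE.
have sa : \sum_(k < n) a k <=
    mgf_coef1 `|v| rho^-1 * (o * `|v| ^+ 2) + mgf_coef2 `|v| rho^-1 * tr.
  rewrite /a big_split/= -!mulr_sumr; apply: lerD.
    apply: (le_trans (ler_wpM2l (mgf_coef1_ge0 v3w gi0) Qo)).
    by rewrite ler_wpM2r ?mgf_coef1_le// mulr_ge0// sqr_ge0.
  apply: (le_trans (ler_wpM2l (mgf_coef2_ge0 v0 gi0) Ttr)).
  by rewrite ler_wpM2r ?mgf_coef2_le.
have lnP : ln (Psi j) <= y - ln (2 * (varpi_tail rho - varpi_tail (u * rho))).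
  rewrite -[y]expRK -ln_div ?posrE ?expR_gt0// ler_ln ?posrE ?divr_gt0 ?expR_gt0//.
have gv2 : g * (`|v| ^+ 2 / 2) <= u * rho * (`|v| ^+ 2 / 2) + `|v| ^+ 2 / 2 / N.+1%:R.
  by rewrite mulrC [X in _ <= X + _]mulrC -mulrDr ler_wpM2l// divr_ge0// sqr_ge0.
have gv4 : g ^+ 2 * `|v| ^+ 4 / 3 / N.+1%:R <=
    (u * rho + 1) ^+ 2 * `|v| ^+ 4 / 3 / N.+1%:R.
  rewrite ler_pM2r ?invr_gt0// ler_pM2r ?invr_gt0// ler_pM2r ?exprn_gt0//.
  by rewrite ler_pXn2r ?nnegrE// ltW// (lt_le_trans g0).
have {}key : dot (partial_proj dot e N.+1 v) (\sum_(k < n) X k) <=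
    \sum_(k < n) a k + (g * (`|v| ^+ 2 / 2) + g ^+ 2 * `|v| ^+ 4 / 3 / N.+1%:R)
    + ln (Psi j).
  by rewrite -lerBlDl opprD addrA; exact: key.
apply: (le_trans key).
apply: (le_trans (lerD (lerD sa (lerD gv2 gv4)) lnP)).
rewrite le_eqVlt; apply/orP; left; apply/eqP.
by move: (N.+1%:R^-1) => z; ring.
Qed.

End LevelBound.

(** * The linear bound along one trajectory *)

Section PathBound.
Context (R : realType) (H : completeNormedModType R) (dot : {dot H for idfun}).
Hypothesis hdot : induces_norm dot.
Context (e : nat -> H) (oe : orthonormal_seq dot e).
Hypothesis e_cvg : forall x, partial_proj dot e N x @[N --> \oo] --> x.
Context (n : nat) (X : nat -> H) (C : nat -> H -> H)
  (D : forall N : nat, nat -> nat -> {ffun 'I_N.+1 * 'I_N.+1 -> bool} -> R)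
  (y o tr : R).
Hypotheses (o0 : 0 <= o) (tr0 : 0 <= tr) (X1 : forall k, `|X k| <= 1)
  (D0 : forall N k j xi, 0 < @D N k j xi)
  (Ttr : forall N, \sum_(k < n) \sum_(i < N) dot (e i) (C k (e i)) <= tr)
  (mix : forall K, exists2 N, (K <= N)%N &
    \sum_(j < N.+1 * N.+1) grid_weight R N j *
    (\sum_xi 2^-1 ^+ #|{: 'I_N.+1 * 'I_N.+1}| * \prod_(k < n)
      (clipped_exp dot (sign_dir e (grid R N j.+1) xi) (X k) / @D N k j xi))
    <= expR y).

Lemma path_linear_bound (v : H) (rho u : R) :
  1 <= rho -> 1 < u -> 0 < `|v| < 3 ->
  (forall N k j, grid R N j.+1 * `|v| ^+ 2 < N.+1%:R ->
    \sum_xi sign_weight (sign_bias dot e (grid R N j.+1) v) xi * @D N k j xi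
    <= 1 + mgf_coef1 `|v| (grid R N j.+1)^-1 *
           dot (partial_proj dot e N.+1 v) (C k (partial_proj dot e N.+1 v))
         + mgf_coef2 `|v| (grid R N j.+1)^-1 *
           \sum_(i < N.+1) dot (e i) (C k (e i))) ->
  (forall N, \sum_(k < n) dot (partial_proj dot e N v) (C k (partial_proj dot e N v))
    <= o * `|v| ^+ 2) ->
  dot v (\sum_(k < n) X k) <=
  mgf_coef1 `|v| rho^-1 * (o * `|v| ^+ 2) + mgf_coef2 `|v| rho^-1 * tr
  + u * rho * (`|v| ^+ 2 / 2)
  + (y - ln (2 * (varpi_tail rho - varpi_tail (u * rho)))).
Proof.
move=> r1 u1 v3 hD Qo.
set A := (leRHS).
pose E := `|v| ^+ 2 / 2 + (u * rho + 1) ^+ 2 * `|v| ^+ 4 / 3.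
apply: (@frequently_le_limit R
  (fun N => dot (partial_proj dot e N.+1 v) (\sum_(k < n) X k))
  (fun N => A + E / N.+1%:R)).
- rewrite (dotC _ v); under eq_fun do rewrite (dotC _ (partial_proj _ _ _ _)).
  apply: (@continuous_cvg _ _ _ _ _ _ (dot (\sum_(k < n) X k))).
    exact: continuous_dot.
  by have := @e_cvg v; rewrite -(cvg_shiftS (fun N => partial_proj dot e N v)).
- rewrite -[X in _ --> X]addr0; apply: cvgD; first exact: cvg_cst.
  rewrite -(mulr0 E); apply: cvgM; first exact: cvg_cst.
  exact: cvg_harmonic.
- move=> K.
  (* From level [m] on, the grid covers the window and all sign biases stay within []-1, 1[]. *)
  pose m := (Num.truncn (u * rho + 1) + Num.truncn ((u * rho + 1) * `|v| ^+ 2)).+1.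
  have [N KN mN] := mix (maxn K m).
  have mN' : (m <= N.+1)%N by rewrite (leq_trans (leq_maxr K m))// (leq_trans KN).
  exists N; first exact: leq_trans (leq_maxl _ _) KN.
  have ur0 : 0 <= u * rho + 1.
    by rewrite addr_ge0// mulr_ge0// ltW// (lt_le_trans ltr01)// ltW.
  have trN (x : R) : 0 <= x -> (Num.truncn x < m)%N -> x < N.+1%:R.
    move=> x0 xm; have /andP[_ h] := Num.Theory.truncn_itv x0.
    by rewrite (lt_le_trans h)// ler_nat (leq_trans xm).
  apply: (level_bound hdot oe r1 u1 v3 o0 tr0 _ _ X1 (D := @D N)) => //.
  + by apply/ltW/trN => //; rewrite ltnS leq_addr.
  + by apply: trN; rewrite ?mulr_ge0 ?sqr_ge0// ltnS leq_addl.
  + by move=> k j; exact: hD.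
Qed.

End PathBound.

(** * From linear bounds to the norm *)

Section Deviation.
Context (R : realType).

(** [expR_bernstein] at [69 / 100] gives an upper bound of [expR (69 / 100)] just below [2]. *)
Lemma ln2_ge : 69 / 100 <= ln (2 : R).
Proof.
rewrite -ler_expR lnK ?posrE//.
have := expR_bernstein (69 / 100 : R); lra.
Qed.

(** The factor [2] of the conditioned prior yields the gain [69 / 100]; by [varpi_tail_diff_anti],
    the window at [rho] has at least the mass of the window at [Num.max 1 tr]. *)
Lemma Lterm_ge (y tr u rho : R) : 1 < u -> 1 <= rho -> rho <= Num.max 1 tr ->
  y - ln (2 * (varpi_tail rho - varpi_tail (u * rho))) <=
  Lterm y tr u - 69 / 100.
Proof.
move=> u1 r1 rt; rewrite /Lterm lerBrDr le_max; apply/orP; right.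
rewrite -addrA lerD2l /Delta_varpi.
have a1 : 1 <= Num.max 1 tr by rewrite le_max lexx.
rewrite varpi_itv//=; last by rewrite ltr_pMl// (lt_le_trans ltr01).
have t0 (a : R) : 1 <= a -> 0 < varpi_tail a - varpi_tail (u * a).
  by move=> a0; rewrite subr_gt0 varpi_tail_lt// ltr_pMl// (lt_le_trans ltr01).
rewrite lnM ?posrE ?t0// opprD.
have : ln (varpi_tail (Num.max 1 tr) - varpi_tail (u * Num.max 1 tr)) <=
    ln (varpi_tail rho - varpi_tail (u * rho)).
  by rewrite ler_ln ?posrE ?t0//; exact: varpi_tail_diff_anti.
have := ln2_ge; lra.
Qed.

Lemma peak_le (l m : R) : l <= m -> m < 3 -> peak l <= peak m.
Proof.
move=> lm m3; have h (x : R) : x < 3 -> 0 < 1 - x / 3.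
  by move=> x3; rewrite subr_gt0 ltr_pdivrMr// mul1r.
by rewrite lef_pV2 ?posrE ?h// ?(le_lt_trans lm)// lerD2l lerN2 ler_pM2r.
Qed.

Context (H : completeNormedModType R) (dot : {dot H for idfun}).
Hypothesis hdot : induces_norm dot.

(** The optimal direction [lam * S / |S|] need not belong to the sequence. If the claim failed, some
    length [t] strictly between [B / |S|] and [lam] would leave room for an approximation in the
    open ball. *)
Lemma norm_le_of_dense (z : nat -> H) (S : H) (lam B : R) :
  (forall x (eps : R), 0 < eps -> exists m, `|x - z m| < eps) ->
  0 < lam -> 0 <= B ->
  (forall m, 0 < `|z m| < lam -> dot (z m) S <= B) ->
  lam * `|S| <= B.
Proof.
move=> dz lam0 B0 zB.
have [->|S0] := eqVneq S 0; first by rewrite normr0 mulr0.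
have nS : 0 < `|S| by rewrite normr_gt0.
rewrite leNgt; apply/negP => Bl.
have Bl' : B / `|S| < lam by rewrite ltr_pdivrMr.
pose t := (B / `|S| + lam) / 2.
have BS0 : 0 <= B / `|S| by exact: divr_ge0.
have t0 : 0 < t by rewrite /t; lra.
have tl : t < lam by rewrite /t; lra.
have Bt : B / `|S| < t by rewrite /t; lra.
(* The three margins ensure in turn [z m != 0], [|z m| < lam] and [dot (z m) S > B]. *)
pose eps := Num.min t (Num.min (lam - t) (t - B / `|S|)).
have eps0 : 0 < eps by rewrite !lt_min t0 !subr_gt0 tl.
have [m zm] := dz ((t / `|S|) *: S) eps eps0.
have nt : `|(t / `|S|) *: S| = t.
  have tS : 0 <= t / `|S| by rewrite divr_ge0// ltW.
  by rewrite normrZ (ger0_norm tS) divfK ?gt_eqF.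
move: zm; rewrite !lt_min => /and3P[z1 z2 z3].
have zn0 : 0 < `|z m|.
  have := ler_distD (z m) ((t / `|S|) *: S) 0.
  by rewrite !subr0 nt -lerBlDl; apply: lt_le_trans; rewrite subr_gt0.
have znl : `|z m| < lam.
  rewrite (_ : z m = (t / `|S|) *: S - ((t / `|S|) *: S - z m)); last by rewrite opprB addrC subrK.
  by rewrite (le_lt_trans (ler_normB _ _))// nt -ltrBrDl.
have := zB m; rewrite zn0 znl => /(_ isT); apply/negP; rewrite -ltNge.
have -> : z m = (t / `|S|) *: S - ((t / `|S|) *: S - z m) by rewrite opprB addrC subrK.
rewrite (dotBl) (dotZl) -hdot.
have -> : t / `|S| * `|S| ^+ 2 = t * `|S| by rewrite expr2 mulrA divfK// gt_eqF.
have := cauchy_schwarz hdot ((t / `|S|) *: S - z m) S => cs.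
have h : dot ((t / `|S|) *: S - z m) S < (t - B / `|S|) * `|S|.
  rewrite (le_lt_trans (ler_norm _))// (le_lt_trans cs)// ltr_pM2r//.
move: h; rewrite mulrBl divfK ?gt_eqF// ltrBrDr addrC -ltrBrDr; lra.
Qed.

End Deviation.

(** * The deviation bound along one trajectory *)

Section PathDeviation.
Context (R : realType).

(** The dense vectors are shorter than [lam], so the bound must increase with the length; the factor
    [l ^+ 2] absorbs the decreasing term [l^-1] of [mgf_coef1]. *)
Lemma exponent_bound_le (l lam s op tr u rho y0 L : R) :
  0 < l -> l <= lam -> lam < 3 -> 0 <= s -> 0 <= op -> 0 <= tr -> 0 <= u * rho ->
  y0 <= L ->
  mgf_coef1 l s * (op * l ^+ 2) + mgf_coef2 l s * tr + u * rho * (l ^+ 2 / 2) + y0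
  <= (lam * lam * peak lam + 13 / 20 * s * (lam * lam * peak lam + lam)) * (op / 2)
     + (1 + 3 / 10 * s) * (1 + lam / 2) * (s * (tr / 2))
     + u * rho * (lam * lam / 2) + L.
Proof.
move=> l0 llam lam3 s0 op0 tr0 ur0 yL.
have lam0 : 0 < lam by exact: lt_le_trans llam.
have ll : l * l <= lam * lam by apply: ler_pM => //; exact: ltW.
have pl0 : 0 <= peak l by apply: peak_ge0; rewrite (le_trans llam)// ltW.
have p : l * l * peak l <= lam * lam * peak lam.
  by apply: ler_pM => //; [apply: mulr_ge0; exact: ltW|exact: peak_le].
have -> : mgf_coef1 l s * (op * l ^+ 2) =
    (l * l * peak l + 13 / 20 * s * (l * l * peak l + l)) * (op / 2).
  by rewrite /mgf_coef1; field; rewrite gt_eqF.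
have -> : mgf_coef2 l s * tr = (1 + 3 / 10 * s) * (1 + l / 2) * (s * (tr / 2)).
  by rewrite /mgf_coef2; field.
apply: lerD => //; apply: lerD; first apply: lerD.
- apply: ler_wpM2r; first by rewrite divr_ge0.
  by apply: lerD => //; apply: ler_wpM2l; [rewrite mulr_ge0|exact: lerD].
- apply: ler_wpM2r; first by rewrite mulr_ge0// divr_ge0.
  apply: ler_wpM2l; first by rewrite addr_ge0// mulr_ge0.
  by rewrite lerD2l ler_pM2r.
- by rewrite ler_wpM2l// expr2 ler_pM2r.
Qed.

Context (H : completeNormedModType R) (dot : {dot H for idfun}).
Hypothesis hdot : induces_norm dot.
Context (z : nat -> H) (S : H) (y op tr : R).
Hypotheses (dz : forall x (eps : R), 0 < eps -> exists m, `|x - z m| < eps)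
  (op0 : 0 <= op) (tr0 : 0 <= tr).
Hypothesis linear_bound : forall m rho u,
  1 <= rho -> 1 < u -> 0 < `|z m| < 3 ->
  dot (z m) S <= mgf_coef1 `|z m| rho^-1 * (Num.min op tr * `|z m| ^+ 2)
    + mgf_coef2 `|z m| rho^-1 * tr + u * rho * (`|z m| ^+ 2 / 2)
    + (y - ln (2 * (varpi_tail rho - varpi_tail (u * rho)))).

Lemma norm_le_deviation_bound : `|S| <= deviation_bound y tr op.
Proof.
apply: lb_le_inf.
  (* A lower bound is below [inf] only for a nonempty set; [u = 2] is a witness. *)
  by exists (Num.sqrt (4 * 2 * Num.max tr (Num.max 1 op * Lterm y tr 2)
    + 2 * 2 * tr) + Lterm y tr 2 / Num.sqrt 2); exists 2 => //=; rewrite ltr1n.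
move=> _ [u /= u1 <-].
have L1 : 1 <= Lterm y tr u by rewrite /Lterm le_max lexx.
have [rho [lam [r1 rt /andP[lam0 lam32] opt]]] :=
  deviation_optimization op0 tr0 L1 (ltW u1).
rewrite -(@ler_pM2l _ lam)//; apply: le_trans opt.
have lam3 : lam < 3 by rewrite (le_lt_trans lam32)// ltr_pdivrMr// -natrM ltr_nat.
have o0 : 0 <= Num.min op tr by rewrite le_min op0.
have s0 : 0 <= rho^-1 by rewrite invr_ge0 (le_trans ler01).
have ur0 : 0 <= u * rho by rewrite mulr_ge0// (le_trans ler01)// ltW.
have pl0 : 0 <= peak lam by apply: peak_ge0; exact: ltW.
apply: (norm_le_of_dense hdot dz lam0) => //.
  have l2 : 0 <= lam * lam * peak lam.
    by apply: mulr_ge0 => //; apply: mulr_ge0; exact: ltW.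
  apply: addr_ge0; last by rewrite subr_ge0 (le_trans _ L1)// ler_pdivrMr// mul1r ler_nat.
  apply: addr_ge0; last by rewrite mulr_ge0// divr_ge0// mulr_ge0// ltW.
  apply: addr_ge0; apply: mulr_ge0.
  - apply: addr_ge0 => //; apply: mulr_ge0; first by rewrite mulr_ge0.
    by rewrite addr_ge0// ltW.
  - by rewrite divr_ge0.
  - apply: mulr_ge0; first by rewrite addr_ge0// mulr_ge0.
    by rewrite addr_ge0// divr_ge0// ltW.
  - by rewrite mulr_ge0// divr_ge0.
move=> m /andP[zm0 zml].
have zm3 : 0 < `|z m| < 3 by rewrite zm0 (lt_trans zml).
apply: (le_trans (linear_bound r1 u1 zm3)).
by apply: exponent_bound_le => //; [exact: ltW|exact: Lterm_ge].
Qed.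

End PathDeviation.

(** * Trace and quadratic form of the quadratic variation *)

Section QuadraticVariation.
Context (R : realType) (H : completeNormedModType R) (dot : {dot H for idfun}).
Hypothesis hdot : induces_norm dot.

(** The bound [b] makes the nondecreasing partial sums converge, so that [limn] is an actual
    limit. *)
Lemma trace_ge_partial (A : H -> H) (b : R) (N : nat) :
  (forall i, 0 <= dot (onb dot i) (A (onb dot i))) ->
  (forall m, \sum_(i < m) dot (onb dot i) (A (onb dot i)) <= b) ->
  \sum_(i < N) dot (onb dot i) (A (onb dot i)) <= trace dot A.
Proof.
move=> A0 Ab.
have E m : trace_series dot A m = \sum_(i < m) dot (onb dot i) (A (onb dot i)).
  by rewrite /trace_series /series/= big_mkord.
have nd : nondecreasing_seq (trace_series dot A).
  by apply/nondecreasing_seqP => m; rewrite !E big_ord_recr/= lerDl.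
rewrite -E; apply: nondecreasing_cvgn_le => //.
apply: nondecreasing_is_cvgn => //.
by exists b => _ [m _ <-]; rewrite E.
Qed.

Lemma bounded_linear_sum (n : nat) (A : nat -> H -> H) :
  (forall k, bounded_linear (A k)) ->
  bounded_linear (fun h => \sum_(k < n) A k h).
Proof.
move=> bA; split.
  move=> a u v; rewrite scaler_sumr -big_split/=.
  by apply: eq_bigr => k _; exact: (bA k).1.
have /choice[K hK] : forall k, exists K : R, forall x, `|A k x| <= K * `|x|.
  by move=> k; exact: (bA k).2.
exists (\sum_(k < n) K k) => x; apply: (le_trans (ler_norm_sum _ _ _)).
by rewrite mulr_suml; exact: ler_sum.
Qed.

Context (C : nat -> H -> H) (n : nat).
Hypotheses (bC : forall k, bounded_linear (C k))
  (C0 : forall k i, 0 <= dot (onb dot i) (C k (onb dot i)))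
  (C1 : forall k m, \sum_(i < m) dot (onb dot i) (C k (onb dot i)) <= 1).
Let V h := \sum_(k < n) C k h.

Lemma sum_trace_le N :
  \sum_(k < n) \sum_(i < N) dot (onb dot i) (C k (onb dot i)) <= trace dot V.
Proof.
have E m : \sum_(k < n) \sum_(i < m) dot (onb dot i) (C k (onb dot i)) =
    \sum_(i < m) dot (onb dot i) (V (onb dot i)).
  by rewrite exchange_big/=; apply: eq_bigr => i _; rewrite /V dot_sumr.
rewrite E; apply: (@trace_ge_partial _ n%:R).
  by move=> i; rewrite /V dot_sumr sumr_ge0.
move=> m; rewrite -E; apply: (@le_trans _ _ (\sum_(k < n) 1)).
  by apply: ler_sum => k _; exact: C1.
by rewrite sumr_const card_ord.
Qed.

Lemma trace_ge0 : 0 <= trace dot V.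
Proof.
apply: le_trans (sum_trace_le 0).
by apply: sumr_ge0 => k _; rewrite big_ord0.
Qed.

Lemma sum_proj_le v N :
  orthonormal_seq dot (onb dot) ->
  (forall k, dot (partial_proj dot (onb dot) N v) (C k (partial_proj dot (onb dot) N v))
    <= `|v| ^+ 2 * \sum_(i < N) dot (onb dot i) (C k (onb dot i))) ->
  \sum_(k < n) dot (partial_proj dot (onb dot) N v) (C k (partial_proj dot (onb dot) N v))
    <= Num.min (opnorm V) (trace dot V) * `|v| ^+ 2.
Proof.
move=> oe Cv; rewrite minr_pMl ?sqr_ge0// le_min; apply/andP; split.
  rewrite -dot_sumr -/(V _).
  apply: (le_trans (dot_le_opnorm hdot _ (bounded_linear_sum n bC))).
  by rewrite ler_wpM2l ?opnorm_ge0// ler_pXn2r ?nnegrE// norm_partial_proj_le.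
apply: (@le_trans _ _ (\sum_(k < n) `|v| ^+ 2 *
    \sum_(i < N) dot (onb dot i) (C k (onb dot i)))).
  by apply: ler_sum => k _; exact: Cv.
by rewrite -mulr_sumr mulrC ler_wpM2r ?sqr_ge0// sum_trace_le.
Qed.

End QuadraticVariation.

(** * Assembly of the probabilistic and deterministic parts *)

Theorem mainTheorem9 (R : realType) (H : completeNormedModType R)
    (dot : {dot H for idfun}) (hdot : induces_norm dot) (hsep : separable H)
    (d : measure_display) (T : measurableType d) (P : probability T R)
    (F : nat -> set (set T)) (M : nat -> T -> H)
    (hM : martingale P F M)
    (hM0 : {ae P, forall w, M 0%N w = 0})
    (hX0 : forall n : nat, (0 < n)%N ->
       is_bochner_cond_exp P (F n.-1) (increment M n) (fun=> 0))
    (hX1 : forall n : nat, (0 < n)%N -> {ae P, forall w, `|increment M n w| <= 1})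
    (C : nat -> T -> H -> H)
    (hC : forall n : nat, (0 < n)%N ->
       is_cond_cov dot P (F n.-1) (increment M n) (C n))
    (y : R) (hy : 0 <= y) :
  exists Omega : set T,
    [/\ measurable Omega,
        ((1 - expR (- y))%:E <= P Omega)%E
      & forall w, Omega w -> forall n : nat, (0 < n)%N ->
          `|M n w| <= deviation_bound y (trace dot (pqv C n w)) (opnorm (pqv C n w))].
Proof.
(* With this shift [X k] is centered given [F k] and has conditional covariance [C k.+1]. *)
pose e := onb dot; pose X k := increment M k.+1.
have fF : filtration F by case: hM.
have sG k := fF.1 k.
have oe : orthonormal_seq dot e by exact: onb_orthonormal.
have [z dz] := dense_sequence hsep.
have X0 k : is_bochner_cond_exp P (F k) (X k) (fun=> 0) by exact: (hX0 k.+1).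
have X1 k : {ae P, forall w, `|X k w| <= 1} by exact: (hX1 k.+1).
have XC k : is_cond_cov dot P (F k) (X k) (C k.+1) by exact: (hC k.+1).
have hD0 k h := cond_mgf_exists hdot (sG k) (X0 k) h.
pose D k h := sval (cid (hD0 k h)).
have hD k h := svalP (cid (hD0 k h)).
have mX k h : measurable_wrt (F k.+1) (fun w => clipped_exp dot h (X k w)).
  have mM i : (i <= k.+1)%N -> F i `<=` F k.+1 ->
      measurable_wrt (F k.+1) (fun w => dot h (M i w)).
    move=> ik Fi; have [_ mMi _ _] := hM.
    have := @borel_wrt_continuous _ _ _ _ _ _ _ (@continuous_dot _ _ _ hdot h) (mMi i).
    move=> /(measurable_wrtP (sG i)) mi.
    by apply/(measurable_wrtP (sG k.+1)) => B /mi; exact: Fi.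
  (* The difference of martingale values is taken after the scalar product, where subtraction is
     that of real functions. *)
  have mXk : measurable_wrt (F k.+1) (fun w => dot h (X k w)).
    rewrite /X /increment; under eq_fun do rewrite dotBr.
    apply: (@measurable_funB _ (g_sigma_algebraType (F k.+1))).
      exact: mM.
    by apply: mM; [exact: leqnSn|exact: fF.2].
  apply: (@measurableT_comp _ _ _ (g_sigma_algebraType (F k.+1)) _ _ expR).
    exact: measurable_expR.
  by apply: measurable_maxr => //; apply: measurable_minr.
pose J N := ('I_(N.+1 * N.+1) * {ffun 'I_N.+1 * 'I_N.+1 -> bool})%type.
pose h N (j : J N) := sign_dir e (grid R N j.1.+1) j.2.
pose p N (j : J N) : R := grid_weight R N j.1 * 2^-1 ^+ #|{: 'I_N.+1 * 'I_N.+1}|.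
have p0 N (j : J N) : 0 <= p N j.
  by rewrite mulr_ge0 ?exprn_ge0 ?invr_ge0// ltW// grid_weight_gt0.
have p1 N : \sum_j p N j <= 1.
  rewrite -(pair_bigA _ (fun (j : 'I_(N.+1 * N.+1))
      (_ : {ffun 'I_N.+1 * 'I_N.+1 -> bool}) =>
    grid_weight R N j * 2^-1 ^+ #|{: 'I_N.+1 * 'I_N.+1}|))/=.
  under eq_bigr => j _.
    rewrite sumr_const card_ffun card_bool -(mulr_natr (_ * _)) natrX -mulrA -exprMn.
    rewrite mulVf ?pnatr_eq0// expr1n mulr1.
    over.
  exact: sum_grid_weight_le1.
(* A trajectory outside the [liminf] of the sets [bad N] satisfies the bound of
   level [N] for infinitely many [N], which is enough to let [N] tend to [+oo]. *)
pose bad N := [set w | exists n, expR y < exp_mixture dot X (p N) (@h N)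
  (fun k j => D k (h N j)) n w].
have badP N : measurable (bad N) /\ (P (bad N) <= (expR (- y))%:E)%E.
  rewrite expRN; apply: (exp_mixture_ville (F := F)) => //; last exact: expR_gt0.
  by move=> k j; exact: hD.
have [mB PB] := liminf_measure_le (fun N => (badP N).1) (fun N => (badP N).2).
pose good w := [/\ (forall k, `|X k w| <= 1), M 0 w = 0,
  (forall k i, 0 <= dot (e i) (C k.+1 w (e i))),
  (forall k m, \sum_(i < m) dot (e i) (C k.+1 w (e i)) <= 1) &
  (forall k N m, dot (partial_proj dot e N (z m)) (C k.+1 w (partial_proj dot e N (z m)))
     <= `|z m| ^+ 2 * \sum_(i < N) dot (e i) (C k.+1 w (e i)))].
pose mgf w := forall k N j m, 0 < `|z m| < 3 -> grid R N j.+1 * `|z m| ^+ 2 < N.+1%:R ->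
    \sum_(xi : {ffun 'I_N.+1 * 'I_N.+1 -> bool})
       sign_weight (sign_bias dot e (grid R N j.+1) (z m)) xi *
       D k (sign_dir e (grid R N j.+1) xi) w
    <= 1 + mgf_coef1 `|z m| (grid R N j.+1)^-1 *
           dot (partial_proj dot e N.+1 (z m)) (C k.+1 w (partial_proj dot e N.+1 (z m)))
         + mgf_coef2 `|z m| (grid R N j.+1)^-1 *
           \sum_(i < N.+1) dot (e i) (C k.+1 w (e i)).
(* All indices are natural numbers, including the one of the direction [z m], so countably many null
   sets suffice. *)
have aegood : {ae P, forall w, good w /\ mgf w}.
  have ae1 := ae_forall X1.
  have ae2 := ae_forall (fun k => ae_forall (fun i =>
    cond_cov_ge0 (sG k) (X1 k) (XC k) (e i))).
  have ae3 := ae_forall (fun k => ae_forall (fun m =>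
    cond_cov_sum_le1 hdot (sG k) (X1 k) (XC k) oe m)).
  have ae4 := ae_forall (fun k => ae_forall (fun N => ae_forall (fun m =>
    cond_cov_proj_le hdot (sG k) (X1 k) (XC k) oe N (z m)))).
  have ae5 : {ae P, forall w, mgf w}.
    apply: ae_forall => k; apply: ae_forall => N; apply: ae_forall => j.
    apply: ae_forall => m.
    have [zm|nzm] := boolP (0 < `|z m| < 3); last by apply: aeW ae1.
    have [gm|ngm] := boolP (grid R N j.+1 * `|z m| ^+ 2 < N.+1%:R); last first.
      by apply: aeW ae1.
    have := cond_mgf_mixture_le hdot (sG k) (X0 k) (X1 k) (XC k)
      (q := sign_weight (sign_bias dot e (grid R N j.+1) (z m)))
      (h := fun xi => sign_dir e (grid R N j.+1) xi)
      (D := fun xi => D k (sign_dir e (grid R N j.+1) xi))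
      (v := partial_proj dot e N.+1 (z m)) (n := N.+1) (fun xi => hD k _)
      (fun x x1 => sign_dir_mgf hdot oe (grid_ge1 R N j.+1) zm gm x1).
    by apply: aeW => w + _ _.
  apply: aeW (ae_and ae1 (ae_and hM0 (ae_and ae2 (ae_and ae3 (ae_and ae4 ae5))))).
  by move=> w [? [? [? [? [? ?]]]]].
(* Negligibility provides a measurable null set [A] containing every trajectory that violates [good]
   or [mgf]. *)
have [A [mA A0 gA]] := aegood.
exists (~` (\bigcup_k \bigcap_(N in [set N | (k <= N)%N]) bad N `|` A)); split.
- by apply: measurableC; exact: measurableU.
- rewrite probability_setC; last exact: measurableU.
  rewrite EFinB leeB//; apply: le_trans (measureU2 _ mB mA) _.
  rewrite -[leRHS]adde0; apply: leeD; first exact: PB.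
  by rewrite le_eqVlt; apply/orP; left; apply/eqP; exact: A0.
move=> w /not_orP[nB nA] n n0.
have [[Xw M0 C0 C1 Cp] mg] : good w /\ mgf w by apply: contrapT => ng; apply: nA; apply: gA.
have MS : M n w = \sum_(k < n) X k w.
  by rewrite -(big_mkord xpredT (fun k => X k w)) telescope_sumr// M0 subr0.
have VE : pqv C n w = fun h => \sum_(k < n) C k.+1 w h.
  by apply/funext => x; rewrite /pqv big_add1/= big_mkord.
have bC k : bounded_linear (C k.+1 w) by case: ((XC k).1 w).
rewrite VE MS.
have tr0 := @trace_ge0 _ _ dot (fun k => C k.+1 w) n C0 C1.
apply: (norm_le_deviation_bound hdot dz) => //; first exact: opnorm_ge0.
move=> m rho u r1 u1 zm.
apply: (path_linear_bound hdot oe _ _ tr0 Xw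
  (D := fun N k j xi => D k (sign_dir e (grid R N j.+1) xi) w)
  _ _ _ r1 u1 zm) => //.
- by move=> x; exact: onb_cvg.
- by rewrite le_min opnorm_ge0.
- move=> N k j xi.
  have [_ /(_ w)/andP[+ _] _] := hD k (sign_dir e (grid R N j.+1) xi).
  by apply: lt_le_trans; exact: expR_gt0.
- by move=> N; exact: (@sum_trace_le _ _ dot (fun k => C k.+1 w)).
- move=> K; apply: contrapT => nK; apply: nB; exists K => // N /= KN.
  apply: contrapT => nbN; apply: nK; exists N => //.
  rewrite leNgt; apply/negP => lt; apply: nbN; exists n.
  move: lt; rewrite /exp_mixture /p.
  rewrite -(pair_bigA _ (fun (j : 'I_(N.+1 * N.+1))
      (xi : {ffun 'I_N.+1 * 'I_N.+1 -> bool}) =>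
    grid_weight R N j * 2^-1 ^+ #|{: 'I_N.+1 * 'I_N.+1}| *
    exp_process dot X (@h N) (fun k j => D k (h N j)) (j, xi) n w))/=.
  move=> lt; apply: (lt_le_trans lt); rewrite le_eqVlt; apply/orP; left; apply/eqP.
  apply: eq_bigr => j _; rewrite mulr_sumr; apply: eq_bigr => xi _.
  by rewrite mulrA.
- by move=> N k j gN; exact: mg.
- by move=> N; exact: (@sum_proj_le _ _ dot hdot (fun k => C k.+1 w)).
Qed.
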